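(* Let $U\sim\mathrm{Unif}[\alpha,\beta]$ for some $0\le\alpha<\beta$ and let $r\in\mathbb{R}\setminus\{0\}$. Then $U^r$ has a tower distribution if and only if $1\in[\alpha,\beta]$ and $r\in\left[0,\frac{1}{1+\log\beta}\right]$. When these conditions hold, the inverse tower distribution of $U^r$ has distribution function given by $$F(x)=\begin{cases}\dfrac{x^{\beta^r/r}}{\beta}\left(1-\beta^r\log x\right)-\dfrac{\alpha}{\beta}+\dfrac{\alpha}{\beta}F\left(x^{\beta^r/\alpha^r}\right) & x\in[\alpha^{r/\beta^r},\beta^{r/\beta^r})\setminus\{1\}\\ 0 & x<\alpha^{r/\beta^r}\\ 1 & x\ge\beta^{r/\beta^r}\\ \dfrac{1-\alpha}{\beta-\alpha} & x=1,\end{cases}$$ where $\frac{\alpha}{\beta}F\left(x^{\beta^r/\alpha^r}\right)$ is interpreted as $0$ when $\alpha=0$.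
   Context: A random variable $T$ is said to have a tower distribution if there exists an i.i.d. sequence $\{A_i\}_{i\ge 1}$ of positive real random variables such that the power towers $T_n=A_1^{A_2^{\cdots^{A_n}}}$ (evaluated from the top down) converge almost surely to a finite limit as $n\to\infty$ and this limit, denoted $A_1^{A_2^{A_3^{\cdots}}}$, has the same distribution as $T$. In that case the distribution of $A_i$ is called the inverse tower distribution of $T$. When $\alpha=0$, the value of the first-case formula at $x=0$ is understood as its limit $x\to 0^+$. *)

(* Defs.v *)
From HB Require Import structures.
From mathcomp Require Import all_boot all_order all_algebra.
From mathcomp Require Import all_classical all_reals all_analysis.
From mathcomp Require Import measurable_realfun.

Set Implicit Arguments.
Unset Strict Implicit.
Unset Printing Implicit Defensive.

Import Order.TTheory GRing.Theory Num.Theory.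
Import numFieldNormedType.Exports.

Local Open Scope classical_set_scope.
Local Open Scope ring_scope.

(* With 0-based indices, tower a n = a_0 ^ (a_1 ^ (... ^ a_(n-1))); in
   particular tower a 1 = a_0 `^ 1, which is a_0 when a_0 >= 0. *)
Fixpoint tower (R : realType) (a : nat -> R) (n : nat) : R :=
  if n is m.+1 then a 0%N `^ tower (fun i => a i.+1) m else 1.

Definition mutually_independent (R : realType) (d : measure_display)
    (Omega : measurableType d) (P : probability Omega R)
    (A : nat -> {RV P >-> R}) : Prop :=
  forall (J : seq nat) (B : nat -> set R),
    uniq J -> (forall i, measurable (B i)) ->
    P (\bigcap_(i in [set` J]) (A i @^-1` B i)) =
    (\prod_(i <- J) P (A i @^-1` B i))%E.

Definition iid_with_law (R : realType) (d : measure_display)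
    (Omega : measurableType d) (P : probability Omega R)
    (A : nat -> {RV P >-> R}) (nu : probability R R) : Prop :=
  mutually_independent A /\
  forall i (B : set R), measurable B -> distribution P (A i) B = nu B.

(* The sequence A need not live on the probability space of T: only the law
   of T matters. The limit L is real-valued, hence finite. *)
Definition inverse_tower_distribution (R : realType) (d : measure_display)
    (Omega : measurableType d) (P : probability Omega R) (T : {RV P >-> R})
    (nu : probability R R) : Prop :=
  exists (d' : measure_display) (Omega' : measurableType d')
         (P' : probability Omega' R) (A : nat -> {RV P' >-> R})
         (L : {RV P' >-> R}),
    [/\ iid_with_law A nu,
        forall i w, 0 < A i w,
        {ae P', forall w, tower (fun i => A i w) n @[n --> \oo] --> L w} &
        forall B : set R, measurable B ->
          distribution P' L B = distribution P T B].

Definition has_tower_distribution (R : realType) (d : measure_display)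
    (Omega : measurableType d) (P : probability Omega R) (T : {RV P >-> R}) :
    Prop :=
  exists nu : probability R R,
    inverse_tower_distribution T nu.

Definition uniformly_distributed (R : realType) (d : measure_display)
    (Omega : measurableType d) (P : probability Omega R) (U : {RV P >-> R})
    (a b : R) (ab : a < b) : Prop :=
  forall B : set R, measurable B -> distribution P U B = uniform_prob ab B.

Section rv_powR.
Context (R : realType) (d : measure_display) (Omega : measurableType d).
Context (P : probability Omega R).

(* For r < 0 this takes the value 0 where U vanishes, by the convention
   0 `^ r = 0; this is a null event when U is uniform. *)
Definition powR_fun (U : {RV P >-> R}) (r : R) : Omega -> R :=
  fun w => U w `^ r.

Lemma measurable_powR_fun (U : {RV P >-> R}) (r : R) :
  measurable_fun [set: Omega] (powR_fun U r).
Proof. exact: (measurableT_comp (measurable_powR r)). Qed.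

HB.instance Definition _ (U : {RV P >-> R}) (r : R) :=
  isMeasurableFun.Build _ _ _ _ (powR_fun U r) (measurable_powR_fun U r).

Definition rv_powR (U : {RV P >-> R}) (r : R) : {RV P >-> R} := powR_fun U r.

End rv_powR.

Definition main_branch (R : realType) (a b r : R) (F : R -> R) (x : R) : R :=
  x `^ (b `^ r / r) / b * (1 - b `^ r * ln x) - a / b
  + (if a == 0 then 0 else a / b * F (x `^ (b `^ r / a `^ r))).

(* 0 lies in the range of the main branch only when a = 0, and main_branch
   does not depend on F in that case. *)
Record inverse_tower_cdf_eqn (R : realType) (a b r : R) (F : R -> R) : Prop := {
  cdf_main : forall x,
    x \in `[a `^ (r / b `^ r), b `^ (r / b `^ r)[ -> x != 1 -> x != 0 ->
    F x = main_branch a b r F x;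
  cdf_main0 : a = 0 -> main_branch a b r F y @[y --> 0^'+] --> F 0;
  cdf_below : forall x, x < a `^ (r / b `^ r) -> F x = 0;
  cdf_above : forall x, b `^ (r / b `^ r) <= x -> F x = 1;
  cdf_one : F 1 = (1 - a) / (b - a)
}.

(* Main.v *)
From HB Require Import structures.
Require Import Defs.
From mathcomp Require Import all_boot all_order all_algebra.
From mathcomp Require Import all_classical all_reals all_analysis.
From mathcomp Require Import measurable_realfun ring lra zify.

Set Implicit Arguments.
Unset Strict Implicit.
Unset Printing Implicit Defensive.

Import Order.TTheory GRing.Theory Num.Theory.
Import numFieldNormedType.Exports.

Local Open Scope classical_set_scope.
Local Open Scope ring_scope.

(** Let [V] be uniform on [[a, b]].

    NECESSITY. If the towers over an i.i.d. sequence with law [nu] converge to a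
    limit distributed as [V `^ r], that law is a fixed point: [A `^ (V `^ r)] is
    distributed as [V `^ r] when [A] has law [nu] and is independent of [V]
    ([tower_limit_fixpoint]). Put [G] for the distribution function of [ln A / r].
    Taking logarithms, [V `^ r * (ln A / r)] is distributed as [ln V], that is,
    [\int_a^b G (v `^ (- r) * y) dv = clamp a b (expR y) - a] for all [y]
    ([log_law_integral]). Comparing the equations at [y] and at
    [t `^ (- r) * y], and letting [t] tend to [1], differentiates it into
    [b * G (b `^ (- r) * y) - a * G (a `^ (- r) * y) = phi y - a], where
    [phi y = expR y * (1 - r * y)] and [a <= expR y < b] ([functional_eq]).
    Near the ends of this range one of the two terms is constant, so that [phi]
    has to be monotone there; this excludes [1 < a] and bounds [r], and when
    [r < 0] it forces the bases to be at most [expR (expR (- 1))], which keeps the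
    towers below [expR 1] while [V `^ r] exceeds it ([neg_exponent_tower]). When
    [r > 0] and [b <= 1], iterating the equation expresses [G] as a finite sum of
    rescaled copies of [phi]. If [b < 1] that sum would be constant on an
    interval, which an exponential sum cannot be ([small_base]); if [b = 1] its
    monotonicity forces [r <= 1] ([unit_top]). In terms of the distribution
    function of [A], the functional equation is the equation of the statement
    ([cdf_eqn_of_log]), and its solution is unique because the recursion leaves
    the range after finitely many steps ([cdf_eqn_unique]).

    SUFFICIENCY. When [a <= 1 <= b] and [r * (1 + ln b) <= 1], the function
    [(phi - a) / (b - a)] is a distribution function on the range, and a geometric
    mixture of rescaled copies of it solves the functional equation
    ([tower_cdf_FE]). Integrating the functional equation along
    [s `^ (- r) * y] gives back the integral equation
    ([integral_of_functional_eq]), hence the fixed point property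
    ([inverse_law_fixpoint]). An i.i.d. sequence with this law is built on the
    unit interval: the even and odd binary digits of a uniform number form two
    independent uniform numbers ([digits_independent]), and the step is iterated
    on the second one. Two floors [x `^ (y `^ s)] of the tower are Lipschitz in
    the seed [s] with constant [C * `|ln y|] ([two_floors_lipschitz]). The fixed
    point property factors log-moments, [E |ln V^r| = E |ln A| * E V^r], and an
    estimate of the two sides gives [C * E |ln A| < 1]
    ([inverse_law_log_moment]). So the towers contract on average and converge to
    a limit that forgets the seed ([seeded_tower_cvg]); starting from a seed with
    the law of [V `^ r], which every floor preserves, identifies the law of the
    limit ([tower_limit_law]). *)

(** * Laws on the line *)

Lemma measure_eq_cdf (R : realType) (m1 m2 : {measure set R -> \bar R}) :
  (m1 setT < +oo)%E -> m1 setT = m2 setT ->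
  (forall x, m1 `]-oo, x]%classic = m2 `]-oo, x]%classic) ->
  forall B : set R, measurable B -> m1 B = m2 B.
Proof.
move=> fin1 mT h B mB.
have fin (m : {measure set R -> \bar R}) S : (m setT < +oo)%E -> measurable S ->
    m S \is a fin_num.
  move=> mfin mS; rewrite ge0_fin_numE//; apply: le_lt_trans mfin.
  by apply: le_measure; rewrite ?inE.
have fin2 : (m2 setT < +oo)%E by rewrite -mT.
apply: (measure_unique (@RGenOInfty.G R) (fun k => `](- k%:R : R), +oo[%classic)) => //.
- exact: RGenOInfty.measurableE.
- move=> _ _ [x ->] [y ->]; exists (Num.max x y).
  apply/seteqP; split => z /=; rewrite !in_itv/= !andbT gt_max; last by move/andP.
  by move=> [-> ->].
- by move=> i; exists (- i%:R).
- rewrite -subTset => x _; exists (Num.bound `|x|) => //=.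
  rewrite in_itv/= andbT ltrNl; apply: le_lt_trans (archi_boundP (normr_ge0 x)).
  by rewrite -normrN ler_norm.
- move=> _ [x ->]; rewrite -setCitvl.
  have e (m : {measure set R -> \bar R}) : (m setT < +oo)%E ->
      m (~` `]-oo, x]%classic) = (m setT - m `]-oo, x]%classic)%E.
    move=> mfin; rewrite -(setUv `]-oo, x]%classic) measureU//; last 2 first.
      by apply: measurableC.
      by rewrite setICr.
    by rewrite addeAC subee ?add0e// fin.
  by apply: etrans (etrans (e m1 fin1) _) (esym (e m2 fin2)); rewrite h mT.
- by move=> k; rewrite -ge0_fin_numE// fin.
Qed.

Lemma prob_eq_cdf (R : realType) (m1 m2 : probability R R) :
  (forall x, m1 `]-oo, x]%classic = m2 `]-oo, x]%classic) ->
  forall B : set R, measurable B -> m1 B = m2 B.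
Proof.
move=> h; apply: measure_eq_cdf => //.
  by rewrite -ge0_fin_numE// fin_num_measure.
by apply: etrans (esym _); exact: probability_setT.
Qed.

(** Packing a function and its measurability, so that laws can be taken. *)
Definition rv d d' (T : measurableType d) (T' : measurableType d') (f : T -> T')
    (mf : measurable_fun setT f) : {mfun T >-> T'} :=
  HB.pack f (isMeasurableFun.Build _ _ _ _ f mf).

Lemma eq_law_integral (R : realType) d1 (T1 : measurableType d1)
  (P1 : probability T1 R) d2 (T2 : measurableType d2) (P2 : probability T2 R)
  d' (T' : measurableType d')
  (X : T1 -> T') (Y : T2 -> T') (g : T' -> \bar R) :
  measurable_fun setT X -> measurable_fun setT Y -> measurable_fun setT g ->
  (forall t, 0 <= g t)%E ->
  (forall B, measurable B -> P1 (X @^-1` B) = P2 (Y @^-1` B)) ->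
  (\int[P1]_w g (X w) = \int[P2]_w g (Y w))%E.
Proof.
move=> mX mY mg g0 XY.
have <- := @ge0_integral_distribution _ _ _ _ _ P1 (rv mX) g mg g0.
have <- := @ge0_integral_distribution _ _ _ _ _ P2 (rv mY) g mg g0.
by apply: eq_measure_integral => B mB _; exact: XY.
Qed.

(** Almost sure convergence implies weak convergence and weak limits are unique.
    The half-lines are reached through the continuous test functions
    [expR (- (k%:R * (`|t - x| + (t - x))))], which decrease to the indicator of
    [t <= x]. *)
Lemma ae_limit_law (R : realType) d1 (T1 : measurableType d1)
  (P1 : probability T1 R) d2 (T2 : measurableType d2) (P2 : probability T2 R)
  (X_ : nat -> T1 -> R) (X : T1 -> R) (Y_ : nat -> T2 -> R) (Y : T2 -> R) :
  (forall n, measurable_fun setT (X_ n)) -> measurable_fun setT X ->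
  (forall n, measurable_fun setT (Y_ n)) -> measurable_fun setT Y ->
  {ae P1, forall w, X_ n w @[n --> \oo] --> X w} ->
  {ae P2, forall w, Y_ n w @[n --> \oo] --> Y w} ->
  (forall n B, measurable B -> P1 (X_ n @^-1` B) = P2 (Y_ n @^-1` B)) ->
  forall B, measurable B -> P1 (X @^-1` B) = P2 (Y @^-1` B).
Proof.
move=> mX_ mX mY_ mY XX YY XY B mB.
have main d (T : measurableType d) (P : probability T R) (f_ : nat -> T -> R)
    (f : T -> R)    (g : R -> R) : (forall n, measurable_fun setT (f_ n)) ->
    measurable_fun setT f -> {ae P, forall w, f_ n w @[n --> \oo] --> f w} ->
    continuous g -> (forall t, 0 <= g t <= 1) ->
    (\int[P]_w (g (f_ n w))%:E)%E @[n --> \oo] --> (\int[P]_w (g (f w))%:E)%E.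
  move=> mf_ mf ff cg g01.
  have mg : measurable_fun setT g by exact: continuous_measurable_fun.
  have := @dominated_convergence _ _ _ P setT measurableT
    (fun n w => (g (f_ n w))%:E) (fun w => (g (f w))%:E) (cst 1%E).
  case => //.
  - by move=> n; apply/measurable_EFinP; exact: measurableT_comp.
  - by apply/measurable_EFinP; exact: measurableT_comp.
  - apply: filterS ff => w fw _; apply: cvg_EFin; first by near=> n.
    by apply: continuous_cvg => //; exact: cg.
  - exact: finite_measure_integrable_cst.
  - by apply: aeW => w n _/=; rewrite lee_fin ger0_norm; case/andP: (g01 (f_ n w)).
have key (g : R -> R) : continuous g -> (forall t, 0 <= g t <= 1) ->
    (\int[P1]_w (g (X w))%:E = \int[P2]_w (g (Y w))%:E)%E.
  move=> cg g01; have mg : measurable_fun setT g by exact: continuous_measurable_fun.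
  have h1 := main _ _ P1 X_ X g mX_ mX XX cg g01.
  have h2 := main _ _ P2 Y_ Y g mY_ mY YY cg g01.
  suff e n : (\int[P1]_w (g (X_ n w))%:E = \int[P2]_w (g (Y_ n w))%:E)%E.
    by rewrite (funext e) in h1; exact: cvg_unique h1 h2.
  apply: (@eq_law_integral _ _ _ P1 _ _ P2 _ _ (X_ n) (Y_ n) (EFin \o g)) => //.
  - by apply/measurable_EFinP.
  - by move=> t; rewrite lee_fin; case/andP: (g01 t).
  - exact: XY.
apply: (@prob_eq_cdf _ (distribution P1 (rv mX)) (distribution P2 (rv mY))) => //.
move=> x; rewrite /distribution/pushforward/=.
pose g k t : R := expR (- (k%:R * (`|t - x| + (t - x)))).
have cg k : continuous (g k).
  move=> t; have dt : (fun t : R => t - x) y @[y --> t] --> t - x.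
    by apply: cvgB; [exact: cvg_id|exact: cvg_cst].
  apply: continuous_cvg; first exact: continuous_expR.
  apply: cvgN; apply: cvgM; first exact: cvg_cst.
  by apply: cvgD => //; exact: cvg_norm.
have d0 t : 0 <= `|t - x| + (t - x) by rewrite -lerBlDr sub0r -normrN ler_norm.
have g01 k t : 0 <= g k t <= 1.
  by rewrite /g expR_ge0/= -[leRHS]expR0 ler_expR oppr_le0 mulr_ge0.
have lim d (T : measurableType d) (P : probability T R) (f : T -> R) :
    measurable_fun setT f ->
    (\int[P]_w (g k (f w))%:E)%E @[k --> \oo] --> P (f @^-1` `]-oo, x]%classic).
  move=> mf.
  have mi : measurable (f @^-1` `]-oo, x]%classic).
    by rewrite -[X in measurable X]setTI; exact: mf.
  rewrite -[X in _ --> P X]setIT -integral_indic//.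
  have := @dominated_convergence _ _ _ P setT measurableT
    (fun k w => (g k (f w))%:E)
    (fun w => (\1_(f @^-1` `]-oo, x]%classic) w)%:E) (cst 1%E).
  case => //.
  - move=> n; apply/measurable_EFinP; apply: measurableT_comp => //.
    exact: continuous_measurable_fun.
  - by apply/measurable_EFinP.
  - apply: aeW => w _; apply: cvg_EFin; first by near=> n.
    rewrite indicE/=; have [wx|xw] := leP (f w) x.
      rewrite mem_set/= ?in_itv//= /g ler0_norm ?subr_le0// addNr.
      by under eq_fun do rewrite mulr0 oppr0 expR0; exact: cvg_cst.
    rewrite memNset/=; last by rewrite in_itv/= leNgt xw.
    under eq_fun do rewrite /g -mulrN expRM_natl.
    apply: cvg_expr; rewrite ger0_norm ?expR_ge0// -[ltRHS]expR0 ltr_expR.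
    by rewrite oppr_lt0 ltr_wpDl// subr_gt0.
  - exact: finite_measure_integrable_cst.
  - by apply: aeW => w n _/=; rewrite lee_fin ger0_norm; case/andP: (g01 n (f w)).
have h1 := lim _ _ P1 X mX; have h2 := lim _ _ P2 Y mY.
have e n : (\int[P1]_w (g n (X w))%:E = \int[P2]_w (g n (Y w))%:E)%E by apply: key.
by rewrite (funext e) in h1; exact: cvg_unique h1 h2.
Unshelve. all: by end_near. Qed.

(** * Power towers of an i.i.d. sequence *)

Lemma measurable_powR2 (R : realType) d (T : measurableType d) (f g : T -> R) :
  measurable_fun setT f -> measurable_fun setT g ->
  measurable_fun setT (fun w => f w `^ g w).
Proof.
move=> mf mg; rewrite /powR.
apply: measurable_fun_ifT.
- by apply: measurable_fun_eqr => //; exact: measurable_cst.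
- rewrite (_ : (fun t => _) = (fun t => if g t == 0 then 1 else 0)).
    by apply: measurable_fun_ifT => //; apply: measurable_fun_eqr.
  by apply/funext => t; case: eqP.
- apply: measurableT_comp => //; apply: measurable_funM => //.
  by apply: measurableT_comp => //; exact: measurable_ln.
Qed.

Definition powp {R : realType} (p : R * R) : R := p.1 `^ p.2.

Lemma measurable_powp (R : realType) : measurable_fun setT (@powp R).
Proof. exact: measurable_powR2. Qed.

Lemma measurable_preimage d d' (T : measurableType d) (T' : measurableType d')
  (f : T -> T') B : measurable_fun setT f -> measurable B -> measurable (f @^-1` B).
Proof. by move=> mf mB; rewrite -[X in measurable X]setTI; exact: mf. Qed.

Lemma measurable_tower (R : realType) d (T : measurableType d) (A : nat -> T -> R) n :
  (forall i, measurable_fun setT (A i)) ->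
  measurable_fun setT (fun w => tower (A^~ w) n).
Proof.
elim: n A => [|n IH] A mA /=; first exact: measurable_cst.
apply: measurable_powR2 => //.
exact: (IH (fun i => A i.+1)).
Qed.

Definition pushm (R : realType) d d' (T : measurableType d) (T' : measurableType d')
    (m : {measure set T -> \bar R}) (f : T -> T') (mf : measurable_fun setT f) :
  {measure set T' -> \bar R} :=
  measure_function_pushforward__canonical__measure_function_Measure m mf.

Lemma prod_measure_eq (R : realType) d1 d2 (T1 : measurableType d1)
    (T2 : measurableType d2) (m1 m2 : {measure set (T1 * T2) -> \bar R}) :
  (m1 setT < +oo)%E ->
  (forall A B, measurable A -> measurable B -> m1 (A `*` B) = m2 (A `*` B)) ->
  forall D, measurable D -> m1 D = m2 D.
Proof.
move=> fin h D mD.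
apply: (measure_unique [set A `*` B | A in measurable & B in measurable]
  (fun=> setT)) => //.
- exact: measurable_prod_measurableType.
- move=> _ _ [A mA [B mB <-]] [A' mA' [B' mB' <-]].
  exists (A `&` A'); first exact: measurableI.
  by exists (B `&` B'); [exact: measurableI|rewrite setXI].
- by move=> _; exists setT => //; exists setT => //; rewrite setXTT.
- by rewrite -subTset => x _; exists 0%N.
- by move=> _ [A mA [B mB <-]]; exact: h.
Qed.

Section iid_towers.
Context (R : realType) d (T : measurableType d) (P : probability T R).
Context (A : nat -> {RV P >-> R}) (nu : probability R R).
Context (iidA : iid_with_law A nu).

Definition prefix_event k (B : nat -> set R) : set T :=
  \bigcap_(i in [set` iota 0 k]) (A i @^-1` B i).

Definition tower_rv k n : T -> R := fun w => tower (fun i => A (k + i)%N w) n.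

Lemma tower_rvE k n w : tower_rv k n.+1 w = powp (A k w, tower_rv k.+1 n w).
Proof.
rewrite /tower_rv /powp /= addn0; congr (_ `^ tower _ n).
by apply/funext => i; rewrite addnS addSn.
Qed.

Lemma measurable_tower_rv k n : measurable_fun setT (tower_rv k n).
Proof. by apply: (@measurable_tower _ _ _ (fun i => A (k + i)%N)) => i. Qed.

Lemma prefix_event0 B : prefix_event 0 B = setT.
Proof. by rewrite -subTset => w _ i; rewrite /= in_nil. Qed.

Lemma prefix_eventS k B : prefix_event k.+1 B = prefix_event k B `&` A k @^-1` B k.
Proof.
apply/seteqP; split=> [w h|w [h1 h2] i]; rewrite /prefix_event/=.
  split; last by apply: h; rewrite /= -[_ \in _]/(k \in iota 0 k.+1) mem_iota ltnS leqnn.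
  move=> i; rewrite /= mem_iota => ik; apply: h.
  by rewrite /= -[_ \in _]/(i \in iota 0 k.+1) mem_iota; lia.
rewrite -[_ \in _]/(i \in iota 0 k.+1) mem_iota leq0n add0n ltnS leq_eqVlt => /orP[/eqP->//|ik].
by apply: h1; rewrite /= mem_iota.
Qed.

Lemma measurable_prefix k B : (forall i, measurable (B i)) ->
  measurable (prefix_event k B).
Proof.
move=> mB; elim: k => [|k IH]; first by rewrite prefix_event0.
by rewrite prefix_eventS; apply: measurableI => //; apply: measurable_preimage.
Qed.

Lemma prefix_event_prob k B : (forall i, measurable (B i)) ->
  P (prefix_event k.+1 B) = (P (prefix_event k B) * nu (B k))%E.
Proof.
case: iidA => ind law mB.
rewrite /prefix_event !ind ?iota_uniq// -addn1 iotaD big_cat/= big_cons big_nil mule1.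
by rewrite add0n -(law k).
Qed.

(** Mutual independence speaks of events on the single variables, not on towers.
    Carrying the whole prefix along is what makes the induction on the height
    go through. *)
Definition tower_indep n := forall k B C,
  (forall i, measurable (B i)) -> measurable C ->
  P (prefix_event k B `&` tower_rv k n @^-1` C) =
  (P (prefix_event k B) * P (tower_rv 0 n @^-1` C))%E.

Lemma tower_indep_step n : tower_indep n -> forall j E C,
  (forall i, measurable (E i)) -> measurable C ->
  P (prefix_event j E `&` tower_rv j n.+1 @^-1` C) =
  (P (prefix_event j E) *
   (nu \x distribution P (rv (measurable_tower_rv 0 n)))%E (powp @^-1` C))%E.
Proof.
move=> IH j E C mE mC; have mpre := measurable_prefix j mE.
have mf : measurable_fun setT (fun w => (A j w, tower_rv j.+1 n w)).
  by apply: measurable_fun_pair => //; exact: measurable_tower_rv.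
pose m1 := pushm (mrestr P mpre) mf.
pose m2 := mscale (NngNum (fine_ge0 (measure_ge0 P (prefix_event j E))))
             (nu \x distribution P (rv (measurable_tower_rv 0 n)))%E.
have mD : measurable (powp @^-1` C) by exact: (measurable_preimage (@measurable_powp R) mC).
have : m1 (powp @^-1` C) = m2 (powp @^-1` C).
  apply: prod_measure_eq mD.
    by rewrite /m1/= /pushforward/mrestr/= -ge0_fin_numE// fin_num_measure// preimage_setT setTI.
  move=> B' C' mB' mC'.
  (* the event on the [j]-th variable joins the prefix *)
  pose E' i := if i == j then B' else E i.
  have mE' i : measurable (E' i) by rewrite /E'; case: ifP.
  have -> : m1 (B' `*` C') = P (prefix_event j.+1 E' `&` tower_rv j.+1 n @^-1` C').
    rewrite prefix_eventS /m1/= /pushforward/mrestr/=.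
    congr (P _); apply/seteqP; split => w /=.
      move=> [[h1 h2] h3]; split=> //; split; last by rewrite /E' eqxx.
      by move=> i /= ij; rewrite /E'; case: eqP => [->//|_]; apply: h3.
    move=> [[h1 h2] h3]; split; first by move: h2; rewrite /E' eqxx.
    move=> i /= ij; have := h1 i ij; rewrite /E'; case: eqP => // e.
    by move: ij; rewrite e mem_iota ltnn andbF.
  rewrite IH// prefix_event_prob//.
  rewrite /m2/= /mscale/= fineK ?fin_num_measure// product_measure1E//.
  rewrite /E' eqxx muleA; congr (P _ * _ * _)%E; apply: eq_bigcapr => i /=.
  by rewrite mem_iota; case: eqP => // ->; rewrite ltnn andbF.
rewrite /m1/m2/= /mscale/= fineK ?fin_num_measure// => <-.
rewrite /pushforward/mrestr setIC; congr (P (_ `&` _)).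
by apply/seteqP; split => w /=; rewrite tower_rvE.
Qed.

(** The tower started at stage [k] is independent of the first [k] variables
    and its law does not depend on [k]. *)
Lemma tower_rv_indep n : tower_indep n.
Proof.
elim: n => [|n IH] k B C mB mC.
  rewrite /tower_rv/= !preimage_cst; case: ifPn => _.
    by rewrite setIT probability_setT mule1.
  by rewrite setI0 measure0 mule0.
rewrite (tower_indep_step IH)//.
have := tower_indep_step IH 0%N (fun=> measurableT) mC.
by rewrite prefix_event0 setTI probability_setT mul1e => <-.
Qed.

(** The law of a tower of height [n.+1] is the law of [a `^ t] for [a] and [t]
    independent, [t] a tower of height [n]. *)
Lemma tower_rvS n C : measurable C ->
  P (tower_rv 0 n.+1 @^-1` C) =
  (nu \x distribution P (rv (measurable_tower_rv 0 n)))%E (powp @^-1` C).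
Proof.
move=> mC.
have := tower_indep_step (@tower_rv_indep n) 0%N (fun=> measurableT) mC.
by rewrite prefix_event0 setTI probability_setT mul1e => <-.
Qed.

End iid_towers.

(** Independent variables stay independent after applying functions. *)
Lemma prod_push (R : realType) d1 d2 (T1 : measurableType d1) (T2 : measurableType d2)
  (P1 : probability T1 R) (P2 : probability T2 R)
  d1' d2' (T1' : measurableType d1') (T2' : measurableType d2')
  (Q1 : probability T1' R) (Q2 : probability T2' R) (f : T1 -> T1') (g : T2 -> T2') :
  measurable_fun setT f -> measurable_fun setT g ->
  (forall B, measurable B -> P1 (f @^-1` B) = Q1 B) ->
  (forall B, measurable B -> P2 (g @^-1` B) = Q2 B) ->
  forall D, measurable D ->
  (P1 \x P2)%E ((fun w => (f w.1, g w.2)) @^-1` D) = (Q1 \x Q2)%E D.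
Proof.
move=> mf mg fQ gQ D mD.
have mfg : measurable_fun setT (fun w : T1 * T2 => (f w.1, g w.2)).
  by apply: measurable_fun_pair; exact: measurableT_comp.
apply: (@prod_measure_eq _ _ _ _ _ (pushm (P1 \x P2)%E mfg) (Q1 \x Q2)%E) => //.
  rewrite /= /pushforward preimage_setT -setXTT product_measure1E//.
  have -> : (P1 [set: T1] * P2 [set: T2] = 1)%E; last exact: ltry.
  by rewrite -[RHS]mule1; congr (_ * _)%E; exact: probability_setT.
move=> A B mA mB.
apply: (etrans (product_measure1E P1 P2 (measurable_preimage mf mA)
  (measurable_preimage mg mB))).
apply: etrans (esym (product_measure1E Q1 Q2 mA mB)).
by congr (_ * _)%E; [exact: fQ|exact: gQ].
Qed.

Lemma ae_prod2 (R : realType) d1 d2 (T1 : measurableType d1) (T2 : measurableType d2)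
  (P1 : probability T1 R) (P2 : probability T2 R) (Q : T2 -> Prop) :
  {ae P2, forall w, Q w} -> {ae (P1 \x P2)%E, forall w, Q w.2}.
Proof.
move=> [N [mN N0 QN]]; exists (setT `*` N); split.
- exact: measurableX.
- by rewrite product_measure1E//; apply/eqP; rewrite mule_eq0; apply/orP; right; apply/eqP.
- by move=> [w1 w2] /= h; split => //; exact: QN.
Qed.

Lemma cvg_powRr (R : realType) (a : R) (u : nat -> R) (l : R) : 0 < a ->
  u n @[n --> \oo] --> l -> a `^ u n @[n --> \oo] --> a `^ l.
Proof.
move=> a0 ul; rewrite /powR gt_eqF//.
by apply: continuous_cvg; [exact: continuous_expR|apply: cvgMl].
Qed.

(** Passing to the limit in [tower_rvS]: the law of the infinite tower is a
    fixed point. *)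
Lemma tower_limit_fixpoint (R : realType) d (T : measurableType d)
  (P : probability T R) (A : nat -> {RV P >-> R}) (nu : probability R R)
  (L : {RV P >-> R}) :
  iid_with_law A nu -> (forall i w, 0 < A i w) ->
  {ae P, forall w, tower (fun i => A i w) n @[n --> \oo] --> L w} ->
  forall C, measurable C ->
  distribution P L C = (nu \x distribution P L)%E (powp @^-1` C).
Proof.
move=> iidA A0 AL C mC.
have AL' : {ae P, forall w, tower_rv A 0 n w @[n --> \oo] --> L w} by exact: AL.
have mA0 : measurable_fun setT (A 0%N) by [].
have mp d' (T' : measurableType d') (f g : T' -> R) :
  measurable_fun setT f -> measurable_fun setT g ->
  measurable_fun setT (fun w => powp (f w, g w)) by exact: measurable_powR2.
have mt n : measurable_fun setT (tower_rv A 0 n) by exact: measurable_tower_rv.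
have lawA0 B : measurable B -> P (A 0%N @^-1` B) = nu B by exact: iidA.2.
have := @ae_limit_law R _ _ (P \x P)%E _ _ P
  (fun n w => powp (A 0%N w.1, tower_rv A 0 n w.2)) (fun w => powp (A 0%N w.1, L w.2))
  (fun n => tower_rv A 0 n.+1) L.
have -> : distribution P L C = P (L @^-1` C) by [].
move=> h; rewrite -h//.
- exact: (@prod_push _ _ _ _ _ P P _ _ _ _ nu (distribution P L) (A 0%N) L _ _ _ _ (powp @^-1` C) (measurable_preimage (@measurable_powp R) mC)).
- by move=> n; apply: mp; exact: measurableT_comp.
- by apply: mp; exact: measurableT_comp.
- apply: filterS (ae_prod2 P AL') => w cw.
  by apply: cvg_powRr.
- by apply: filterS AL' => w cw; rewrite (cvg_shiftS (fun n => tower_rv A 0 n w)).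
- move=> n B mB; rewrite (tower_rvS iidA)//.
  exact: (@prod_push _ _ _ _ _ P P _ _ _ _ nu (distribution P (rv (measurable_tower_rv A 0 n))) (A 0%N) _ _ _ _ _ (powp @^-1` B) (measurable_preimage (@measurable_powp R) mB)).
Qed.

(** * The integral equation for the law of the logarithm *)

Notation mu := lebesgue_measure.

Definition cdfR (R : realType) (kappa : probability R R) (y : R) : R :=
  fine (kappa `]-oo, y]%classic).

Definition clamp (R : realType) (a b x : R) : R := Num.min b (Num.max a x).

Lemma ysection_prod_measure (R : realType) d1 d2 (T1 : measurableType d1)
    (T2 : measurableType d2) (P1 : probability T1 R) (P2 : probability T2 R) D :
  measurable D -> ((P1 \x P2) D = \int[P2]_y P1 (ysection D y))%E.
Proof.
move=> mD; rewrite (@product_measure_unique _ _ _ _ _ P1 P2 (P1 \x^ P2)%E)//.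
by move=> A B mA mB; exact: (product_measure2E P1 P2 mA mB).
Qed.

Lemma cdfR_fin (R : realType) (kappa : probability R R) y :
  (cdfR kappa y)%:E = kappa `]-oo, y]%classic.
Proof. by rewrite /cdfR fineK// fin_num_measure. Qed.

Lemma cdfR_ge0 (R : realType) (kappa : probability R R) y : 0 <= cdfR kappa y.
Proof. by rewrite -lee_fin cdfR_fin. Qed.

Lemma cdfR_le1 (R : realType) (kappa : probability R R) y : cdfR kappa y <= 1.
Proof. by rewrite -lee_fin cdfR_fin probability_le1. Qed.

Lemma cdfR_ndecr (R : realType) (kappa : probability R R) x y : x <= y ->
  cdfR kappa x <= cdfR kappa y.
Proof.
by move=> xy; rewrite -lee_fin !cdfR_fin le_measure ?inE//; exact: subitvPr.
Qed.

Lemma cdfR_rc (R : realType) (kappa : probability R R) x :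
  cdfR kappa y @[y --> x^'+] --> cdfR kappa x.
Proof.
have mid : measurable_fun setT (@id R) by exact: measurable_id.
have := @cdf_right_continuous _ _ _ kappa (rv mid) x.
rewrite /cdf /distribution /pushforward /= preimage_id -cdfR_fin => h.
by apply: fine_cvg h.
Qed.

Lemma measurable_idR (R : realType) :
  @measurable_fun _ _ (measurableTypeR R) R setT (fun x => x).
Proof. by move=> _ B mB; rewrite setTI. Qed.

(** [uniform_prob] lives on the Borel sigma-algebra generated by intervals; its
    image under the identity lives on the measurable type [R]. *)
Definition unif (R : realType) (a b : R) (ab : a < b) : probability R R :=
  distribution (uniform_prob ab) (rv (@measurable_idR R)).

Lemma integral_unif (R : realType) (a b : R) (ab : a < b) (f : R -> \bar R) :
  measurable_fun setT f -> (forall x, 0 <= f x)%E ->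
  (\int[unif ab]_x f x = (b - a)^-1%:E * \int[mu]_(x in `]a, b]) f x)%E.
Proof.
move=> mf f0.
rewrite /unif [LHS](@ge0_integral_distribution _ _ _ _ _ (uniform_prob ab)
  (rv (@measurable_idR R)) f mf f0).
rewrite [LHS](integral_uniform ab mf f0); congr (_ * _)%E.
rewrite integral_itv_obnd_cbnd//; exact: measurable_funTS.
Qed.

Lemma unifE (R : realType) (a b : R) (ab : a < b) (E : set R) : measurable E ->
  unif ab E = ((b - a)^-1%:E * mu (E `&` `]a, b]%classic))%E.
Proof.
move=> mE; rewrite -[E in LHS]setIT -[LHS]integral_indic//.
rewrite integral_unif//; last by apply/measurable_EFinP.
by rewrite integral_indic// setIC.
Qed.

(** [clamp a b x - a] is the length of the part of [[a, b]] below [x], that is,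
    the distribution function of the uniform law up to the factor [b - a]. *)
Lemma lebesgue_clamp (R : realType) (a b x : R) : a < b ->
  mu (`]-oo, x]%classic `&` `]a, b]%classic) = (clamp a b x - a)%:E.
Proof.
move=> ab; rewrite /clamp.
have -> : `]-oo, x]%classic `&` `]a, b]%classic = `]a, Num.min b x]%classic.
  apply/seteqP; split => z /=; rewrite !in_itv/= le_min.
    by move=> [-> /andP[-> ->]].
  by move=> /andP[-> /andP[-> ->]].
rewrite lebesgue_measure_itv/= lte_fin lt_min ab/=.
have [ax|xa] := ltP a x; first by rewrite -EFinB.
by congr EFin; rewrite min_r ?subrr// ltW.
Qed.

Section log_law.
Context (R : realType) (a b r : R) (a_ge0 : 0 <= a) (ab : a < b) (r_neq0 : r != 0).

Definition scaled_le (y : R) : set (R * R) := [set p | p.2 `^ r * p.1 <= y].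

Lemma measurable_scaled_le y : measurable (scaled_le y).
Proof.
have mf : measurable_fun setT (fun p : R * R => p.2 `^ r * p.1).
  apply: (@measurable_funM _ _ _ _ (fun p : R * R => p.2 `^ r) fst).
    by apply: (measurableT_comp (measurable_powR r)); exact: measurable_snd.
  exact: measurable_fst.
rewrite (_ : scaled_le y = (fun p : R * R => p.2 `^ r * p.1) @^-1` `]-oo, y]%classic).
  by apply: measurable_preimage mf _.
by apply/seteqP; split => p /=; rewrite in_itv.
Qed.

(** Conditioning on the uniform variable. *)
Lemma scaled_le_prob (kappa : probability R R) y :
  ((kappa \x unif ab) (scaled_le y) =
   (b - a)^-1%:E * \int[mu]_(v in `]a, b]) (cdfR kappa (v `^ (- r) * y))%:E)%E.
Proof.
rewrite ysection_prod_measure ?measurable_scaled_le//.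
have mG : measurable_fun setT (fun v => kappa (ysection (scaled_le y) v)).
  exact: measurable_fun_ysection (measurable_scaled_le y).
rewrite integral_unif//.
- congr (_ * _)%E; apply: eq_integral => v /[!inE]/= /[!in_itv]/= /andP[av _].
  have v0 : 0 < v by exact: le_lt_trans av.
  rewrite cdfR_fin; congr (kappa _); apply/seteqP; split => l.
    rewrite /ysection/= inE /scaled_le/= in_itv/= powRN.
    by rewrite ler_pdivlMl// powR_gt0.
  rewrite /ysection/= inE /scaled_le/= in_itv/= powRN.
  by rewrite ler_pdivlMl// powR_gt0.
exact: measurable_scaled_le.
Qed.

Definition log_r (x : R) : R := ln x / r.

Lemma measurable_log_r : measurable_fun setT log_r.
Proof.
apply: measurable_funM; last exact: measurable_cst.
exact: measurable_ln.
Qed.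

Definition log_law (nu : probability R R) : probability R R :=
  distribution nu (rv measurable_log_r).

Definition power_law : probability R R :=
  distribution (unif ab) (rv (@measurable_powR R r)).

Lemma measurable_log_r_le y : measurable [set t : R | ln t / r <= y].
Proof.
rewrite (_ : [set t | _] = log_r @^-1` `]-oo, y]%classic).
  by apply: measurable_preimage measurable_log_r _.
by apply/seteqP; split => p /=; rewrite in_itv.
Qed.

(** Logarithms turn [x `^ (v `^ r)] into the product [v `^ r * ln x]. *)
Lemma fixpoint_log_law (nu : probability R R) y :
  (nu \x power_law)%E (powp @^-1` [set t | ln t / r <= y]) =
  (log_law nu \x unif ab)%E (scaled_le y).
Proof.
have mpre := measurable_preimage (@measurable_powp R) (measurable_log_r_le y).
have e1 := @prod_push _ _ _ _ _ nu (unif ab) _ _ _ _ nu power_law id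
  (fun v => v `^ r) (@measurable_id _ _ _) (@measurable_powR R r)
  (fun _ _ => erefl) (fun _ _ => erefl) _ mpre.
have e2 := @prod_push _ _ _ _ _ nu (unif ab) _ _ _ _ (log_law nu) (unif ab) log_r
  id measurable_log_r (@measurable_id _ _ _) (fun _ _ => erefl)
  (fun _ _ => erefl) _ (measurable_scaled_le y).
rewrite -e1 -e2; congr (_ _); apply/seteqP; split => -[x v] /=; rewrite /scaled_le/powp/log_r/=.
  by rewrite ln_powR mulrA.
by rewrite ln_powR mulrA.
Qed.

Lemma power_law_log_le y : power_law [set t | ln t / r <= y] =
  ((b - a)^-1 * (clamp a b (expR y) - a))%:E.
Proof.
have -> : power_law [set t | ln t / r <= y] = unif ab [set u | ln u <= y].
  rewrite /power_law/distribution/pushforward/=; congr (unif ab _).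
  by apply/seteqP; split => u /=; rewrite ln_powR mulrAC divff ?mul1r.
rewrite unifE; last first.
  rewrite (_ : [set u | _] = (@ln R) @^-1` `]-oo, y]%classic).
    by apply: measurable_preimage (@measurable_ln R) _.
  by apply/seteqP; split => p /=; rewrite in_itv.
rewrite EFinM; congr (_ * _)%E; rewrite -lebesgue_clamp//; congr (mu _).
apply/seteqP; split => u [/= h]; rewrite in_itv/= => /andP[au ub].
  have u0 : 0 < u by exact: le_lt_trans au.
  by rewrite !in_itv/= au ub -[u]lnK ?posrE// ler_expR.
have u0 : 0 < u by exact: le_lt_trans au.
by move: h; rewrite /= !in_itv/= au ub -{1}(@lnK _ u) ?posrE// ler_expR.
Qed.

(** Both sides are the probability that [ln t <= r * y] for [t] with law
    [power_law], up to the factor [b - a]. *)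
Lemma log_law_integral (nu : probability R R) :
  (forall C, measurable C -> power_law C = (nu \x power_law)%E (powp @^-1` C)) ->
  forall y, (\int[mu]_(v in `]a, b]) (cdfR (log_law nu) (v `^ (- r) * y))%:E =
    (clamp a b (expR y) - a)%:E)%E.
Proof.
move=> h y.
have mlr := measurable_log_r_le y.
have e : power_law [set t : R | ln t / r <= y] =
    (log_law nu \x unif ab)%E (scaled_le y).
  exact: etrans (h _ mlr) (fixpoint_log_law nu y).
move: e; rewrite power_law_log_le => /esym; rewrite [X in X = _](scaled_le_prob (log_law nu) y) EFinM.
have ba : (b - a)^-1%:E != 0%E by rewrite eqe invr_eq0 subr_eq0 gt_eqF.
by move=> /(congr1 (fun x => ((b - a)%:E * x)%E)); rewrite !muleA -!EFinM divff ?subr_eq0 ?gt_eqF// mul1e mul1r.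
Qed.

End log_law.

(** * Integrals of bounded measurable functions over bounded intervals *)

Lemma lebesgue_affine (R : realType) (k c : R) (A : set (measurableTypeR R)) :
  0 < k -> measurable A -> (mu A = k%:E * mu ((fun x => k * x + c)%R @^-1` A))%E.
Proof.
move=> k0 mA.
have mk : @measurable_fun _ _ (measurableTypeR R) (measurableTypeR R) setT (fun x => k * x + c).
  by apply: (@measurable_funD _ _ R setT ( *%R k) (cst c)) => //; apply: (@measurable_funM _ _ R setT (cst k) id).
pose m' := (mscale (NngNum (ltW k0)) (pushm mu mk) : {measure set (measurableTypeR R) -> \bar R}).
rewrite (@lebesgue_measure_unique _ m')//.
move=> _ [[x y] _ <-] /=.
rewrite /m' /mscale/= /pushforward/=.
have -> : (fun z => k * z + c) @^-1` `]x, y]%classic = `](x - c) / k, (y - c) / k]%classic.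
  by apply/seteqP; split => z /=; rewrite !in_itv/= ltr_pdivrMr// ler_pdivlMr// ltrBlDr lerBrDr mulrC.
rewrite !lebesgue_measure_itv/= !lte_fin ltr_pM2r ?invr_gt0// ltrD2r.
case: ifPn => _; last by rewrite mule0.
by rewrite -!EFinB -EFinM -mulrBl mulrCA divff ?mulr1 ?gt_eqF//; congr EFin; ring.
Qed.

Lemma lebesgue_scale (R : realType) (k : R) (A : set (measurableTypeR R)) :
  0 < k -> measurable A -> (mu A = k%:E * mu (( *%R k) @^-1` A))%E.
Proof.
move=> k0 mA; rewrite (lebesgue_affine 0 k0 mA); congr (_ * mu _)%E.
by apply/seteqP; split => x /=; rewrite addr0.
Qed.

Section bounded_integral.
Context (R : realType).
Implicit Types (f : R -> R) (c d : R).

Lemma bounded_integrable f c d : measurable_fun setT f -> (forall x, 0 <= f x <= 1) ->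
  mu.-integrable `]c, d]%classic (EFin \o f).
Proof.
move=> mf f01; apply: measurable_bounded_integrable => //=.
- by rewrite lebesgue_measure_itv/=; case: ifP => //; rewrite -EFinB ltry.
- exact: measurable_funTS.
- exists 1; split => // M M1 x _ /=; apply: (le_trans _ (ltW M1)).
  by rewrite ger0_norm; case/andP: (f01 x).
Qed.

Lemma Rintegral_chasles f c d e : measurable_fun setT f -> (forall x, 0 <= f x <= 1) ->
  c <= d -> d <= e ->
  (\int[mu]_(x in `]c, e]) f x =
   \int[mu]_(x in `]c, d]) f x + \int[mu]_(x in `]d, e]) f x)%R.
Proof.
move=> mf f01 cd de.
rewrite -Rintegral_setU//.
- by rewrite -itv_bndbnd_setU.
- by rewrite -itv_bndbnd_setU//; exact: bounded_integrable.
- rewrite disj_set2E; apply/eqP; apply/seteqP; split => // z /=.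
  by rewrite !in_itv/= => -[/andP[_ zd] /andP[dz _]]; move: (lt_le_trans dz zd); rewrite ltxx.
Qed.

Lemma Rintegral_bounds f c d m M : measurable_fun setT f -> (forall x, 0 <= f x <= 1) ->
  c <= d -> (forall x, c < x <= d -> m <= f x <= M) ->
  m * (d - c) <= \int[mu]_(x in `]c, d]) f x <= M * (d - c).
Proof.
move=> mf f01 cd h.
have cst_int k : (\int[mu]_(x in `]c, d]) (cst k) x = k * (d - c))%R.
  rewrite Rintegral_cst//= lebesgue_measure_itv/= lte_fin.
  move: cd; rewrite le_eqVlt => /orP[/eqP->|->]; last by rewrite -EFinB.
  by rewrite ltxx subrr.
have fin : (mu `]c, d]%classic < +oo)%E.
  by rewrite lebesgue_measure_itv/=; case: ifP => //; rewrite -EFinB ltry.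
have icst k : mu.-integrable `]c, d]%classic (EFin \o cst k).
  apply: measurable_bounded_integrable => //=.
  exists `|k|; split => // K kK x _ /=; exact: ltW.
apply/andP; split; rewrite -cst_int; apply: le_Rintegral => //.
- exact: bounded_integrable.
- by move=> x /=; rewrite in_itv/= => /h /andP[].
- exact: bounded_integrable.
- by move=> x /=; rewrite in_itv/= => /h /andP[].
Qed.

Lemma Rintegral_scale f c d (k : R) : 0 < k -> measurable_fun setT f -> (forall x, 0 <= f x <= 1) ->
  (\int[mu]_(x in `]k * c, k * d]) f x = k * \int[mu]_(x in `]c, d]) f (k * x))%R.
Proof.
move=> k0 mf f01; have f0 x : 0 <= f x by case/andP: (f01 x).
have mk : @measurable_fun _ _ (measurableTypeR R) (measurableTypeR R) setT (fun x => k * x).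
  by apply: (@measurable_funM _ _ R setT (cst k) id).
rewrite /Rintegral.
have -> : (\int[mu]_(x in `](k * c)%R, (k * d)%R]) (f x)%:E =
    k%:E * \int[mu]_(x in `]c, d]) (f (k * x)%R)%:E)%E.
  pose m' := (mscale (NngNum (ltW k0)) (pushm mu mk) : {measure set (measurableTypeR R) -> \bar R}).
  rewrite (_ : (\int[mu]_(x in _) _)%E = (\int[m']_(x in `](k * c)%R, (k * d)%R]) (f x)%:E)%E); last first.
    by apply: eq_measure_integral => A mA _; exact: lebesgue_scale.
  rewrite ge0_integral_mscale//=; last by move=> x _; rewrite lee_fin.
    congr (_ * _)%E.
    rewrite (@ge0_integral_pushforward _ _ (measurableTypeR R) (measurableTypeR R) _ _ mk mu)//=.
    - rewrite (_ : ( *%R k @^-1` _) = `]c, d]%classic)//.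
      by apply/seteqP; split => z /=; rewrite !in_itv/= ltr_pM2l// ler_pM2l.
    - by apply/measurable_EFinP; exact: measurable_funTS.
    - by move=> x _; rewrite lee_fin.
  by apply/measurable_EFinP; exact: measurable_funTS.
rewrite fineM//; apply: integrable_fin_num => //.
apply: (@bounded_integrable (fun x => f (k * x))) => //.
exact: measurableT_comp.
Qed.

End bounded_integral.

(** * The functional equation *)

Lemma cvg_at_right_shift (R : realType) (G : R -> R) (F : set_system R) (FF : Filter F)
  (h : R -> R) (s : R) :
  G y @[y --> s^'+] --> G s -> h t @[t --> F] --> s -> (\forall t \near F, s < h t) ->
  G (h t) @[t --> F] --> G s.
Proof.
move=> Gs hs sh; apply: cvg_comp Gs => P /= sP.
have : \forall t \near F, s < h t -> P (h t) by exact: hs sP.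
by move=> H; near=> t; apply: (near H t) => //; apply: (near sh t).
Unshelve. all: by end_near. Qed.

Lemma is_derive1_continuous (R : realType) (f : R -> R) (x df : R) :
  is_derive x (1 : R) f df -> {for x, continuous f}.
Proof. by move=> [/derivable1_diffP/differentiable_continuous]. Qed.

Lemma continuous_powRl (R : realType) (p x : R) : 0 < x -> {for x, continuous (fun t => t `^ p)}.
Proof. by move=> /(is_derive1_powR p)/is_derive1_continuous. Qed.

Lemma le_powRl (R : realType) (p x y : R) : 0 < p -> 0 <= x -> x <= y -> x `^ p <= y `^ p.
Proof.
by move=> p0 x0 xy; apply: (ge0_ler_powR (ltW p0)); rewrite ?nnegrE// (le_trans x0).
Qed.

Lemma lt_powRl (R : realType) (p x y : R) : 0 < p -> 0 <= x -> x < y -> x `^ p < y `^ p.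
Proof.
by move=> p0 x0 xy; apply: (gt0_ltr_powR p0); rewrite ?nnegrE// (le_trans x0)// ltW.
Qed.

Lemma one_powR (R : realType) (p : R) : 1 `^ p = 1.
Proof. by rewrite powR1. Qed.

Section functional_equation.
Context (R : realType) (a b r : R) (a_ge0 : 0 <= a) (ab : a < b) (r_neq0 : r != 0).
Context (G : R -> R) (Gnd : {homo G : x y / x <= y}).
Context (G01 : forall x, 0 <= G x <= 1).

Let b_gt0 : 0 < b. Proof. exact: le_lt_trans ab. Qed.

Definition section_cdf y v := G (v `^ (- r) * y).

Lemma measurable_section_cdf y : measurable_fun setT (section_cdf y).
Proof.
have mG : measurable_fun setT G by exact: nondecreasing_measurable.
by apply: (measurableT_comp mG); apply: measurable_funM.
Qed.

Lemma section_cdf01 y v : 0 <= section_cdf y v <= 1.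
Proof. exact: G01. Qed.

(** The part of the integral equation coming from [v] in [`]c, d]]. *)
Definition mixed y c d : R := (\int[mu]_(v in `]c, d]) section_cdf y v)%R.

Lemma mixed_chasles y c d e : c <= d -> d <= e ->
  mixed y c e = mixed y c d + mixed y d e.
Proof.
by apply: Rintegral_chasles; [exact: measurable_section_cdf|exact: section_cdf01].
Qed.

Lemma mixed_bounds y c d m M : c <= d ->
  (forall v, c < v <= d -> m <= section_cdf y v <= M) ->
  m * (d - c) <= mixed y c d <= M * (d - c).
Proof.
by apply: Rintegral_bounds; [exact: measurable_section_cdf|exact: section_cdf01].
Qed.

(** Scaling the uniform variable amounts to scaling [y]. *)
Lemma mixed_scale y c d t : 0 <= c -> 0 < t ->
  mixed y (t * c) (t * d) = t * mixed (t `^ (- r) * y) c d.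
Proof.
move=> c0 t0; rewrite /mixed Rintegral_scale//; last 2 first.
- exact: measurable_section_cdf.
- exact: section_cdf01.
congr (_ * _); apply: eq_Rintegral => v /[!inE]/= /[!in_itv]/= /andP[cv _].
have v0 : 0 <= v by rewrite ltW// (le_lt_trans c0).
by rewrite /section_cdf powRM ?(ltW t0)// mulrA; congr (G (_ * _)); rewrite mulrC.
Qed.

(** The two one-sided situations [t < 1] and [1 < t] are handled at once. *)
Definition signed_mixed y c t := if t <= 1 then mixed y (t * c) c else - mixed y c (t * c).

Lemma signed_mixedB y t : 0 < t ->
  t * mixed (t `^ (- r) * y) a b - mixed y a b =
  signed_mixed y a t - signed_mixed y b t.
Proof.
move=> t0; rewrite -mixed_scale// /signed_mixed.
have tab : t * a <= t * b by rewrite ler_pM2l// ltW.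
have [t1|t1] := leP t 1.
  have ta : t * a <= a by rewrite ler_piMl.
  have tb : t * b <= b by rewrite ler_piMl// ltW.
  have := mixed_chasles y tab tb; rewrite (mixed_chasles y ta (ltW ab)); lra.
have ta : a <= t * a by rewrite ler_peMl// ltW.
have tb : b <= t * b by rewrite ler_peMl// ltW.
have := mixed_chasles y ta tab; rewrite (mixed_chasles y (ltW ab) tb); lra.
Qed.

Lemma powRN_homo y c d : 0 < c -> c <= d -> 0 < r * y -> d `^ (- r) * y <= c `^ (- r) * y.
Proof.
move=> c0 cd ry; have d0 := lt_le_trans c0 cd.
have [y0|y0|y0] := ltrgtP 0 y; last by rewrite -y0 mulr0 ltxx in ry.
  have r0 : 0 < r by rewrite pmulr_lgt0 in ry.
  rewrite ler_pM2r// !powRN lef_pV2 ?posrE ?powR_gt0//.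
  by apply: le_powRl => //; exact: ltW.
have r0 : r < 0 by rewrite nmulr_lgt0 in ry.
by rewrite ler_nM2r// le_powRl ?oppr_gt0// ltW.
Qed.

Lemma powRN_homoN y c d : 0 < c -> c <= d -> r * y < 0 -> c `^ (- r) * y <= d `^ (- r) * y.
Proof.
move=> c0 cd ry; have : 0 < r * (- y) by rewrite mulrN oppr_gt0.
by move=> /(powRN_homo c0 cd); rewrite !mulrN lerN2.
Qed.

Lemma signed_mixed_bounds y c t : 0 <= c -> 0 < t ->
  (0 < r * y /\ t < 1) \/ (r * y < 0 /\ 1 < t) ->
  c * G (c `^ (- r) * y) <= signed_mixed y c t / (1 - t) <=
  c * G (t `^ (- r) * (c `^ (- r) * y)).
Proof.
rewrite le_eqVlt => /orP[/eqP<-|c0] t0 side.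
  rewrite /signed_mixed !mul0r !mulr0.
  have -> : mixed y 0 0 = 0.
    by apply/eqP; rewrite eq_le; have := @mixed_bounds y 0 0 0 1 (lexx _)
      (fun v _ => section_cdf01 y v); rewrite subrr !mulr0 => /andP[-> ->].
  by rewrite oppr0 if_same mul0r lexx.
rewrite mulrA -powRM ?(ltW t0) ?(ltW c0)//.
case: side => -[ry t1]; rewrite /signed_mixed.
  rewrite (ltW t1); have tc : t * c <= c by rewrite ler_piMl// ltW.
  have t1' : 0 < 1 - t by rewrite subr_gt0.
  have := @mixed_bounds y (t * c) c (G (c `^ (- r) * y)) (G ((t * c) `^ (- r) * y)) tc.
  have e : c - t * c = c * (1 - t) by ring.
  rewrite e => /(_ _)/andP[|h1 h2].
    move=> v /andP[v1 v2]; rewrite /section_cdf !Gnd//.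
      by apply: powRN_homo => //; [exact: mulr_gt0|exact: ltW].
    by apply: powRN_homo => //; apply: lt_trans v1; exact: mulr_gt0.
  by rewrite ler_pdivlMr// ler_pdivrMr// -!mulrA [c * (G _ * _)]mulrCA h1/= [c * (G _ * _)]mulrCA h2.
rewrite [t <= 1]leNgt t1/=; have tc : c <= t * c by rewrite ler_peMl// ltW.
have t1' : 0 < t - 1 by rewrite subr_gt0.
have := @mixed_bounds y c (t * c) (G (c `^ (- r) * y)) (G ((t * c) `^ (- r) * y)) tc.
have e : t * c - c = c * (t - 1) by ring.
rewrite e => /(_ _)/andP[|h1 h2].
  move=> v /andP[v1 v2]; rewrite /section_cdf !Gnd//.
    by apply: powRN_homoN => //; apply: lt_trans v1.
  by apply: powRN_homoN => //; exact: ltW.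
rewrite -opprB invrN mulrNN.
by rewrite ler_pdivlMr// ler_pdivrMr// -!mulrA [c * (G _ * _)]mulrCA h1/= [c * (G _ * _)]mulrCA h2.
Qed.

Context (Grc : forall x, G y @[y --> x^'+] --> G x).
Context (GI : forall y, mixed y a b = clamp a b (expR y) - a).

(** The derivative at [t = 1] of [t * expR (t `^ (- r) * y)]; see
    [is_derive_profile]. *)
Definition phi y := expR y * (1 - r * y).

Definition profile y t := t * (expR (t `^ (- r) * y) - a).

Lemma is_derive_powR_scaled (s y : R) : 0 < s ->
  is_derive s (1 : R) (fun s => s `^ (- r) * y) (- r * s `^ (- r - 1) * y).
Proof.
move=> s0; have := is_derive1_powR (- r) s0 => d1.
by apply: is_derive_eq; rewrite /GRing.scale/=; ring.
Qed.

Lemma is_derive_profile (s y : R) : 0 < s ->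
  is_derive s (1 : R) (profile y) (phi (s `^ (- r) * y) - a).
Proof.
move=> s0; have dexp : is_derive s (1 : R) (fun s => expR (s `^ (- r) * y))
    (expR (s `^ (- r) * y) * (- r * s `^ (- r - 1) * y)).
  exact: (@is_derive1_comp R expR _ s _ _ (is_derive_expR _) (is_derive_powR_scaled y s0)).
rewrite /profile; apply: is_derive_eq; rewrite /GRing.scale/= /phi.
have -> : s `^ (- r) = s * s `^ (- r - 1).
  rewrite -[X in X * _](powRr1 (ltW s0)) -powRD ?(gt_eqF s0) ?implybT//.
  by have -> : 1 + (- r - 1) = - r by ring.
ring.
Qed.

Lemma powRN_shift y s h : y != 0 -> 0 < s -> -1 < h ->
  (0 < r * y /\ h < 0) \/ (r * y < 0 /\ 0 < h) ->
  s `^ (- r) * y < (1 + h) `^ (- r) * (s `^ (- r) * y).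
Proof.
move=> y0 s0 h1 side; rewrite mulrCA -subr_gt0 -mulrBr pmulr_rgt0 ?powR_gt0//.
rewrite -{2}[y]mul1r -mulrBl.
have t0 : 0 < 1 + h by rewrite -ltrBlDl sub0r.
have lnt : ((0 < h) = (0 < ln (1 + h))) * ((h < 0) = (ln (1 + h) < 0)).
  by split; rewrite -[RHS]ltr_expR lnK ?posrE// expR0 ?ltrDl ?gtrDl.
have e : (1 + h) `^ (- r) = expR (- r * ln (1 + h)) by rewrite /powR gt_eqF.
rewrite e.
have [y_gt0|y_lt0|] := ltrgtP 0 y; last by move/esym/eqP; rewrite (negbTE y0).
  rewrite pmulr_lgt0// subr_gt0 expR_gt1.
  by case: side => -[ry]; rewrite lnt => lh; rewrite ?(pmulr_lgt0 _ y_gt0) ?(pmulr_llt0 _ y_gt0) in ry; nra.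
rewrite nmulr_lgt0// subr_lt0 expR_lt1.
by case: side => -[ry]; rewrite lnt => lh; rewrite ?(nmulr_lgt0 _ y_lt0) ?(nmulr_llt0 _ y_lt0) in ry; nra.
Qed.

(** By [signed_mixedB] the integral equations at [y] and at [t `^ (- r) * y]
    differ by two thin strips, of width proportional to [1 - t], at the ends of
    [[a, b]]. Divided by [1 - t], the strips are squeezed by monotonicity between
    values of [G]. Taking [t] on the side of [1] where
    [t `^ (- r) * y] is beyond [y], right-continuity gives their limits. *)
Theorem functional_eq y : y != 0 -> a <= expR y < b ->
  b * G (b `^ (- r) * y) - a * G (a `^ (- r) * y) = phi y - a.
Proof.
move=> y0 /andP[ay yb].
have ry0 : r * y != 0 by rewrite mulf_neq0.
pose F : set_system R := if 0 < r * y then 0^'- else 0^'+.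
have PF : ProperFilter F.
  by rewrite /F; case: ifP => _; [exact: at_left_proper_filter|exact: at_right_proper_filter].
have FF : Filter F by apply: filter_filter.
have Fd (f : R -> R) (l : R) : f h @[h --> 0^'] --> l -> f h @[h --> F] --> l.
  by rewrite /F; case: ifP => _; [exact: cvg_dnbhs_at_left|exact: cvg_dnbhs_at_right].
have side : \forall h \near F, (0 < r * y /\ h < 0) \/ (r * y < 0 /\ 0 < h).
  rewrite /F; case: ifPn => [ry|]; last rewrite -leNgt le_eqVlt (negbTE ry0)/= => ry.
    by near=> h; left.
  by near=> h; right.
have F0 : h @[h --> F] --> (0 : R).
  by rewrite /F; case: ifP => _; apply: cvg_within.
have tcv : (1 + h) `^ (- r) @[h --> F] --> (1 : R).
  have h1 : h + 1 @[h --> F] --> (1 : R).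
    by rewrite -[X in _ --> X]add0r; apply: cvgD => //; exact: cvg_cst.
  have c1 := @continuous_powRl R (- r) 1 ltr01.
  have p1 : (1 : R) `^ (- r) = 1 by rewrite powR1.
  rewrite -[X in _ --> X]p1; under eq_fun do rewrite addrC.
  exact: (continuous_cvg _ c1 h1).
have h1 : \forall h \near F, -1 < h.
  by apply: F0; apply: lt_nbhsr; rewrite ltrN10.
have cvG s : 0 < s -> G ((1 + h) `^ (- r) * (s `^ (- r) * y)) @[h --> F] --> G (s `^ (- r) * y).
  move=> s0; apply: (@cvg_at_right_shift R G F FF (fun h => (1 + h) `^ (- r) * (s `^ (- r) * y)) (s `^ (- r) * y) (@Grc _)).
    rewrite -[X in _ --> X]mul1r; apply: cvgM => //; exact: cvg_cst.
  near=> h; apply: powRN_shift => //; first by near: h.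
  by near: h.
have DQ : (profile y (1 + h) - profile y 1) / h @[h --> F] --> phi y - a.
  apply: Fd; have := is_derive_profile y ltr01; rewrite one_powR mul1r => -[d1 <-]; move: d1; apply: cvg_trans.
  apply: near_eq_cvg; near=> h.
  have -> : h%:A = h :> R by rewrite /GRing.scale/= mulr1.
  by rewrite /= [h + 1]addrC [RHS]mulrC.
have nearb : \forall h \near F, expR ((1 + h) `^ (- r) * y) < b.
  have : expR ((1 + h) `^ (- r) * y) @[h --> F] --> expR y.
    apply: continuous_cvg; first exact: continuous_expR.
    by rewrite -[X in _ --> X]mul1r; apply: cvgM => //; exact: cvg_cst.
  by move/cvgr_lt; apply.
have id1 : \forall h \near F, profile y (1 + h) - profile y 1 =
    signed_mixed y a (1 + h) - signed_mixed y b (1 + h).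
  near=> h.
  have t0 : 0 < 1 + h by rewrite -ltrBlDl sub0r; near: h.
  have yt : y <= (1 + h) `^ (- r) * y.
    have := @powRN_shift y 1 h y0 ltr01; rewrite powR1 mul1r => q.
    by apply/ltW/q; near: h.
  rewrite -signed_mixedB// !GI /profile powR1 !mul1r.
  have eb : expR ((1 + h) `^ (- r) * y) < b by near: h; exact: nearb.
  rewrite /clamp max_r ?min_r ?max_r ?(ltW eb) ?(ltW yb)//.
  by apply: (le_trans ay); rewrite ler_expR.
have bnd c : 0 <= c -> \forall h \near F, c * G (c `^ (- r) * y) <= signed_mixed y c (1 + h) / (- h) <=
    c * G ((1 + h) `^ (- r) * (c `^ (- r) * y)).
  move=> c0; near=> h.
  have -> : - h = 1 - (1 + h) by ring.
  apply: signed_mixed_bounds => //.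
    by rewrite -ltrBlDl sub0r; near: h.
  rewrite gtrDl ltrDl; by near: h.
have up c : 0 <= c -> c * G ((1 + h) `^ (- r) * (c `^ (- r) * y)) @[h --> F] --> c * G (c `^ (- r) * y).
  rewrite le_eqVlt => /orP[/eqP<-|c0].
    by under eq_fun do rewrite mul0r; rewrite mul0r; exact: cvg_cst.
  by apply: cvgM; [exact: cvg_cst|exact: cvG].
apply/eqP; rewrite eq_le; apply/andP; split.
  have lo : b * G (b `^ (- r) * y) - a * G ((1 + h) `^ (- r) * (a `^ (- r) * y))
      @[h --> F] --> b * G (b `^ (- r) * y) - a * G (a `^ (- r) * y).
    by apply: cvgB; [exact: cvg_cst|exact: up].
  apply: (ler_cvg_to lo DQ); near=> h.
  have /andP[_ ua] : a * G (a `^ (- r) * y) <= signed_mixed y a (1 + h) / (- h) <=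
    a * G ((1 + h) `^ (- r) * (a `^ (- r) * y)) by near: h; exact: bnd.
  have /andP[ub _] : b * G (b `^ (- r) * y) <= signed_mixed y b (1 + h) / (- h) <=
    b * G ((1 + h) `^ (- r) * (b `^ (- r) * y)) by near: h; exact: bnd (ltW _).
  have -> : profile y (1 + h) - profile y 1 =
    signed_mixed y a (1 + h) - signed_mixed y b (1 + h) by near: h.
  by move: ua ub; rewrite invrN !mulrN mulrBl; lra.
have hi : b * G ((1 + h) `^ (- r) * (b `^ (- r) * y)) - a * G (a `^ (- r) * y)
    @[h --> F] --> b * G (b `^ (- r) * y) - a * G (a `^ (- r) * y).
  by apply: cvgB; [exact: up (ltW _)|exact: cvg_cst].
apply: (ler_cvg_to DQ hi); near=> h.
have /andP[la _] : a * G (a `^ (- r) * y) <= signed_mixed y a (1 + h) / (- h) <=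
  a * G ((1 + h) `^ (- r) * (a `^ (- r) * y)) by near: h; exact: bnd.
have /andP[_ lb] : b * G (b `^ (- r) * y) <= signed_mixed y b (1 + h) / (- h) <=
  b * G ((1 + h) `^ (- r) * (b `^ (- r) * y)) by near: h; exact: bnd (ltW _).
have -> : profile y (1 + h) - profile y 1 =
  signed_mixed y a (1 + h) - signed_mixed y b (1 + h) by near: h.
by move: la lb; rewrite invrN !mulrN mulrBl; lra.
Unshelve. all: by end_near. Qed.

Lemma powR_lt_near v y z : 0 < v -> v `^ (- r) * y < z ->
  exists2 e, 0 < e & forall x, `|x - v| < e -> x `^ (- r) * y < z.
Proof.
move=> v0 vz.
have : x `^ (- r) * y @[x --> v] --> v `^ (- r) * y.
  by apply: cvgM; [exact: continuous_powRl|exact: cvg_cst].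
move/cvgr_lt => /(_ _ vz) /nbhs_ballP[e /= e0 h]; exists e => // x xv.
by apply: h; rewrite /ball/= distrC.
Qed.

(** A local bound on [section_cdf y] moves the mixed value away from its extreme
    values [0] and [b - a]. *)
Lemma mixed_near v y m M e : 0 < e -> a <= v <= b -> 0 <= m -> M <= 1 ->
  (forall x, `|x - v| < e -> m <= section_cdf y x <= M) ->
  (0 < m -> 0 < mixed y a b) /\ (M < 1 -> mixed y a b < b - a).
Proof.
move=> e0 /andP[av vb] m0 M1 h.
pose c := Num.max a (v - e / 2); pose d := Num.min b (v + e / 2).
have e2 : 0 < e / 2 by rewrite divr_gt0.
have cd : c < d.
  by rewrite /c/d lt_min !gt_max ab/= !(ltrBlDr, ltrDl) ?addr_gt0//; apply/and3P; split=> //; lra.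
have ac : a <= c by rewrite le_max lexx.
have db : d <= b by rewrite ge_min lexx.
have hcd x : c < x <= d -> m <= section_cdf y x <= M.
  rewrite /c/d gt_max le_min => /andP[/andP[_ x1] /andP[_ x2]].
  by apply: h; rewrite ltr_norml; lra.
rewrite (mixed_chasles y ac (ltW (lt_le_trans cd db))) (mixed_chasles y (ltW cd) db).
have /andP[l1 u1] := mixed_bounds ac (fun v _ => section_cdf01 y v).
have /andP[l2 u2] := mixed_bounds (ltW cd) hcd.
have /andP[l3 u3] := mixed_bounds db (fun v _ => section_cdf01 y v).
have dc : 0 < d - c by rewrite subr_gt0.
split=> [mp|Mp].
  have : 0 < m * (d - c) by rewrite mulr_gt0.
  lra.
have : 0 < (1 - M) * (d - c) by rewrite mulr_gt0// subr_gt0.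
lra.
Qed.

(** The mixed value is maximal, so [section_cdf y] cannot drop below [1]
    anywhere: by right-continuity it would do so on an interval. *)
Lemma G_above y v : b <= expR y -> 0 < v -> a <= v <= b -> G (v `^ (- r) * y) = 1.
Proof.
move=> yb v0 avb; apply/eqP; rewrite eq_le; have /andP[_ ->]/= := G01 (v `^ (- r) * y).
rewrite leNgt; apply/negP => Glt1.
have [z [vz Gz]] : exists z, v `^ (- r) * y < z /\ G z < 1.
  apply: (@filter_ex _ ((v `^ (- r) * y)^'+)).
  apply: filterI; first exact: nbhs_right_gt.
  by move/cvgr_lt: (@Grc (v `^ (- r) * y)); apply.
have [e e0 he] := powR_lt_near v0 vz.
have [|_ /(_ Gz)] := @mixed_near v y 0 (G z) e e0 avb (lexx _) (ltW Gz).
  move=> x /he xz; have /andP[-> _]/= := G01 (x `^ (- r) * y).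
  by apply: Gnd; exact: ltW.
by rewrite GI /clamp max_r ?min_l ?ltxx// (le_trans (ltW ab)).
Qed.

(** A positive value at [y] would be a lower bound near [v] at [ln a], where the
    mixed value still vanishes. *)
Lemma G_below y v : expR y < a -> a <= v <= b -> G (v `^ (- r) * y) = 0.
Proof.
move=> ya /andP[av vb].
have a0 : 0 < a by exact: lt_trans (expR_gt0 y) ya.
have v0 : 0 < v by exact: lt_le_trans av.
have /andP[Gge0 _] := G01 (v `^ (- r) * y).
apply/eqP; rewrite eq_le Gge0 andbT leNgt; apply/negP => Ggt0.
have yy : y < ln a by rewrite -ltr_expR lnK.
have vy : v `^ (- r) * (- ln a) < - (v `^ (- r) * y).
  by rewrite mulrN ltrN2 ltr_pM2l// powR_gt0.
have [e e0 he] := powR_lt_near v0 vy.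
have [||/(_ Ggt0) + _] := @mixed_near v (ln a) (G (v `^ (- r) * y)) 1 e e0 _ (ltW Ggt0) (lexx _).
- by rewrite av vb.
- move=> x /he; rewrite mulrN ltrN2 => xz; have /andP[_ ->] := G01 (x `^ (- r) * ln a).
  by rewrite andbT; apply: Gnd; exact: ltW.
- by rewrite GI lnK ?posrE// /clamp maxxx min_r ?subrr ?ltxx// ltW.
Qed.

Lemma G_zero : G 0 * (b - a) = clamp a b 1 - a.
Proof.
rewrite -expR0 -GI.
have := @mixed_bounds 0 a b (G 0) (G 0) (ltW ab) => /(_ _)/andP[|h1 h2].
  by move=> v _; rewrite /section_cdf mulr0 lexx.
by apply/eqP; rewrite eq_le h1 h2.
Qed.

End functional_equation.

(** * Necessary conditions *)

Lemma is_derive_phi (R : realType) (r y : R) :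
  is_derive y 1 (phi r) (expR y * (1 - r - r * y)).
Proof.
rewrite /phi; apply: is_derive_eq; rewrite /GRing.scale/=; ring.
Qed.

Lemma phi_increment (R : realType) (r x y : R) : x < y ->
  exists2 z, x < z < y & phi r y - phi r x = expR z * (1 - r - r * z) * (y - x).
Proof.
move=> xy; have [||z] := @MVT R (phi r) (fun z => expR z * (1 - r - r * z)) _ _ xy.
- by move=> z _; exact: is_derive_phi.
- by apply: continuous_subspaceT => z; exact: is_derive1_continuous (is_derive_phi r z).
- by rewrite in_itv/= => xzy e; exists z.
Qed.

Lemma phi_incr (R : realType) (r x y : R) : x < y ->
  (forall z, x < z < y -> 0 < 1 - r - r * z) -> phi r x < phi r y.
Proof.
move=> xy h; rewrite -subr_gt0; have [z zxy ->] := phi_increment r xy.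
by rewrite !mulr_gt0 ?expR_gt0 ?h// subr_gt0.
Qed.

Lemma phi_decr (R : realType) (r x y : R) : x < y ->
  (forall z, x < z < y -> 1 - r - r * z < 0) -> phi r y < phi r x.
Proof.
move=> xy h; rewrite -subr_lt0; have [z zxy ->] := phi_increment r xy.
by rewrite nmulr_rlt0 ?subr_gt0// pmulr_rlt0 ?expR_gt0 ?h.
Qed.

Lemma in_between2 (R : realType) (x y : R) : x < y ->
  exists p q, [/\ x < p, p < q & q < y].
Proof. by move=> xy; exists ((2 * x + y) / 3), ((x + 2 * y) / 3); split; lra. Qed.

Lemma expr_unbounded (R : realType) (c M : R) (c1 : 1 < c) : exists n, M < c ^+ n.
Proof.
have c0 := lt_trans ltr01 c1.
have : (c^-1) ^+ n @[n --> \oo] --> (0 : R).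
  by apply: cvg_expr; rewrite ger0_norm ?invr_ge0 ?(ltW c0)// invf_lt1.
have M0 : 0 < (`|M| + 1)^-1 by rewrite invr_gt0 ltr_wpDl.
move/cvgr_lt => /(_ _ M0) [n _ /(_ n (leqnn n))]/=.
rewrite exprVn ltf_pV2 ?posrE ?exprn_gt0 ?ltr_wpDl// => h.
by exists n; apply: lt_trans h; apply: (le_lt_trans (ler_norm M)); rewrite ltrDl.
Qed.

Lemma ndecr_derive_ge0 (R : realType) (f : R -> R) (y q df : R) : y < q ->
  (forall z, y < z < q -> f y <= f z) -> is_derive y (1 : R) f df -> 0 <= df.
Proof.
move=> yq fy [d1 <-].
have h0 : h^-1 *: ((f \o shift y) (h *: (1 : R)) - f y) @[h --> 0^'+] --> 'D_1 f y.
  by apply: cvg_dnbhs_at_right.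
apply: (cvgr_to_ge h0); near=> h.
have h_gt0 : 0 < h by near: h; exact: nbhs_right_gt.
rewrite /GRing.scale/= mulr1 mulr_ge0 ?invr_ge0 ?(ltW h_gt0)// subr_ge0 fy//.
rewrite ltrDr h_gt0/= -ltrBrDr; near: h; apply: nbhs_right_lt; by rewrite subr_gt0.
Unshelve. all: by end_near. Qed.

Section exponential_sums.
Context (R : realType) (rho c r : R) (rho_gt0 : 0 < rho) (c_gt1 : 1 < c) (r_gt0 : 0 < r).
Context (n : nat) (p q : R) (pq : p < q) (q_le0 : q <= 0).

(** The [m]-th derivative of [\sum_i rho ^+ i * expR (c ^+ i * y)]. *)
Definition exp_sum m y : R := \sum_(i < n.+1) rho ^+ i * (c ^+ i) ^+ m * expR (c ^+ i * y).

Let c_gt0 : 0 < c. Proof. exact: lt_trans c_gt1. Qed.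

Lemma exp_sum_gt0 m y : 0 < exp_sum m y.
Proof.
rewrite /exp_sum big_ord_recl ltr_pwDl ?mulr_gt0 ?exprn_gt0 ?expR_gt0//.
by apply: sumr_ge0 => i _; rewrite ltW// !mulr_gt0 ?exprn_gt0 ?expR_gt0.
Qed.

Lemma exp_sumS m y : exp_sum m.+1 y <= c ^+ n * exp_sum m y.
Proof.
rewrite /exp_sum mulr_sumr; apply: ler_sum => i _.
have -> : rho ^+ i * c ^+ i ^+ m.+1 * expR (c ^+ i * y) =
    c ^+ i * (rho ^+ i * c ^+ i ^+ m * expR (c ^+ i * y)) by rewrite exprS; ring.
rewrite ler_pM2r ?mulr_gt0 ?exprn_gt0 ?expR_gt0//.
by rewrite ler_weXn2l ?(ltW c_gt1)// -ltnS.
Qed.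

Lemma is_derive_exp_sum m (y : R) : is_derive y (1 : R) (exp_sum m) (exp_sum m.+1 y).
Proof.
have -> : exp_sum m = \sum_(i < n.+1) (fun y => rho ^+ i * (c ^+ i) ^+ m * expR (c ^+ i * y)).
  by apply/funext => z; rewrite fct_sumE.
apply: is_derive_sum => i; have d1 : is_derive y (1 : R) (fun y => c ^+ i * y) (c ^+ i).
  by apply: is_derive_eq; rewrite /GRing.scale/=; ring.
have d2 := @is_derive1_comp R expR _ y _ _ (is_derive_expR _) d1.
apply: (is_derive_eq (is_deriveM (is_derive_cst (rho ^+ i * c ^+ i ^+ m) y 1) d2)).
rewrite /GRing.scale/= exprS; ring.
Qed.

Lemma exp_sum_phi y : \sum_(i < n.+1) rho ^+ i * phi r (c ^+ i * y) =
  exp_sum 0 y - r * y * exp_sum 1 y.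
Proof.
rewrite /exp_sum mulr_sumr -sumrB; apply: eq_bigr => i _.
rewrite /phi expr0 expr1; ring.
Qed.

Lemma is_derive_eq_on (f g : R -> R) (y df dg : R) : p < y < q ->
  (forall z, p < z < q -> f z = g z) ->
  is_derive y (1 : R) f df -> is_derive y (1 : R) g dg -> df = dg.
Proof.
move=> ypq fg f' g'.
have fg' : {near y, f =1 g}.
  near=> z; apply: fg; have : z \in `]p, q[.
    by near: z; apply: near_in_itvoo; rewrite in_itv.
  by rewrite in_itv.
have h := near_eq_is_derive fg' f'.
by rewrite -(@derive_val _ _ _ _ _ _ _ h) -(@derive_val _ _ _ _ _ _ _ g').
Unshelve. all: by end_near. Qed.

Lemma derivatives_ratio (C : R) :
  (forall y, p < y < q -> \sum_(i < n.+1) rho ^+ i * phi r (c ^+ i * y) = C) ->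
  forall m y, p < y < q -> (1 - m.+1%:R * r) * exp_sum m.+1 y = r * y * exp_sum m.+2 y.
Proof.
move=> h; elim=> [|m IH] y ypq.
  have := @is_derive_eq_on (fun y => exp_sum 0 y - r * y * exp_sum 1 y) (cst C) y _ _ ypq.
  move=> /(_ (exp_sum 1 y - (r * exp_sum 1 y + r * y * exp_sum 2 y)) 0) e.
  have : exp_sum 1 y - (r * exp_sum 1 y + r * y * exp_sum 2 y) = 0.
    apply: e => //; first by move=> z zpq; rewrite -exp_sum_phi h.
    have d0 := is_derive_exp_sum 0 y; have d1 := is_derive_exp_sum 1 y.
    apply: is_derive_eq; rewrite /GRing.scale/=; ring.
  by rewrite mul1r; lra.
have := @is_derive_eq_on (fun y => (1 - m.+1%:R * r) * exp_sum m.+1 y)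
  (fun y => r * y * exp_sum m.+2 y) y _ _ ypq IH.
move=> /(_ ((1 - m.+1%:R * r) * exp_sum m.+2 y) (r * exp_sum m.+2 y + r * y * exp_sum m.+3 y)) e.
have : (1 - m.+1%:R * r) * exp_sum m.+2 y = r * exp_sum m.+2 y + r * y * exp_sum m.+3 y.
  have d0 := is_derive_exp_sum m.+1 y; have d1 := is_derive_exp_sum m.+2 y.
  have d2 : is_derive y (1 : R) (fun y => r * y) r.
    by apply: is_derive_eq; rewrite /GRing.scale/=; ring.
  have e1 : is_derive y (1 : R) (fun y => (1 - m.+1%:R * r) * exp_sum m.+1 y)
      ((1 - m.+1%:R * r) * exp_sum m.+2 y).
    apply: (is_derive_eq (is_deriveM (is_derive_cst (1 - m.+1%:R * r) y 1) d0)).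
    rewrite /GRing.scale/=; ring.
  have e2 : is_derive y (1 : R) (fun y => r * y * exp_sum m.+2 y)
      (r * exp_sum m.+2 y + r * y * exp_sum m.+3 y).
    by apply: (is_derive_eq (is_deriveM d2 d1)); rewrite /GRing.scale/=; ring.
  exact: e e1 e2.
by rewrite -[m.+2%:R]natr1; lra.
Qed.

(** If the sum is constant then [derivatives_ratio] makes successive derivatives
    of [exp_sum 0] grow by factors of order [m], whereas [exp_sumS] bounds these
    factors by [c ^+ n]. *)
Lemma exp_sum_not_constant (C : R) :
  ~ (forall y, p < y < q -> \sum_(i < n.+1) rho ^+ i * phi r (c ^+ i * y) = C).
Proof.
move=> h; have [y [z [py yz zq]]] := in_between2 pq.
have ypq : p < y < q by rewrite py (lt_trans yz).
have y_le0 : y < 0 by case/andP: ypq => _ /lt_le_trans; apply.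
(* large enough for the growth factor to exceed [c ^+ n] *)
pose m := Num.bound (r^-1 * (1 + r * - y * c ^+ n)).
have hm : r^-1 * (1 + r * - y * c ^+ n) < m%:R.
  by apply: archi_boundP; rewrite mulr_ge0 ?invr_ge0 ?addr_ge0 ?mulr_ge0 ?exprn_ge0 ?oppr_ge0 ?ltW.
have := derivatives_ratio h m ypq.
have := exp_sumS m.+1 y; have := exp_sum_gt0 m.+1 y; have := exp_sum_gt0 m.+2 y.
set A := exp_sum m.+1 y; set B := exp_sum m.+2 y => B0 A0 AB e.
rewrite ltr_pdivrMl// in hm.
have hm' : 1 + r * - y * c ^+ n < m.+1%:R * r by rewrite [r * m%:R]mulrC in hm; apply: (lt_trans hm); rewrite ltr_pM2r// ltr_nat.
have : r * - y * B <= r * - y * (c ^+ n * A).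
  by rewrite ler_pM2l// mulr_gt0// oppr_gt0.
have : (1 + r * - y * c ^+ n) * A < m.+1%:R * r * A by rewrite ltr_pM2r.
move: e; rewrite !mulrDl !mulNr !mulrN !mulNr !mul1r; lra.
Qed.

End exponential_sums.

Section necessary.
Context (R : realType) (a b r : R) (a_ge0 : 0 <= a) (ab : a < b).
Context (G : R -> R) (Gnd : {homo G : x y / x <= y}) (G01 : forall x, 0 <= G x <= 1).
Context (FE : forall y, y != 0 -> a <= expR y < b ->
  b * G (b `^ (- r) * y) - a * G (a `^ (- r) * y) = phi r y - a).
Context (Gabove : forall y v, b <= expR y -> 0 < v -> a <= v <= b -> G (v `^ (- r) * y) = 1).
Context (Gbelow : forall y v, expR y < a -> a <= v <= b -> G (v `^ (- r) * y) = 0).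

Let b_gt0 : 0 < b. Proof. exact: le_lt_trans ab. Qed.

(** The factor [(b / a) `^ r] between the two arguments of [G] in the functional
    equation; it is [0] when [a = 0 < r]. *)
Definition ratio := a `^ (- r) / b `^ (- r).

Lemma ratio_gt0 : 0 < a -> 0 < ratio.
Proof. by move=> a0; rewrite divr_gt0 ?powR_gt0. Qed.

Lemma ratio_gt1 : 0 < a -> 0 < r -> 1 < ratio.
Proof.
move=> a0 r0; rewrite /ratio ltr_pdivlMr ?powR_gt0// mul1r !powRN ltf_pV2 ?posrE ?powR_gt0//.
exact: lt_powRl.
Qed.

Lemma ratio_lt1 : 0 < a -> r < 0 -> ratio < 1.
Proof.
move=> a0 r0; rewrite /ratio ltr_pdivrMr ?powR_gt0// mul1r.
by rewrite lt_powRl ?oppr_gt0.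
Qed.

Lemma ratioE y : b `^ (- r) * (ratio * y) = a `^ (- r) * y.
Proof. by rewrite /ratio mulrA mulrCA divff ?mulr1// gt_eqF// powR_gt0. Qed.

Lemma expR_between y : (0 < a -> ln a <= y) -> y < ln b -> a <= expR y < b.
Proof.
move=> ay yb; rewrite -[ltRHS](@lnK _ b) ?posrE// ltr_expR yb andbT.
move: a_ge0; rewrite le_eqVlt => /orP[/eqP<-|a0]; first exact: expR_ge0.
by rewrite -[leLHS](@lnK _ a) ?posrE// ler_expR ay.
Qed.

Lemma G_top v y : 0 < v -> a <= v <= b -> v `^ (- r) * ln b <= y -> G y = 1.
Proof.
move=> v0 avb h; apply/eqP; rewrite eq_le; have /andP[_ ->]/= := G01 y.
by rewrite -(@Gabove (ln b) v)// ?Gnd// lnK.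
Qed.

Lemma G_bottom v y : 0 < a -> a <= v <= b -> y < v `^ (- r) * ln a -> G y = 0.
Proof.
move=> a0 avb h; have v0 : 0 < v by case/andP: avb => av _; exact: lt_le_trans av.
have -> : y = v `^ (- r) * (y / v `^ (- r)) by rewrite mulrC divfK// gt_eqF// powR_gt0.
apply: Gbelow => //; rewrite -[ltRHS]lnK ?posrE// ltr_expR.
by rewrite ltr_pdivrMr ?powR_gt0// mulrC.
Qed.

Let FEa y : y != 0 -> ln a <= y -> y < ln b -> 
  b * G (b `^ (- r) * y) - a * G (a `^ (- r) * y) = phi r y - a.
Proof. by move=> y0 ay yb; apply: FE => //; apply: expR_between. Qed.

(** The left-hand side of the functional equation is [b * G _ >= 0], but [phi] is
    negative far to the left. *)
Lemma neg_exponent_zero_end : a = 0 -> r < 0 -> False.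
Proof.
move=> a0 r0; pose y := Num.min (2 / r) (ln b - 1).
have y1 : y <= 2 / r by rewrite ge_min lexx.
have y2 : y < ln b by rewrite gt_min ltrBlDr ltrDl ltr01 orbT.
have y0 : y < 0 by apply: (le_lt_trans y1); rewrite pmulr_rlt0// invr_lt0.
have ry : 2 <= r * y by move: y1; rewrite ler_ndivlMr// mulrC.
have ay : 0 < a -> ln a <= y by rewrite a0 ltxx.
have := FE (ltr0_neq0 y0) (expR_between ay y2).
rewrite a0 mul0r !subr0 => e.
have : 0 <= b * G (b `^ (- r) * y) by rewrite mulr_ge0 ?(ltW b_gt0)//; case/andP: (G01 (b `^ (- r) * y)).
rewrite e /phi pmulr_rge0 ?expR_gt0//; lra.
Qed.

(** Just below [ln b] the [b]-term is the constant [b], so that [- phi] would have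
    to be nondecreasing there. *)
Lemma neg_exponent_top : 1 < b -> r < 0 -> False.
Proof.
move=> b1 r0; move: a_ge0; rewrite le_eqVlt => /orP[/eqP a0|a0].
  exact: neg_exponent_zero_end (esym a0) r0.
have lb : 0 < ln b by exact: ln_gt0.
have lab : ln a < ln b by rewrite ltr_ln ?posrE.
have r1 := ratio_lt1 a0 r0.
have [|p [q [mp pq qb]]] := @in_between2 _ (Num.max (Num.max (ln a) (ratio * ln b)) 0) (ln b).
  by rewrite !gt_max lab lb andbT/= gtr_pMl.
move: mp; rewrite !gt_max => /andP[/andP[ap rp] p0].
have one y : p <= y -> G (b `^ (- r) * y) = 1.
  move=> py; apply: (@G_top a) => //; first by rewrite lexx ltW.
  by rewrite -ratioE ler_pM2l ?powR_gt0// (le_trans (ltW rp)).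
have q0 := lt_trans p0 pq.
have e1 := FEa (lt0r_neq0 p0) (ltW ap) (lt_trans pq qb).
have e2 := FEa (lt0r_neq0 q0) (ltW (lt_trans ap pq)) qb.
rewrite one ?lexx// in e1; rewrite one ?(ltW pq)// in e2.
have : a * G (a `^ (- r) * p) <= a * G (a `^ (- r) * q).
  by rewrite ler_pM2l// Gnd// ler_pM2l ?powR_gt0// ltW.
have : phi r p < phi r q.
  apply: phi_incr => // z /andP[pz _]; have : 0 < z by exact: lt_trans pz.
  nra.
lra.
Qed.

(** Just above [ln a] the [b]-term vanishes, so that [- phi] is nondecreasing
    there; the conclusion is the sign of its derivative at [ln a]. *)
Lemma neg_exponent_bottom : 0 < a -> b <= 1 -> r < 0 -> 1 - r - r * ln a <= 0.
Proof.
move=> a0 b1 r0; rewrite leNgt; apply/negP => h.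
have lb : ln b <= 0 by exact: ln_le0.
have lab : ln a < ln b by rewrite ltr_ln ?posrE.
have la : ln a < 0 by exact: lt_le_trans lb.
have r1 := ratio_lt1 a0 r0.
have [|p [q [mp pq]]] := @in_between2 _ (ln a) (Num.min (ln b) (ratio * ln a)).
  by rewrite lt_min lab/=; nra.
rewrite lt_min => /andP[qb rq].
have zero y : y <= q -> G (b `^ (- r) * y) = 0.
  move=> yq; apply: (@G_bottom a) => //; first by rewrite lexx ltW.
  by rewrite -ratioE ltr_pM2l ?powR_gt0// (le_lt_trans yq).
have q0 := lt_le_trans qb lb; have p0 := lt_trans pq q0.
have e1 := FEa (ltr0_neq0 p0) (ltW mp) (lt_trans pq qb).
have e2 := FEa (ltr0_neq0 q0) (ltW (lt_trans mp pq)) qb.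
rewrite zero ?(ltW pq)// in e1; rewrite zero ?lexx// in e2.
have : a * G (a `^ (- r) * p) <= a * G (a `^ (- r) * q).
  by rewrite ler_pM2l// Gnd// ler_pM2l ?powR_gt0// ltW.
have : phi r p < phi r q.
  by apply: phi_incr => // z /andP[pz _]; nra.
lra.
Qed.

(** Just below [ln b] the [a]-term is the constant [a], so that [phi] is
    nondecreasing there. *)
Lemma pos_exponent_top : 1 < b -> 0 < r -> r * (1 + ln b) <= 1.
Proof.
move=> b1 r0; rewrite leNgt; apply/negP => h.
have lb : 0 < ln b by exact: ln_gt0.
pose m : R := Num.max ((1 - r) / r) 0.
have mb : m < ln b by rewrite gt_max lb andbT ltr_pdivrMr//; lra.
have key p q : m < p -> p < q -> q < ln b ->
    b * G (b `^ (- r) * p) = phi r p -> b * G (b `^ (- r) * q) = phi r q -> False.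
  move=> mp pq qb e1 e2.
  have : b * G (b `^ (- r) * p) <= b * G (b `^ (- r) * q).
    by rewrite ler_pM2l// Gnd// ler_pM2l ?powR_gt0// ltW.
  have : phi r q < phi r p.
    apply: phi_decr => // z /andP[pz _].
    move: mp; rewrite gt_max ltr_pdivrMr// => /andP[mp _]; nra.
  lra.
have nz p : m < p -> p != 0 by rewrite gt_max => /andP[_ p0]; rewrite gt_eqF.
move: a_ge0; rewrite le_eqVlt => /orP[/eqP a0|a0].
  have [p [q [mp pq qb]]] := in_between2 mb.
  apply: (key p q) => //.
    have := FE (nz _ mp) (expR_between _ (lt_trans pq qb)).
    by rewrite -a0 ltxx mul0r !subr0; apply.
  have := FE (nz _ (lt_trans mp pq)) (expR_between _ qb).
  by rewrite -a0 ltxx mul0r !subr0; apply.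
have lab : ln a < ln b by rewrite ltr_ln ?posrE.
have r1 := ratio_gt1 a0 r0.
have [|p [q [+ pq qb]]] := @in_between2 _ (Num.max m (Num.max (ln a) (ln b / ratio))) (ln b).
  by rewrite gt_max mb gt_max lab/= ltr_pdivrMr ?ratio_gt0// ltr_pMr.
rewrite gt_max => /andP[mp]; rewrite gt_max => /andP[ap rp].
have one y : p <= y -> G (a `^ (- r) * y) = 1.
  move=> py; apply: (@G_top b) => //; first by rewrite lexx ltW.
  rewrite -ratioE ler_pM2l ?powR_gt0// -ler_pdivrMl ?ratio_gt0// mulrC.
  exact: le_trans (ltW rp) py.
apply: (key p q) => //.
  by have := FEa (nz _ mp) (ltW ap) (lt_trans pq qb); rewrite one//; lra.
by have := FEa (nz _ (lt_trans mp pq)) (ltW (lt_trans ap pq)) qb; rewrite one ?(ltW pq)//; lra.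
Qed.

(** Just above [ln a] the [b]-term vanishes, so that [phi] would have to be
    nonincreasing there, which [pos_exponent_top] rules out. *)
Lemma pos_exponent_bottom : 1 < a -> 0 < r -> False.
Proof.
move=> a1 r0; have a0 := lt_trans ltr01 a1.
have top := pos_exponent_top (lt_trans a1 ab) r0.
have lab : ln a < ln b by rewrite ltr_ln ?posrE.
have la : 0 < ln a by exact: ln_gt0.
have r1 := ratio_gt1 a0 r0.
have [|p [q [mp pq]]] := @in_between2 _ (ln a) (Num.min (ln b) (ratio * ln a)).
  by rewrite lt_min lab ltr_pMl.
rewrite lt_min => /andP[qb rq].
have zero y : y <= q -> G (b `^ (- r) * y) = 0.
  move=> yq; apply: (@G_bottom a) => //; first by rewrite lexx ltW.
  by rewrite -ratioE ltr_pM2l ?powR_gt0// (le_lt_trans yq).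
have p0 := lt_trans la mp; have q0 := lt_trans p0 pq.
have e1 := FEa (lt0r_neq0 p0) (ltW mp) (lt_trans pq qb).
have e2 := FEa (lt0r_neq0 q0) (ltW (lt_trans mp pq)) qb.
rewrite zero ?(ltW pq)// in e1; rewrite zero ?lexx// in e2.
have : a * G (a `^ (- r) * p) <= a * G (a `^ (- r) * q).
  by rewrite ler_pM2l// Gnd// ler_pM2l ?powR_gt0// ltW.
have : phi r p < phi r q.
  by apply: phi_incr => // z /andP[_ zq]; have := lt_trans zq qb; nra.
lra.
Qed.

(** Here [phi] is the left-hand side [b * G _ <= b], but [phi (ln b)] exceeds [b]. *)
Lemma small_base_zero_end : a = 0 -> b < 1 -> 0 < r -> False.
Proof.
move=> a0 b1 r0.
have lb : ln b < 0 by rewrite ln_lt0// b_gt0.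
have phib : b < phi r (ln b) by rewrite /phi lnK ?posrE// ltr_pMr//; nra.
have cphi := is_derive1_continuous (is_derive_phi r (ln b)).
have [y [yb by_]] : exists y, y < ln b /\ b < phi r y.
  apply: (@filter_ex _ ((ln b)^'-)).
  apply: filterI; first exact: nbhs_left_lt.
  by have /cvgr_gt := cvg_at_left_filter cphi; apply.
have ay : 0 < a -> ln a <= y by rewrite a0 ltxx.
have := FE (ltr0_neq0 (lt_trans yb lb)) (expR_between ay yb).
rewrite a0 mul0r !subr0 => e.
have /andP[_ G1] := G01 (b `^ (- r) * y).
have : b * G (b `^ (- r) * y) <= b by rewrite ger_pMr.
lra.
Qed.

(** Here [G] is [phi] to the left of [0], where [phi] decreases near [0]. *)
Lemma unit_top_zero_end : a = 0 -> b = 1 -> 1 < r -> False.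
Proof.
move=> a0 b1 r1; have r0 := lt_trans ltr01 r1.
have [|p [q [mp pq q0]]] := @in_between2 _ ((1 - r) / r) 0.
  by rewrite pmulr_llt0 ?invr_gt0// subr_lt0.
have lb : ln b = 0 by rewrite b1 ln1.
have ay y : 0 < a -> ln a <= y by rewrite a0 ltxx.
have Gphi y : y < 0 -> G (b `^ (- r) * y) = phi r y.
  move=> y0; have := FE (ltr0_neq0 y0) (expR_between (@ay y) _).
  by rewrite lb a0 mul0r !subr0 b1 mul1r; apply.
have : G (b `^ (- r) * p) <= G (b `^ (- r) * q).
  by rewrite Gnd// ler_pM2l ?powR_gt0// ltW.
rewrite !Gphi ?(lt_trans pq q0)//.
have : phi r q < phi r p.
  apply: phi_decr => // z /andP[pz _].
  by move: mp; rewrite ltr_pdivrMr// => mp; nra.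
lra.
Qed.

Section exponential_sum_form.
Context (a_gt0 : 0 < a) (b_le1 : b <= 1) (r_gt0 : 0 < r).

Let H y := G (b `^ (- r) * y).

(** Multiplying by [ratio > 1] moves a negative [y] down until it leaves the
    range, below which [H] vanishes; unfolding the functional equation until then
    leaves a finite sum. *)
Lemma H_sum n y : y < ln b -> (forall i, (i < n)%N -> ln a <= ratio ^+ i * y) ->
  ratio ^+ n * y < ln a ->
  b * H y = \sum_(i < n) (a / b) ^+ i * (phi r (ratio ^+ i * y) - a).
Proof.
have lb : ln b <= 0 by exact: ln_le0.
have r1 := ratio_gt1 a_gt0 r_gt0.
elim: n y => [|n IH] y yb ih yn.
  rewrite big_ord0 /H (@G_bottom b)// ?mulr0//.
  - by rewrite lexx ltW.
  - by rewrite ltr_pM2l ?powR_gt0// -[y]mul1r -(expr0 ratio).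
have y0 : y < 0 by exact: lt_le_trans lb.
have ay : ln a <= y by have := ih 0%N isT; rewrite expr0 mul1r.
have e := FEa (ltr0_neq0 y0) ay yb.
rewrite big_ord_recl /= !expr0 !mul1r.
have cy : ratio * y < y by rewrite gtr_nMl.
have := IH (ratio * y) (lt_trans cy yb) _ _.
rewrite mulrA -exprSr => /(_ _ yn).
have ih' i : (i < n)%N -> ln a <= ratio ^+ i * (ratio * y).
  by move=> i_n; rewrite mulrA -exprSr; exact: ih.
move=> /(_ ih') IHy.
have -> : \sum_(i < n) (a / b) ^+ bump 0 i * (phi r (ratio ^+ bump 0 i * y) - a) =
    a / b * \sum_(i < n) (a / b) ^+ i * (phi r (ratio ^+ i * (ratio * y)) - a).
  rewrite mulr_sumr; apply: eq_bigr => i _; rewrite /bump leq0n add1n.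
  by rewrite [ratio ^+ _]exprSr -[_ * ratio * y]mulrA exprS -[a / b * _ * _]mulrA.
rewrite -IHy /H ratioE mulrA divfK ?gt_eqF//.
move: e; rewrite /H; lra.
Qed.

(** Between [ratio * ln b] and [ln b] the value of [H] is [1], because the top of
    the support is governed by [a] when [b < 1]. On a subinterval the finite sum
    of [H_sum] has a fixed number of terms and is therefore constant. *)
Lemma small_base : b < 1 -> False.
Proof.
move=> b1.
have lb : ln b < 0 by rewrite ln_lt0// b_gt0.
have r1 := ratio_gt1 a_gt0 r_gt0; have r0 := ratio_gt0 a_gt0.
have one y : ratio * ln b <= y -> H y = 1.
  move=> yb; apply: (@G_top a) => //; first by rewrite lexx ltW.
  by rewrite -ratioE ler_pM2l ?powR_gt0.
have [|y0 [y2 [by0 y02 y2b]]] := @in_between2 _ (ratio * ln b) (ln b).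
  by rewrite gtr_nMl.
have y0b := lt_trans y02 y2b.
have y0_lt0 := lt_trans y0b lb.
have ex_n : exists n, ratio ^+ n * y0 < ln a.
  have [n hn] := expr_unbounded (ln a / y0) r1; exists n.
  by rewrite ltr_ndivrMr in hn.
have [n yn nmin] := find_ex_minn ex_n.
have low i : (i < n)%N -> ln a <= ratio ^+ i * y0.
  by move=> i_n; rewrite leNgt; apply/negP => /nmin; rewrite leqNgt i_n.
pose y1 := Num.min (ln b) (ln a / ratio ^+ n).
have y01' : y0 < y1.
  by rewrite lt_min y0b ltr_pdivlMr ?exprn_gt0// mulrC.
have sumE y : y0 < y < y1 ->
    b * 1 = \sum_(i < n) (a / b) ^+ i * (phi r (ratio ^+ i * y) - a).
  move=> /andP[yy0]; rewrite lt_min => /andP[yy1 yy2].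
  rewrite -(one y) ?(le_trans (ltW by0) (ltW yy0))//; apply: H_sum => //.
    by move=> i i_n; apply: (le_trans (low i i_n)); rewrite ler_pM2l ?exprn_gt0// ltW.
  by rewrite mulrC -ltr_pdivlMr ?exprn_gt0.
have [p [q [y0p pq qy1]]] := in_between2 y01'.
have y1lb : y1 <= ln b by rewrite ge_min lexx.
case: n yn low y1 y01' y1lb sumE qy1 {nmin} => [|n] yn low y1 y01' y1lb sumE qy1.
  have := sumE p _; rewrite big_ord0 mulr1 => /(_ _)/eqP.
  by rewrite gt_eqF// => h; apply: notF; apply: h; rewrite y0p (lt_trans pq).
have y1b : y1 <= 0 by rewrite (le_trans _ (ltW lb)).
apply: (@exp_sum_not_constant _ (a / b) ratio r _ r1 r_gt0 n y0 y1 y01' y1b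
  (b + \sum_(i < n.+1) (a / b) ^+ i * a)).
  by rewrite divr_gt0.
move=> y yy; have eb := sumE y yy; rewrite mulr1 in eb.
have -> : \sum_(i < n.+1) (a / b) ^+ i * phi r (ratio ^+ i * y) =
    \sum_(i < n.+1) (a / b) ^+ i * (phi r (ratio ^+ i * y) - a) +
    \sum_(i < n.+1) (a / b) ^+ i * a.
  by rewrite -big_split/=; apply: eq_bigr => i _; rewrite -mulrDr subrK.
by rewrite -eb.
Qed.

(** Write [y = - expR t]. Up to positive factors the derivative of the sum in
    [H_sum] is minus that of [S t], where [S] adds the values of
    [K t = expR (alpha * t - expR t)] along an arithmetic progression of step
    [P]. Monotonicity of [H] makes [S] nonincreasing on the interval where the sum
    has [n.+1] terms. Between the ends of this interval [S] changes by
    [K T - K (T - n.+1%:R * P)], so that [K T <= K (T - n.+1%:R * P)]; the latter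
    tends to [0] since [alpha > 0] when [r > 1]. *)
Lemma unit_top : b = 1 -> r <= 1.
Proof.
move=> b1; rewrite leNgt; apply/negP => r1.
have c1 := ratio_gt1 a_gt0 r_gt0; have c0 := ratio_gt0 a_gt0.
have lb : ln b = 0 by rewrite b1 ln1.
have a1 : a < 1 by rewrite -b1.
pose x0 := - ln a; have x00 : 0 < x0 by rewrite oppr_gt0 ln_lt0// a_gt0.
pose P := r * x0; have P0 : 0 < P by rewrite mulr_gt0.
have cE : ratio = expR P.
  by rewrite /ratio b1 powR1 divr1 /powR gt_eqF// /P /x0 mulrN mulNr.
have aE : a / b = expR (- x0) by rewrite b1 divr1 /x0 opprK lnK.
pose alpha := 1 - r^-1.
have rV : r * r^-1 = 1 by rewrite divff// gt_eqF.
have al0 : 0 < alpha by rewrite subr_gt0 invf_lt1.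
pose K t := expR (alpha * t - expR t).
pose T := ln x0.
suff step n : K T <= K (T - n.+1%:R * P).
  pose n := Num.bound (x0 / (alpha * P)).
  have hn : x0 / (alpha * P) < n%:R.
    by apply: archi_boundP; rewrite divr_ge0 ?mulr_ge0 ?ltW.
  rewrite ltr_pdivrMr ?mulr_gt0// in hn.
  have := step n; rewrite /K ler_expR /T lnK ?posrE// => h.
  have := expR_gt0 (ln x0 - n.+1%:R * P).
  rewrite -natr1 in h *; have : 0 < alpha * P by rewrite mulr_gt0.
  set E := expR _ in h *.
  have eq1 : alpha * (ln x0 - (n%:R + 1) * P) =
    alpha * ln x0 - n%:R * (alpha * P) - alpha * P by ring.
  by rewrite eq1 in h; lra.
pose S t := \sum_(i < n.+1) K (t + i%:R * P).
pose dS t := \sum_(i < n.+1) K (t + i%:R * P) * (alpha - expR (t + i%:R * P)).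
have S' t : is_derive t (1 : R) S (dS t).
  have -> : S = \sum_(i < n.+1) (fun t => K (t + i%:R * P)).
    by apply/funext => z; rewrite fct_sumE.
  apply: is_derive_sum => i.
  have d1 : is_derive t (1 : R) (fun t => t + i%:R * P) 1.
    by apply: is_derive_eq; rewrite addr0.
  have d2 := @is_derive1_comp R expR _ t _ _ (is_derive_expR _) d1.
  have d3 : is_derive t (1 : R) (fun t => alpha * (t + i%:R * P)) alpha.
    by apply: (is_derive_eq (is_deriveM (is_derive_cst alpha t 1) d1)); rewrite /GRing.scale/=; ring.
  have d4 := @is_derive1_comp R expR _ t _ _ (is_derive_expR _) (is_deriveB d3 d2).
  by apply: (is_derive_eq d4); rewrite mulr1.
have [z zI eS] : exists2 z, T - n.+1%:R * P < z < T - n%:R * P &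
    S (T - n%:R * P) - S (T - n.+1%:R * P) = dS z * (T - n%:R * P - (T - n.+1%:R * P)).
  have lt1 : T - n.+1%:R * P < T - n%:R * P by rewrite ltrD2l ltrN2 ltr_pM2r// ltr_nat.
  have [|z] := @MVT R S dS _ _ lt1.
  - by apply: continuous_subspaceT => z; exact: is_derive1_continuous (S' z).
  - by rewrite in_itv/= => zI e; exists z.
have SB : S (T - n%:R * P) - S (T - n.+1%:R * P) = K T - K (T - n.+1%:R * P).
  rewrite /S big_ord_recr [X in _ - X]big_ord_recl /= subrK mul0r addr0.
  set A := \sum_(i < n) _; set B := \sum_(i < n) _.
  have -> : A = B.
    apply: eq_bigr => i _; congr (K _); rewrite /bump leq0n add1n -!natr1; ring.
  ring.
suff : dS z <= 0.
  move: eS; rewrite SB => eS dz.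
  have : 0 < T - n%:R * P - (T - n.+1%:R * P) by rewrite -natr1 mulrDl mul1r; lra.
  by move=> h; rewrite -subr_le0 eS pmulr_lle0.
pose y := - expR z.
pose f y := \sum_(i < n.+1) (a / b) ^+ i * (phi r (ratio ^+ i * y) - a).
pose df y := \sum_(i < n.+1) (a / b) ^+ i * (ratio ^+ i * (expR (ratio ^+ i * y) * (1 - r - r * (ratio ^+ i * y)))).
have f' t : is_derive t (1 : R) f (df t).
  have -> : f = \sum_(i < n.+1) (fun y => (a / b) ^+ i * (phi r (ratio ^+ i * y) - a)).
    by apply/funext => w; rewrite fct_sumE.
  apply: is_derive_sum => i.
  have d1 : is_derive t (1 : R) (fun y => ratio ^+ i * y) (ratio ^+ i).
    by apply: is_derive_eq; rewrite /GRing.scale/=; ring.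
  have d2 := @is_derive1_comp R (phi r) _ t _ _ (is_derive_phi r _) d1.
  apply: (is_derive_eq (is_deriveM (is_derive_cst ((a / b) ^+ i) t 1) (is_deriveB d2 (is_derive_cst a t 1)))).
  rewrite /GRing.scale/=; ring.
have eci i : ratio ^+ i * y = - expR (z + i%:R * P).
  by rewrite /y cE -expRM_natl mulrN -expRD addrC.
have -> : dS z = - (expR (alpha * z) / r * df y).
  rewrite /dS /df mulr_sumr -sumrN; apply: eq_bigr => i _; rewrite eci.
  rewrite /K cE aE -!expRM_natl.
  have -> : alpha * (z + i%:R * P) - expR (z + i%:R * P) =
     (alpha * z + i%:R * (- x0) + i%:R * P) + (- expR (z + i%:R * P)).
    have : alpha * P = P - x0 by rewrite /alpha /P mulrBl mul1r mulrA [r^-1 * r]mulrC rV mul1r.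
    by move=> e; rewrite mulrDr [alpha * (_ * P)]mulrCA e; ring.
  set E := expR (z + i%:R * P); rewrite !expRD.
  have -> : alpha - E = - (r^-1 * (1 - r - r * (- E))).
    rewrite /alpha.
    by rewrite mulrBr mulrBr mulr1 mulrA [r^-1 * r]mulrC rV mul1r; ring.
  ring.
rewrite oppr_le0 mulr_ge0 ?divr_ge0 ?expR_ge0 ?(ltW r_gt0)//.
have powE k : expR (T - k%:R * P) = x0 / ratio ^+ k.
  by rewrite expRD /T lnK ?posrE// expRN cE -expRM_natl.
have fE w : y <= w -> w < - expR (T - n.+1%:R * P) -> f w = b * H w.
  move=> yw wT; rewrite (@H_sum n.+1)//.
  - rewrite lb; apply: (lt_trans wT); by rewrite oppr_lt0 expR_gt0.
  - move=> i; rewrite ltnS => i_n.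
    have : - expR (T - n%:R * P) <= w.
      apply: le_trans yw; rewrite /y lerN2 ler_expR ltW//; by case/andP: zI.
    rewrite powE -(ler_pM2l (exprn_gt0 i c0)).
    apply: le_trans; rewrite -[ln a]opprK -/x0 mulrN lerN2 mulrCA ger_pMr//.
    by rewrite ler_pdivrMr ?exprn_gt0// mul1r ler_weXn2l// ltW.
  - move: wT; rewrite powE -(ltr_pM2l (exprn_gt0 n.+1 c0)) => /lt_le_trans; apply.
    by rewrite mulrN mulrCA divff ?mulr1 ?expf_neq0 ?gt_eqF// /x0 opprK.
have yT : y < - expR (T - n.+1%:R * P) by rewrite /y ltrN2 ltr_expR; case/andP: zI.
apply: (@ndecr_derive_ge0 _ f y (- expR (T - n.+1%:R * P))) => // w /andP[yw wT].
rewrite (fE y (lexx _) yT) (fE w (ltW yw) wT) ler_pM2l// Gnd//.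
by rewrite ler_pM2l ?powR_gt0// ltW.
Qed.

End exponential_sum_form.

End necessary.

(** * From inverse tower laws to the functional equation *)

Section inverse_tower.
Context (R : realType) (a b r : R) (a_ge0 : 0 <= a) (ab : a < b) (r_neq0 : r != 0).
Context d (Omega : measurableType d) (P : probability Omega R) (U : {RV P >-> R}).
Context (U_unif : uniformly_distributed U ab).

Let b_gt0 : 0 < b. Proof. exact: le_lt_trans ab. Qed.

Lemma power_lawE B : measurable B -> distribution P (rv_powR U r) B = power_law r ab B.
Proof.
move=> mB.
have -> : distribution P (rv_powR U r) B = distribution P U ((fun v => v `^ r) @^-1` B) by [].
rewrite U_unif//; exact: (measurable_preimage (@measurable_powR R r) mB).
Qed.

Context (nu : probability R R) (nu_inv : inverse_tower_distribution (rv_powR U r) nu).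

Lemma inverse_tower_fixpoint C : measurable C ->
  power_law r ab C = (nu \x power_law r ab)%E (powp @^-1` C).
Proof.
have nu_inv' := nu_inv; destruct nu_inv' as (d1 & Omega1 & P1 & A & L & H1); case: H1 => iidA A0 cvL eqL.
have lawL B : measurable B -> distribution P1 L B = power_law r ab B.
  by move=> mB; rewrite eqL// power_lawE.
move=> mC; rewrite -lawL// (tower_limit_fixpoint iidA A0 cvL mC).
exact: (@prod_push _ _ _ _ _ nu (distribution P1 L) _ _ _ _ nu (power_law r ab) id id
  (@measurable_id _ _ _) (@measurable_id _ _ _) (fun _ _ => erefl) lawL
  _ (measurable_preimage (@measurable_powp R) mC)).
Qed.

Let G := cdfR (log_law r nu).

Let G01 x : 0 <= G x <= 1.
Proof. by rewrite cdfR_ge0 cdfR_le1. Qed.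

Let Gnd : {homo G : x y / x <= y}.
Proof. by move=> x y; exact: cdfR_ndecr. Qed.

Let Grc x : G y @[y --> x^'+] --> G x.
Proof. exact: cdfR_rc. Qed.

Let GI y : mixed r G y a b = clamp a b (expR y) - a.
Proof.
rewrite /mixed /Rintegral /section_cdf.
by rewrite (log_law_integral a_ge0 r_neq0 inverse_tower_fixpoint).
Qed.

Lemma inverse_tower_FE y : y != 0 -> a <= expR y < b ->
  b * G (b `^ (- r) * y) - a * G (a `^ (- r) * y) = phi r y - a.
Proof. exact: (functional_eq a_ge0 ab r_neq0 Gnd G01 Grc GI). Qed.

Lemma inverse_tower_above y v : b <= expR y -> 0 < v -> a <= v <= b ->
  G (v `^ (- r) * y) = 1.
Proof. exact: (G_above ab Gnd G01 Grc GI). Qed.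

Lemma inverse_tower_below y v : expR y < a -> a <= v <= b -> G (v `^ (- r) * y) = 0.
Proof. exact: (G_below ab Gnd G01 GI). Qed.

Lemma inverse_tower_zero : G 0 * (b - a) = clamp a b 1 - a.
Proof. exact: (G_zero ab Gnd G01 GI). Qed.

(** The bases are positive everywhere. *)
Lemma nu_pos : nu `]-oo, 0]%classic = 0%E.
Proof.
have nu_inv' := nu_inv; destruct nu_inv' as (d1 & Omega1 & P1 & A & L & H1); case: H1 => iidA A0 cvL eqL.
rewrite -(iidA.2 0%N)// /distribution/pushforward (_ : _ @^-1` _ = set0) ?measure0//.
by rewrite -subset0 => w /=; rewrite in_itv/= leNgt A0.
Qed.

(** If [1 < x = r * ln a] then [U `^ r] exceeds [expR 1] with positive probability,
    while the bases have logarithm at most [x * expR (- x) <= expR (- 1)], and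
    towers over such bases never exceed [expR 1]. *)
Lemma neg_exponent_tower : 0 < a -> r < 0 -> 1 - r - r * ln a <= 0 -> False.
Proof.
move=> a0 r0 hr.
have nu_inv' := nu_inv; destruct nu_inv' as (d1 & Omega1 & P1 & A & L & H1); case: H1 => iidA A0 cvL eqL.
pose x := r * ln a; have x1 : 1 < x by rewrite /x; lra.
have Gs : G (expR (- 1) / r) = 0.
  apply: (G_bottom inverse_tower_below (v := a)) => //.
    by rewrite lexx ltW.
  rewrite ltr_ndivrMr// /powR gt_eqF// -mulrA [ln a * r]mulrC mulNr -/x.
  rewrite expRN mulrC ltr_pdivrMr ?expR_gt0// -expRD addrC.
  have x10 : x - 1 != 0 by rewrite subr_eq0 gt_eqF.
  by have := expR_gt1Dx x10; rewrite [1 + _]addrC subrK.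
have Asmall i : {ae P1, forall w, ln (A i w) <= expR (- 1)}.
  have mS : measurable (log_r r @^-1` `]-oo, expR (- 1) / r]%classic).
    exact: (measurable_preimage (measurable_log_r r)).
  exists (A i @^-1` (log_r r @^-1` `]-oo, expR (- 1) / r]%classic)); split.
  - exact: measurable_preimage.
  - have -> : P1 (A i @^-1` (log_r r @^-1` `]-oo, expR (- 1) / r]%classic)) =
        log_law r nu `]-oo, expR (- 1) / r]%classic by exact: iidA.2 mS.
    by rewrite -cdfR_fin -/G Gs.
  - move=> w /= /negP; rewrite -ltNge => h.
    by rewrite in_itv/= /log_r ler_nM2r ?invr_lt0// ltW.
(* [s `^ t <= expR 1] when [ln s <= expR (- 1)] and [t <= expR 1] *)
have tower_le (s : nat -> R) n : (forall i, 0 < s i) -> (forall i, ln (s i) <= expR (- 1)) ->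
    0 <= tower s n <= expR 1.
  elim: n s => [|n IH] s s0 sl /=; first by rewrite ler01 -[leLHS]expR0 ler_expR ler01.
  rewrite powR_ge0/=; have /andP[t0 te] := IH (fun i => s i.+1) (fun i => s0 i.+1) (fun i => sl i.+1).
  rewrite /powR gt_eqF// ler_expR; apply: le_trans (ler_wpM2l t0 (sl 0%N)) _.
  by rewrite expRN ler_pdivrMr ?expR_gt0// mul1r.
have Lsmall : {ae P1, forall w, L w <= expR 1}.
  have := ae_foralln Asmall; apply: filterS2 cvL => w Lw sw.
  apply: (cvgr_to_le Lw); near=> n.
  by have /andP[] := tower_le (fun i => A i w) n (fun i => A0 i w) sw.
(* [V `^ r > expR 1] on the event [ln V <= y], which has positive probability
   because [ln a < y] *)
pose y := r^-1 - 2^-1.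
have mC := measurable_log_r_le r y.
pose S := [set t : R | ln t / r <= y].
have : (0 < distribution P1 L S)%E.
  rewrite eqL// power_lawE// power_law_log_le// lte_fin mulr_gt0// ?invr_gt0 ?subr_gt0//.
  rewrite /clamp lt_min ab lt_max; apply/orP; right.
  rewrite -[ltLHS](@lnK _ a) ?posrE// ltr_expR /y.
  have rV : r^-1 * r = 1 by rewrite mulVf.
  have r'0 : r^-1 < 0 by rewrite invr_lt0.
  have : r^-1 * x <= r^-1 * (1 - r) by rewrite ler_nM2l//; rewrite /x; lra.
  by rewrite /x mulrA mulrBr rV mulr1 mul1r; lra.
have [N [mN N0 subN]] := Lsmall.
rewrite ltNge => /negP; apply; rewrite -N0 /distribution/pushforward.
apply: le_measure; rewrite ?inE//; first exact: measurable_preimage.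
move=> w /= hw; apply: subN => /= Lw.
have : 1 < ln (L w).
  move: hw; rewrite /S/= ler_ndivrMr//; apply: lt_le_trans.
  by rewrite /y mulrBl mulVf//; lra.
have [Lp|Ln] := ltP 0 (L w); last by rewrite ln0// ltr10.
by rewrite -ltr_expR lnK ?posrE// ltNge Lw.
Unshelve. all: by end_near. Qed.

(** The case analysis on the signs of [r], [1 - a] and [b - 1]. *)
Theorem inverse_tower_conditions : 1 \in `[a, b] /\ r \in `[0, (1 + ln b)^-1].
Proof.
have [r0|r0|r0] := ltrgtP 0 r; last by have := r_neq0; rewrite -r0 eqxx.
- have a1 : a <= 1.
    rewrite leNgt; apply/negP => a1.
    exact: (pos_exponent_bottom a_ge0 ab Gnd G01 inverse_tower_FE inverse_tower_above inverse_tower_below a1 r0).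
  have b1 : 1 <= b.
    rewrite leNgt; apply/negP => b1; move: a_ge0; rewrite le_eqVlt => /orP[/eqP a0|a0].
      exact: (small_base_zero_end a_ge0 ab G01 inverse_tower_FE (esym a0) b1 r0).
    exact: (small_base a_ge0 ab Gnd G01 inverse_tower_FE inverse_tower_above inverse_tower_below a0 (ltW b1) r0 b1).
  have lb : 0 <= ln b by exact: ln_ge0.
  split; first by rewrite in_itv/= a1 b1.
  rewrite in_itv/= (ltW r0)/= -[leRHS]mul1r ler_pdivlMr ?ltr_wpDr//.
  move: b1; rewrite le_eqVlt => /orP[/eqP b1|b1]; last first.
    exact: (pos_exponent_top a_ge0 ab Gnd G01 inverse_tower_FE inverse_tower_above b1 r0).
  rewrite -b1 ln1 addr0 mulr1.
  move: a_ge0; rewrite le_eqVlt => /orP[/eqP a0|a0].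
    rewrite leNgt; apply/negP => r1.
    exact: (unit_top_zero_end a_ge0 ab Gnd inverse_tower_FE (esym a0) (esym b1) r1).
  apply: (unit_top a_ge0 ab Gnd inverse_tower_FE inverse_tower_below a0 _ r0 (esym b1)).
  by rewrite -b1.
- exfalso; have [b1|b1] := leP b 1; last first.
    exact: (neg_exponent_top a_ge0 ab Gnd G01 inverse_tower_FE inverse_tower_above b1 r0).
  move: a_ge0; rewrite le_eqVlt => /orP[/eqP a0|a0].
    exact: (neg_exponent_zero_end a_ge0 ab G01 inverse_tower_FE (esym a0) r0).
  apply: (neg_exponent_tower a0 r0).
  exact: (neg_exponent_bottom a_ge0 ab Gnd inverse_tower_FE inverse_tower_below a0 b1 r0).
Qed.

End inverse_tower.

(** * The equation for the distribution function *)

(** Half of the exponent absorbs the logarithm: [ln x] is at most of order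
    [x `^ (- p / 2)]. *)
Lemma cvg_powR_ln0 (R : realType) (p : R) : 0 < p -> x `^ p * ln x @[x --> 0^'+] --> (0 : R).
Proof.
move=> p0; pose q := p / 2; have q0 : 0 < q by rewrite divr_gt0.
have lim : - (x `^ q / q) @[x --> 0^'+] --> (0 : R).
  rewrite -[X in _ --> X]oppr0; apply: cvgN; rewrite -[X in _ --> X](mul0r q^-1).
  by apply: cvgM; [exact: powR_cvg0|exact: cvg_cst].
apply: (squeeze_cvgr _ lim (cvg_cst 0)).
near=> x; have x0 : 0 < x by near: x; exact: nbhs_right_gt.
have x1 : x < 1 by near: x; exact: nbhs_right_lt.
have lx : ln x <= 0 by exact: ln_le0 (ltW x1).
apply/andP; split; last by rewrite mulr_ge0_le0 ?powR_ge0.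
have pq : p = q + q by rewrite /q; lra.
have -> : x `^ p = x `^ q * x `^ q by rewrite {1}pq powRD// (gt_eqF x0) implybT.
rewrite -mulrA lerNl -!mulrN ler_pM2l ?powR_gt0//.
rewrite -[leRHS]mul1r ler_pdivlMr// -mulrA.
have -> : - ln x * q = ln (x `^ (- q)) by rewrite ln_powR; ring.
rewrite -[leRHS](@divff _ (x `^ q)) ?gt_eqF ?powR_gt0// ler_pM2l ?powR_gt0// -powRN.
have X0 := powR_gt0 (- q) x0.
by have := @ln_sublinear _ (x `^ (- q)) X0 => /ltW.
Unshelve. all: by end_near. Qed.

Section cdf_equation.
Context (R : realType) (a b r : R) (a_ge0 : 0 <= a) (ab : a < b) (r_gt0 : 0 < r).

Let b_gt0 : 0 < b. Proof. exact: le_lt_trans ab. Qed.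

Let br_gt0 : 0 < b `^ r. Proof. exact: powR_gt0. Qed.

(** The value of [y] at which the functional equation evaluates [G] in
    [ln x / r]. *)
Let rescaled x := b `^ r * ln x / r.

Let rescaledE x : b `^ (- r) * rescaled x = ln x / r.
Proof. by rewrite /rescaled powRN mulrA mulrA mulVf ?mul1r// gt_eqF. Qed.

Lemma lt_end c x : 0 < c -> 0 < x -> (x < c `^ (r / b `^ r)) = (expR (rescaled x) < c).
Proof.
move=> c0 x0; have -> : (x < c `^ (r / b `^ r)) = (ln x < ln (c `^ (r / b `^ r))).
  by rewrite ltr_ln ?posrE ?powR_gt0.
rewrite ln_powR mulrAC ltr_pdivlMr//.
have -> : (expR (rescaled x) < c) = (rescaled x < ln c) by rewrite -[RHS]ltr_expR lnK.
by rewrite /rescaled ltr_pdivrMr// mulrC [ln c * r]mulrC.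
Qed.

(** The main branch is the functional equation at [rescaled x], since
    [x `^ (b `^ r / r) = expR (rescaled x)] and the [a]-term evaluates [F] at
    [x `^ (b `^ r / a `^ r)]. *)
Lemma cdf_eqn_of_log (F G : R -> R) :
  (forall x, x <= 0 -> F x = 0) -> (forall x, 0 < x -> F x = G (ln x / r)) ->
  (forall y, y != 0 -> a <= expR y < b ->
     b * G (b `^ (- r) * y) - a * G (a `^ (- r) * y) = phi r y - a) ->
  (forall y, b <= expR y -> G (b `^ (- r) * y) = 1) ->
  (forall y, expR y < a -> G (b `^ (- r) * y) = 0) ->
  G 0 * (b - a) = 1 - a ->
  inverse_tower_cdf_eqn a b r F.
Proof.
move=> F0 FG FE Gab Gbe G0; split.
- move=> x; rewrite in_itv/= => /andP[ax xb] x1 x0.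
  have xp : 0 < x by rewrite lt0r x0 (le_trans _ ax)// powR_ge0.
  have l0 : ln x != 0.
    by apply/eqP => l0; move: x1; rewrite -[x]lnK ?posrE// l0 expR0 eqxx.
  have y0 : rescaled x != 0.
    by rewrite !mulf_eq0 invr_eq0 !negb_or l0 !gt_eqF.
  have /(FE _ y0) : a <= expR (rescaled x) < b.
    rewrite -lt_end// xb andbT; move: a_ge0; rewrite le_eqVlt => /orP[/eqP<-|a0].
      exact: expR_ge0.
    by rewrite leNgt -lt_end// -leNgt.
  rewrite rescaledE -FG// /main_branch => FEx.
  have -> : x `^ (b `^ r / r) = expR (rescaled x).
    by rewrite /powR (gt_eqF xp) /rescaled mulrAC.
  have -> : b `^ r * ln x = r * rescaled x by rewrite [RHS]mulrC divfK// gt_eqF.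
  have b0 : b != 0 by rewrite gt_eqF.
  apply: (mulfI b0); move: FEx; rewrite /phi => /eqP; rewrite subr_eq => /eqP ->.
  case: eqP => [->|/eqP a0].
    by field.
  have ap : 0 < a by rewrite lt0r a0.
  have -> : a `^ (- r) * rescaled x = ln (x `^ (b `^ r / a `^ r)) / r.
    by rewrite ln_powR powRN /rescaled; ring.
  by rewrite -FG ?powR_gt0//; field.
- move=> a0; rewrite F0// /main_branch a0 eqxx.
  under eq_fun do rewrite mul0r subr0 addr0 mulrAC mulrBr mulr1 mulrCA.
  have e0 : (0 : R) = (0 - b `^ r * 0) / b by rewrite mulr0 subr0 mul0r.
  rewrite [X in nbhs X]e0 => {e0}.
  have p0 : 0 < b `^ r / r by rewrite divr_gt0.
  apply: cvgM; last exact: cvg_cst.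
  apply: cvgB; first exact: powR_cvg0.
  by apply: cvgM; [exact: cvg_cst|exact: cvg_powR_ln0].
- move=> x xa; have [/F0//|x0] := leP x 0.
  move: a_ge0; rewrite le_eqVlt => /orP[/eqP a0|a0].
    move: xa; rewrite -a0 powR0 ?gt_eqF ?divr_gt0// => /(lt_trans x0).
    by rewrite ltxx.
  by rewrite FG// -rescaledE Gbe// -lt_end.
- move=> x bx; have x0 : 0 < x by apply: lt_le_trans bx; exact: powR_gt0.
  by rewrite FG// -rescaledE Gab// leNgt -lt_end// -leNgt.
- rewrite FG// ln1 mul0r -G0 mulfK// subr_eq0 gt_eqF//.
Qed.

(** The recursion sends [x] to [x `^ c] with [1 < c], which leaves the interval
    of the main branch after finitely many steps. *)
Lemma cdf_eqn_unique (F1 F2 : R -> R) :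
  inverse_tower_cdf_eqn a b r F1 -> inverse_tower_cdf_eqn a b r F2 -> F1 = F2.
Proof.
move=> h1 h2; apply/funext => x.
have outside z : z < a `^ (r / b `^ r) \/ b `^ (r / b `^ r) <= z -> F1 z = F2 z.
  by case=> hz; [rewrite (cdf_below h1)// (cdf_below h2)|rewrite (cdf_above h1)// (cdf_above h2)].
have inside z : (z \in `[a `^ (r / b `^ r), b `^ (r / b `^ r)[ -> F1 z = F2 z) -> F1 z = F2 z.
  move=> h; have [az|za] := leP (a `^ (r / b `^ r)) z; last by apply: outside; left.
  have [bz|zb] := leP (b `^ (r / b `^ r)) z; first by apply: outside; right.
  by apply: h; rewrite in_itv/= az zb.
have one : F1 1 = F2 1 by rewrite (cdf_one h1) (cdf_one h2).
move: a_ge0; rewrite le_eqVlt => /orP[/eqP a0|a0].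
  have e z : main_branch a b r F1 z = main_branch a b r F2 z.
    by rewrite /main_branch -a0 eqxx.
  apply: inside => xin; have [->//|x1] := eqVneq x 1.
  have [->|x0] := eqVneq x 0.
    have m1 := cdf_main0 h1 (esym a0); have m2 := cdf_main0 h2 (esym a0).
    rewrite (funext e) in m1; exact: cvg_unique m1 m2.
  by rewrite (cdf_main h1)// (cdf_main h2).
pose c := b `^ r / a `^ r.
have c1 : 1 < c.
  rewrite /c ltr_pdivlMr ?powR_gt0// mul1r.
  exact: lt_powRl.
(* [M <= `|ln z|] puts [z] outside the interval of the main branch *)
pose M := `|ln (a `^ (r / b `^ r))| + `|ln (b `^ (r / b `^ r))| + 1.
have far n z : 0 < z -> z != 1 -> M <= `|ln z| * c ^+ n -> F1 z = F2 z.
  elim: n z => [|n IH] z z0 z1 hz.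
    apply: inside; rewrite in_itv/= => /andP[az zb]; exfalso; move: hz; apply/negP.
    rewrite -ltNge expr0 mulr1 /M.
    have l1 : ln (a `^ (r / b `^ r)) <= ln z by rewrite ler_ln ?posrE ?powR_gt0.
    have l2 : ln z <= ln (b `^ (r / b `^ r)) by rewrite ler_ln ?posrE ?powR_gt0// ltW.
    rewrite ltr_norml; apply/andP; split.
      have := ler_norm (- ln (a `^ (r / b `^ r))); rewrite normrN.
      have := normr_ge0 (ln (b `^ (r / b `^ r))); lra.
    have := ler_norm (ln (b `^ (r / b `^ r))).
    have := normr_ge0 (ln (a `^ (r / b `^ r))); lra.
  apply: inside => zin; have z_neq0 : z != 0 by rewrite gt_eqF.
  rewrite (cdf_main h1)// (cdf_main h2)// /main_branch.
  congr (_ + _); rewrite gt_eqF//; congr (_ * _); apply: IH; first exact: powR_gt0.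
    rewrite -ln_eq0 ?powR_gt0// ln_powR -/c mulf_neq0 ?ln_eq0//.
    by rewrite (gt_eqF (lt_trans ltr01 c1)).
  by rewrite ln_powR -/c normrM (gtr0_norm (lt_trans ltr01 c1)); move: hz; rewrite exprS mulrA [c * _]mulrC.
have [x0|x0] := leP x 0.
  by apply: outside; left; apply: (le_lt_trans x0); exact: powR_gt0.
have [->//|x1] := eqVneq x 1.
have lx : 0 < `|ln x| by rewrite normr_gt0 ln_eq0.
have [n nM] := expr_unbounded (M / `|ln x|) c1.
by apply: (far n) => //; rewrite mulrC -ler_pdivrMr// ltW.
Qed.

End cdf_equation.

(** [ln z = 0] for [z <= 0], so the two events differ on the nonpositive
    half-line, which is a null set. *)
Lemma positive_law_cdf (R : realType) (r x : R) (m : probability R R) :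
  m `]-oo, 0]%classic = 0%E -> 0 < r -> 0 < x ->
  m `]-oo, x]%classic = m (log_r r @^-1` `]-oo, ln x / r]%classic).
Proof.
move=> m0 r0 x0; have m_neg : measurable `]-oo, (0 : R)]%classic by [].
have mL : measurable (log_r r @^-1` `]-oo, ln x / r]%classic).
  exact: (measurable_preimage (measurable_log_r r)).
have positive (S : set R) : measurable S -> m S = m (S `\` `]-oo, 0]%classic).
  move=> mS; rewrite -(setIidl (subsetT S)) -{1}(setUv `]-oo, (0 : R)]%classic) setIUr.
  rewrite measureU//; last 3 first.
  - exact: measurableI.
  - by apply: measurableI => //; exact: measurableC.
  - by rewrite setIACA setICr setI0.
  rewrite [X in (X + _)%E](_ : _ = 0%E) ?add0e ?setIT ?setDE//.
  by apply/eqP; rewrite -measure_le0 -m0 le_measure ?inE//; exact: measurableI.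
rewrite [LHS]positive// [RHS]positive//; congr (m _); apply/seteqP.
split => z [/=]; rewrite !in_itv/= => h /negP z0; (split; last exact/negP).
  rewrite /log_r ler_pM2r ?invr_gt0// ler_ln ?posrE//.
  by rewrite ltNge.
by move: h; rewrite /log_r ler_pM2r ?invr_gt0// ler_ln ?posrE// ltNge.
Qed.

Section inverse_tower_cdf.
Context (R : realType) (a b r : R) (a_ge0 : 0 <= a) (ab : a < b) (r_gt0 : 0 < r).
Context (a_le1 : a <= 1) (b_ge1 : 1 <= b).
Context d (Omega : measurableType d) (P : probability Omega R) (U : {RV P >-> R}).
Context (U_unif : uniformly_distributed U ab).
Context (nu : probability R R) (nu_inv : inverse_tower_distribution (rv_powR U r) nu).

Lemma inverse_tower_cdf : inverse_tower_cdf_eqn a b r (cdfR nu).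
Proof.
have r_neq0 : r != 0 by rewrite gt_eqF.
have b_gt0 : 0 < b by exact: lt_le_trans b_ge1.
have nu0 := nu_pos nu_inv.
apply: (@cdf_eqn_of_log _ _ _ _ a_ge0 ab r_gt0 (cdfR nu) (cdfR (log_law r nu))).
- move=> x x0; apply/eqP; rewrite eq_le cdfR_ge0 andbT.
  by apply: (le_trans (cdfR_ndecr nu x0)); rewrite /cdfR nu0.
- by move=> x x0; rewrite /cdfR; congr fine; exact: positive_law_cdf.
- by move=> y; exact: (inverse_tower_FE a_ge0 r_neq0 U_unif nu_inv).
- move=> y yb; apply: (inverse_tower_above a_ge0 r_neq0 U_unif nu_inv) => //.
  by rewrite lexx ltW.
- move=> y ya; apply: (inverse_tower_below a_ge0 r_neq0 U_unif nu_inv) => //.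
  by rewrite lexx ltW.
- rewrite (inverse_tower_zero a_ge0 r_neq0 U_unif nu_inv) /clamp max_r// min_r//.
Qed.

End inverse_tower_cdf.

(** * Independent uniform variables from binary digits *)

Section bits.
Context (R : realType).

Definition unif01 : probability R R := unif (@ltr01 R).

(** The strict inequality makes [doubling] map [`]0, 2^-1]] and [`]2^-1, 1]] onto
    the interval [`]0, 1]] on which [unif01] is given. *)
Definition bit (x : R) : bool := 2^-1 < x.

Definition doubling (x : R) : R := 2 * x - (bit x)%:R.

Lemma measurable_bit : measurable_fun setT (fun x : R => bit x : bool).
Proof. by apply: measurable_fun_ltr; [exact: measurable_cst|exact: measurable_id]. Qed.

Lemma measurable_bitr : measurable_fun setT (fun x : R => (bit x)%:R : R).
Proof.
rewrite (_ : (fun x => _) = fun x => if bit x then 1 else 0).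
  by apply: measurable_fun_ifT => //; exact: measurable_bit.
by apply/funext => x; case: bit.
Qed.

Lemma measurable_doubling : measurable_fun setT doubling.
Proof.
apply: measurable_funB; last exact: measurable_bitr.
by apply: measurable_funM => //; exact: measurable_cst.
Qed.

Lemma measurable_bit_cases (Q : bool -> set R) : (forall c, measurable (Q c)) ->
  measurable [set x | Q (bit x) (doubling x)].
Proof.
move=> mQ; rewrite (_ : [set x | _] = (bit @^-1` [set true] `&` doubling @^-1` Q true) `|`
    (bit @^-1` [set false] `&` doubling @^-1` Q false)).
  apply: measurableU; apply: measurableI.
  - exact: (measurable_preimage measurable_bit).
  - exact: (measurable_preimage measurable_doubling).
  - exact: (measurable_preimage measurable_bit).
  - exact: (measurable_preimage measurable_doubling).
apply/seteqP; split => x /=; first by case: bit; [left|right].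
by case=> -[->].
Qed.

(** The first binary digit is fair and independent of the others. *)
Lemma unif_bit (Q : bool -> set R) : (forall c, measurable (Q c)) ->
  unif01 [set x | Q (bit x) (doubling x)] =
  (2^-1%:E * (unif01 (Q false) + unif01 (Q true)))%E.
Proof.
move=> mQ.
have m01 : measurable (`]0, 1]%classic : set (measurableTypeR R)) by [].
pose A0 := [set x | (0 < x <= 2^-1) /\ Q false (2 * x)] : set R.
pose A1 := [set x | (2^-1 < x <= 1) /\ Q true (2 * x - 1)] : set R.
have mf c : measurable_fun setT (fun x : R => 2 * x - c).
  by apply: measurable_funB; [apply: measurable_funM|]; try exact: measurable_cst.
have mA0 : measurable A0.
  rewrite (_ : A0 = `]0, 2^-1]%classic `&` (fun x : R => 2 * x - 0) @^-1` Q false).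
    by apply: measurableI => //; exact: measurable_preimage.
  by apply/seteqP; split => x /=; rewrite in_itv/= subr0.
have mA1 : measurable A1.
  rewrite (_ : A1 = `]2^-1, 1]%classic `&` (fun x : R => 2 * x - 1) @^-1` Q true).
    by apply: measurableI => //; exact: measurable_preimage.
  by apply/seteqP; split => x /=; rewrite in_itv/=.
have h2 : (0 : R) < 2^-1 by rewrite invr_gt0.
have E0 : mu A0 = (2^-1%:E * unif01 (Q false))%E.
  rewrite unifE// subr0 invr1 mul1e (lebesgue_scale h2 mA0); congr (_ * mu _)%E.
  apply/seteqP; split => x; rewrite /A0/= mulrA divff// mul1r in_itv/=.
    by move=> [/andP[x0 x1] Qx]; split=> //; apply/andP; split; lra.
  by move=> [Qx /andP[x0 x1]]; split=> //; apply/andP; split; lra.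
have E1 : mu A1 = (2^-1%:E * unif01 (Q true))%E.
  rewrite unifE// subr0 invr1 mul1e (lebesgue_affine 2^-1 h2 mA1); congr (_ * mu _)%E.
  apply/seteqP; split => x; rewrite /A1/= mulrDr mulrA divff// mul1r addrK in_itv/=.
    by move=> [/andP[x0 x1] Qx]; split=> //; apply/andP; split; lra.
  by move=> [Qx /andP[x0 x1]]; split=> //; apply/andP; split; lra.
have A01 : [set x | Q (bit x) (doubling x)] `&` `]0, 1]%classic = A0 `|` A1.
  apply/seteqP; split => x /=; rewrite in_itv/= /doubling /bit /A0 /A1/=.
    move=> [+ /andP[x0 x1]]; case: ltP => hx Qx.
      by right; rewrite x1.
    by left; rewrite x0; move: Qx; rewrite mulr0n subr0.
  move=> [[/andP[x0 x1] Qx]|[/andP[x0 x1] Qx]].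
    by rewrite ltNge x1/= mulr0n subr0; split => //; apply/andP; split; lra.
  by rewrite x0/= mulr1n; split => //; apply/andP; split; lra.
have mS := measurable_bit_cases mQ.
rewrite unifE// subr0 invr1 mul1e A01 measureU//; last first.
  by apply/seteqP; split => // x [/= [/andP[_ x1] _] [/andP[x2 _] _]]; lra.
transitivity (2^-1%:E * unif01 (Q false) + 2^-1%:E * unif01 (Q true))%E.
  by congr (_ + _)%E.
by rewrite -ge0_muleDr.
Qed.

(** Partial sums of the number formed by every second binary digit. *)
Fixpoint digits_approx (n : nat) (x : R) : R :=
  if n is m.+1 then ((bit x)%:R + digits_approx m (doubling (doubling x))) / 2 else 0.

Definition even_digits (x : R) : R := limn (digits_approx ^~ x).

Definition odd_digits (x : R) : R := even_digits (doubling x).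

Lemma digits_approx_bounds n x : 0 <= digits_approx n x <= 1.
Proof.
elim: n x => [|n IH] x /=; first by rewrite lexx ler01.
have /andP[h0 h1] := IH (doubling (doubling x)).
by case: bit; rewrite ?mulr1n ?mulr0n; apply/andP; split; lra.
Qed.

Lemma digits_approx_ndecr x : nondecreasing_seq (digits_approx ^~ x).
Proof.
apply/nondecreasing_seqP => n; elim: n x => [|n IH] x.
  by have /andP[] := digits_approx_bounds 1 x.
rewrite -[leLHS]/(((bit x)%:R + digits_approx n (doubling (doubling x))) / 2).
rewrite -[leRHS]/(((bit x)%:R + digits_approx n.+1 (doubling (doubling x))) / 2).
by rewrite ler_pM2r ?invr_gt0// lerD2l.
Qed.

Lemma cvg_digits x : digits_approx n x @[n --> \oo] --> even_digits x.
Proof.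
apply: nondecreasing_is_cvgn; first exact: digits_approx_ndecr.
by exists 1 => _ [n _ <-]; have /andP[] := digits_approx_bounds n x.
Qed.

Lemma even_digits_bounds x : 0 <= even_digits x <= 1.
Proof.
apply/andP; split.
  by apply: (cvgr_to_ge (@cvg_digits x)); apply: nearW => n; have /andP[] := digits_approx_bounds n x.
by apply: (cvgr_to_le (@cvg_digits x)); apply: nearW => n; have /andP[] := digits_approx_bounds n x.
Qed.

Lemma measurable_even_digits : measurable_fun setT even_digits.
Proof.
apply: (measurable_fun_cvg (h := digits_approx)) => [n|x _]; last exact: cvg_digits.
elim: n => [|n IH] /=; first exact: measurable_cst.
apply: measurable_funM; last exact: measurable_cst.
apply: measurable_funD; first exact: measurable_bitr.
by apply: (measurableT_comp IH); apply: measurableT_comp; exact: measurable_doubling.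
Qed.

Lemma measurable_odd_digits : measurable_fun setT odd_digits.
Proof. by apply: measurableT_comp; [exact: measurable_even_digits|exact: measurable_doubling]. Qed.

Lemma even_digitsE x :
  even_digits x = ((bit x)%:R + even_digits (doubling (doubling x))) / 2.
Proof.
have h : digits_approx n.+1 x @[n --> \oo] -->
    ((bit x)%:R + even_digits (doubling (doubling x))) / 2.
  apply: cvgM; last exact: cvg_cst.
  by apply: cvgD; [exact: cvg_cst|exact: cvg_digits].
have := @cvg_digits x; rewrite -(cvg_shiftS (digits_approx ^~ x)) => h'.
exact: cvg_unique h' h.
Qed.

Definition joint_cdf s t : R :=
  fine (unif01 [set x | even_digits x <= s /\ odd_digits x <= t]).

Lemma measurable_joint s t : measurable [set x | even_digits x <= s /\ odd_digits x <= t].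
Proof.
rewrite (_ : [set x | _] = even_digits @^-1` `]-oo, s]%classic `&` odd_digits @^-1` `]-oo, t]%classic).
  apply: measurableI; first exact: (measurable_preimage measurable_even_digits).
  exact: (measurable_preimage measurable_odd_digits).
by apply/seteqP; split => x /=; rewrite !in_itv.
Qed.

Lemma joint_cdf_fin s t :
  (joint_cdf s t)%:E = unif01 [set x | even_digits x <= s /\ odd_digits x <= t].
Proof. by rewrite /joint_cdf fineK// fin_num_measure//; exact: measurable_joint. Qed.

(** Self-similarity: condition on the first two digits. *)
Lemma joint_cdfE s t : joint_cdf s t =
  (joint_cdf (2 * s) (2 * t) + joint_cdf (2 * s) (2 * t - 1) +
   joint_cdf (2 * s - 1) (2 * t) + joint_cdf (2 * s - 1) (2 * t - 1)) / 4.
Proof.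
pose Q2 (c e : bool) := [set z | even_digits z <= 2 * s - c%:R /\ odd_digits z <= 2 * t - e%:R].
have mQ2 c e : measurable (Q2 c e) by exact: measurable_joint.
pose Q1 c := [set y | Q2 c (bit y) (doubling y)].
have mQ1 c : measurable (Q1 c) by exact: measurable_bit_cases.
have e1 : [set x | even_digits x <= s /\ odd_digits x <= t] =
    [set x | Q1 (bit x) (doubling x)].
  apply/seteqP; split => x; rewrite /Q1 /Q2 /odd_digits/= (even_digitsE x) (even_digitsE (doubling x)) !ler_pdivrMr//.
    by rewrite ![_ * 2]mulrC -!lerBrDl.
  by rewrite ![_ * 2]mulrC -!lerBrDl.
apply: EFin_inj; rewrite joint_cdf_fin e1 unif_bit// !unif_bit//.
have q c e : unif01 (Q2 c e) = (joint_cdf (2 * s - c%:R) (2 * t - e%:R))%:E.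
  by rewrite joint_cdf_fin.
rewrite !q.
rewrite /= !mulr0n !mulr1n !subr0.
transitivity (2^-1 * (2^-1 * (joint_cdf (2 * s) (2 * t) + joint_cdf (2 * s) (2 * t - 1)) +
   2^-1 * (joint_cdf (2 * s - 1) (2 * t) + joint_cdf (2 * s - 1) (2 * t - 1))))%:E => //.
by congr EFin; field.
Qed.

(** The expected product satisfies the same self-similarity. The two functions agree
    unless both arguments are inside the unit interval or one is above it, so that
    at least one of the four terms cancels and the gap shrinks by [3 / 4]. *)
Lemma joint_cdf_gap n s t :
  `|joint_cdf s t - clamp 0 1 s * clamp 0 1 t| <= (3 / 4) ^+ n.
Proof.
have cl (x : R) : 0 <= clamp 0 1 x <= (1 : R).
  by rewrite /clamp le_min ge_min ler01 le_max !lexx.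
have j01 u v : 0 <= joint_cdf u v <= 1.
  rewrite -!lee_fin joint_cdf_fin measure_ge0/= probability_le1//; exact: measurable_joint.
have neg u v : u < 0 \/ v < 0 -> joint_cdf u v - clamp 0 1 u * clamp 0 1 v = 0.
  move=> h; rewrite (_ : clamp 0 1 u * clamp 0 1 v = 0); last first.
    by case: h => h; rewrite /clamp (max_l (ltW h)) (min_r ler01) ?mul0r ?mulr0.
  rewrite subr0 /joint_cdf (_ : [set x | _] = set0) ?measure0//.
  rewrite -subset0 => x /= [h1 h2]; case: h => h.
    by have /andP[] := even_digits_bounds x; rewrite leNgt (le_lt_trans h1 h).
  by have /andP[] := even_digits_bounds (doubling x); rewrite leNgt (le_lt_trans h2 h).
have big u v : 1 <= u -> 1 <= v -> joint_cdf u v - clamp 0 1 u * clamp 0 1 v = 0.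
  move=> u1 v1; rewrite /clamp !max_r ?(le_trans ler01)// !min_l// mulr1.
  rewrite /joint_cdf (_ : [set x | _] = setT) ?probability_setT ?subrr//.
  rewrite -subTset => x _ /=; have /andP[_ h1] := even_digits_bounds x.
  have /andP[_ h2] := even_digits_bounds (doubling x).
  by split; [exact: le_trans u1|exact: le_trans v1].
have clE (x : R) : clamp 0 1 (2 * x) + clamp 0 1 (2 * x - 1) = 2 * clamp 0 1 x.
  rewrite /clamp; have [h1|h1] := ltP x 0; first by rewrite !max_l ?min_r ?ler01; lra.
  have [h2|h2] := ltP 1 x; first by rewrite !max_r ?min_l; lra.
  have [h3|h3] := leP (2 * x) 1.
    by rewrite (@max_l _ _ 0 (2 * x - 1)) ?(@max_r _ _ 0 x) ?(@max_r _ _ 0 (2 * x)) ?min_r; lra.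
  by rewrite !max_r ?(@min_l _ _ 1 (2 * x)) ?min_r; lra.
elim: n s t => [|n IH] s t.
  rewrite expr0 ler_norml; have /andP[a0 a1] := j01 s t.
  have /andP[b0 b1] := cl s; have /andP[c0 c1] := cl t.
  have := mulr_ge0 b0 c0; have := ler_pM b0 c0 b1 c1; rewrite mulr1; lra.
pose g u v := joint_cdf u v - clamp 0 1 u * clamp 0 1 v.
have -> : joint_cdf s t - clamp 0 1 s * clamp 0 1 t =
    (g (2 * s) (2 * t) + g (2 * s) (2 * t - 1) +
     g (2 * s - 1) (2 * t) + g (2 * s - 1) (2 * t - 1)) / 4.
  rewrite /g joint_cdfE.
  have -> : clamp 0 1 s * clamp 0 1 t =
    (2 * clamp 0 1 s) * (2 * clamp 0 1 t) / 4 by field.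
  by rewrite -!clE; field.
have gb u v : - (3 / 4) ^+ n <= g u v <= (3 / 4) ^+ n by rewrite -ler_norml; exact: IH.
have /andP[? ?] := gb (2 * s) (2 * t); have /andP[? ?] := gb (2 * s) (2 * t - 1).
have /andP[? ?] := gb (2 * s - 1) (2 * t); have /andP[? ?] := gb (2 * s - 1) (2 * t - 1).
rewrite exprS ler_norml.
have [s1|s1] := ltP (2 * s) 1.
  have z1 : g (2 * s - 1) (2 * t) = 0 by apply: neg; left; lra.
  have z2 : g (2 * s - 1) (2 * t - 1) = 0 by apply: neg; left; lra.
  by rewrite z1 z2; apply/andP; split; lra.
have [t1|t1] := ltP (2 * t) 1.
  have z1 : g (2 * s) (2 * t - 1) = 0 by apply: neg; right; lra.
  have z2 : g (2 * s - 1) (2 * t - 1) = 0 by apply: neg; right; lra.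
  by rewrite z1 z2; apply/andP; split; lra.
have z : g (2 * s) (2 * t) = 0 by exact: big.
by rewrite z; apply/andP; split; lra.
Qed.

Lemma joint_cdf_prod s t : joint_cdf s t = clamp 0 1 s * clamp 0 1 t.
Proof.
apply/eqP; rewrite -subr_eq0 -normr_le0.
have h : (3 / 4 : R) ^+ n @[n --> \oo] --> (0 : R).
  by apply: cvg_expr; rewrite ger0_norm; lra.
by apply: (cvgr_to_ge h); apply: nearW => n; exact: joint_cdf_gap.
Qed.

(** Splitting the binary digits turns one uniform variable into two
    independent ones. *)
Lemma digits_independent (D : set (R * R)) : measurable D ->
  unif01 ((fun x => (even_digits x, odd_digits x)) @^-1` D) = (unif01 \x unif01)%E D.
Proof.
move=> mD.
have me := measurable_even_digits; have mo := measurable_odd_digits.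
have meo : measurable_fun setT (fun x => (even_digits x, odd_digits x)).
  by apply: measurable_fun_pair.
have cdf01 t : unif01 `]-oo, t]%classic = (clamp 0 1 t)%:E.
  by rewrite unifE// subr0 invr1 mul1e lebesgue_clamp// subr0.
have m_pre f B : measurable_fun setT (f : R -> R) -> measurable B -> measurable (f @^-1` B).
  by move=> mf mB; exact: (measurable_preimage mf).
have fin B : measurable B -> (unif01 B < +oo)%E.
  by move=> mB; rewrite -ge0_fin_numE// fin_num_measure.
have one t : unif01 (odd_digits @^-1` `]-oo, t]%classic) = (clamp 0 1 t)%:E.
  have -> : odd_digits @^-1` `]-oo, t]%classic = [set x | even_digits x <= 1 /\ odd_digits x <= t].
    apply/seteqP; split => x /=; rewrite in_itv/=; last by case.
    by move=> h; split => //; have /andP[] := even_digits_bounds x.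
  by rewrite -joint_cdf_fin joint_cdf_prod {1}/clamp max_r ?ler01// min_l// mul1r.
have step1 t A : measurable A ->
    unif01 (even_digits @^-1` A `&` odd_digits @^-1` `]-oo, t]%classic) =
    (unif01 A * unif01 `]-oo, t]%classic)%E.
  move=> mA.
  have mS : measurable (odd_digits @^-1` `]-oo, t]%classic) by exact: m_pre.
  pose m1 := pushm (mrestr unif01 mS) me.
  pose m2 : {measure set R -> \bar R} := mscale (NngNum (fine_ge0 (measure_ge0 unif01 `]-oo, t]%classic))) unif01.
  have m2E B : m2 B = (unif01 B * unif01 `]-oo, t]%classic)%E.
    rewrite muleC; transitivity ((fine (unif01 `]-oo, t]%classic))%:E * unif01 B)%E => //.
    by rewrite fineK// fin_num_measure.
  rewrite -m2E; apply: (@measure_eq_cdf _ m1 m2) mA => //.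
  - by rewrite /m1/= /pushforward/mrestr/= preimage_setT setTI; exact: fin.
  - by rewrite m2E /m1/= /pushforward/mrestr/= preimage_setT setTI probability_setT mul1e one cdf01.
  - move=> s; rewrite m2E /m1/= /pushforward/mrestr/= !cdf01 -EFinM -joint_cdf_prod joint_cdf_fin.
    by congr (unif01 _); apply/seteqP; split => x /=; rewrite !in_itv.
have odd_law B : measurable B -> unif01 (odd_digits @^-1` B) = unif01 B.
  move=> mB; apply: (@measure_eq_cdf _ (pushm unif01 mo) unif01) mB.
  - by rewrite /= /pushforward preimage_setT; exact: fin.
  - by rewrite /= /pushforward preimage_setT.
  - by move=> s; rewrite /= /pushforward one cdf01.
apply: (@prod_measure_eq _ _ _ _ _ (pushm unif01 meo) (unif01 \x unif01)%E) mD.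
  by rewrite /= /pushforward preimage_setT; exact: fin.
move=> A B mA mB.
apply: etrans (_ : (unif01 A * unif01 B)%E = _); last first.
  by apply: esym; exact: product_measure1E.
have mS : measurable (even_digits @^-1` A) by exact: m_pre.
pose m1 := pushm (mrestr unif01 mS) mo.
pose m2 : {measure set R -> \bar R} := mscale (NngNum (fine_ge0 (measure_ge0 unif01 A))) unif01.
have m2E C : m2 C = (unif01 A * unif01 C)%E.
  transitivity ((fine (unif01 A))%:E * unif01 C)%E => //.
  by rewrite fineK// fin_num_measure.
rewrite -m2E; apply: etrans (_ : m1 B = _).
  by rewrite /m1/= /pushforward/mrestr/= setIC; congr (unif01 _); apply/seteqP; split => x /=.
have even_law : unif01 (even_digits @^-1` A) = unif01 A.
  have := step1 1 _ mA; rewrite cdf01 {1}/clamp max_r ?ler01// min_l// mule1 => <-.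
  congr (unif01 _); apply/seteqP; split => x /=; last by case.
  by move=> h; split => //; rewrite in_itv/=; have /andP[] := even_digits_bounds (doubling x).
apply: (@measure_eq_cdf _ m1 m2) mB => //.
- by rewrite /m1/= /pushforward/mrestr/= preimage_setT setTI; exact: fin.
- by rewrite m2E /m1/= /pushforward/mrestr/= preimage_setT setTI probability_setT mule1.
- by move=> t; rewrite m2E -step1// /m1/= /pushforward/mrestr/= setIC.
Qed.

End bits.

Section iid_sequence.
Context (R : realType) (f : R -> R) (mf : measurable_fun setT f).

Let P := unif01 R.

Definition iid_fun (i : nat) (w : R) : R := f (even_digits (iter i (@odd_digits R) w)).

Lemma iid_funS i w : iid_fun i.+1 w = iid_fun i (odd_digits w).
Proof. by rewrite /iid_fun iterSr. Qed.

Lemma measurable_iid_fun i : measurable_fun setT (iid_fun i).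
Proof.
apply: (measurableT_comp mf); apply: (measurableT_comp (@measurable_even_digits R)).
elim: i => [|i IH]; first exact: measurable_id.
by apply: (measurableT_comp (@measurable_odd_digits R)).
Qed.

Lemma digits_rectangle A B : measurable A -> measurable B ->
  P (@even_digits R @^-1` A `&` @odd_digits R @^-1` B) = (P A * P B)%E.
Proof.
move=> mA mB.
have mAB : measurable (A `*` B) by exact: measurableX.
apply: etrans (_ : (P \x P)%E (A `*` B) = _); last exact: product_measure1E.
by apply: etrans (digits_independent mAB); congr (P _); apply/seteqP; split.
Qed.

Lemma odd_digits_law B : measurable B -> P (@odd_digits R @^-1` B) = P B.
Proof.
move=> mB; have := digits_rectangle (@measurableT _ _) mB.
by rewrite preimage_setT setTI probability_setT mul1e.
Qed.

Lemma even_digits_law B : measurable B -> P (@even_digits R @^-1` B) = P B.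
Proof.
move=> mB; have := digits_rectangle mB (@measurableT _ _).
by rewrite preimage_setT setIT probability_setT mule1.
Qed.

Definition iid_law : probability R R := distribution P (rv mf).

Lemma iid_fun_law i B : measurable B -> P (iid_fun i @^-1` B) = iid_law B.
Proof.
elim: i => [|i IH] mB.
  rewrite (_ : _ @^-1` B = @even_digits R @^-1` (f @^-1` B))//.
  by rewrite even_digits_law//; exact: measurable_preimage.
rewrite (_ : _ @^-1` B = @odd_digits R @^-1` (iid_fun i @^-1` B)); last first.
  by apply/seteqP; split => w /=; rewrite iid_funS.
by rewrite odd_digits_law ?IH//; exact: (measurable_preimage (measurable_iid_fun i)).
Qed.

(** The first variable is a function of the even digits, the others are functions
    of the odd ones. *)
Lemma iid_fun_prefix n (B : nat -> set R) : (forall i, measurable (B i)) ->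
  P (\bigcap_(i in [set` iota 0 n]) (iid_fun i @^-1` B i)) =
  (\prod_(i <- iota 0 n) iid_law (B i))%E.
Proof.
elim: n B => [|n IH] B mB.
  rewrite big_nil (_ : \bigcap_(i in _) _ = setT); first exact: probability_setT.
  by rewrite -subTset => w _ i /=; rewrite in_nil.
have -> : \bigcap_(i in [set` iota 0 n.+1]) (iid_fun i @^-1` B i) =
    @even_digits R @^-1` (f @^-1` B 0%N) `&`
    @odd_digits R @^-1` (\bigcap_(i in [set` iota 0 n]) (iid_fun i @^-1` B i.+1)).
  apply/seteqP; split => w.
    move=> h; split; first by apply: (h 0%N); rewrite /= inE.
    move=> i /=; rewrite mem_iota/= => ni; rewrite -iid_funS; apply: (h i.+1).
    by rewrite /= -[_ \in _]/(i.+1 \in iota 0 n.+1) mem_iota.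
  move=> [h0 h] [|i]; first by [].
  rewrite /= -[_ \in _]/(i.+1 \in iota 0 n.+1) mem_iota/= ltnS iid_funS => ni.
  by apply: h; rewrite /= mem_iota.
rewrite digits_rectangle; last 2 first.
- exact: measurable_preimage.
- apply: bigcap_measurableType => i _.
  exact: (measurable_preimage (measurable_iid_fun i)).
rewrite (IH (fun i => B i.+1))//.
have -> : iota 0 n.+1 = 0%N :: map (addn 1) (iota 0 n) by rewrite -iotaDl.
rewrite big_cons big_map.
by congr (_ * _)%E; apply: eq_bigr => i _; rewrite add1n.
Qed.

Definition iid_rv (i : nat) : {RV P >-> R} := rv (measurable_iid_fun i).

Lemma iid_rvP : iid_with_law iid_rv iid_law.
Proof.
split; last by move=> i B mB; exact: iid_fun_law.
move=> J B uJ mB; pose n := (\max_(j <- J) j).+1.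
have Jn j : j \in J -> (j < n)%N.
  by move=> jJ; rewrite ltnS; exact: (@leq_bigmax_seq _ J xpredT (fun j => j) j jJ isT).
(* indices outside [J] carry no constraint *)
pose B' i := if i \in J then B i else setT.
have mB' i : measurable (B' i) by rewrite /B'; case: ifP.
have -> : \bigcap_(i in [set` J]) (iid_rv i @^-1` B i) =
    \bigcap_(i in [set` iota 0 n]) (iid_fun i @^-1` B' i).
  apply/seteqP; split => w h i /= ij.
    by rewrite /B'; case: ifPn => // iJ; apply: h.
  have ni : i \in iota 0 n by rewrite mem_iota Jn.
  by have := h i ni; rewrite /= /B' ij.
rewrite iid_fun_prefix//.
rewrite (eq_bigr (fun i => if i \in J then iid_law (B i) else 1%E)); last first.
  by move=> i _; rewrite /B'; case: ifP => // _; exact: probability_setT.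
rewrite -big_mkcond -big_filter (perm_big J); last first.
  apply: uniq_perm; rewrite ?uJ//; first by rewrite filter_uniq// iota_uniq.
  move=> i; rewrite mem_filter mem_iota/=; case: (boolP (i \in J)) => //= iJ.
  by rewrite Jn.
by apply: eq_bigr => i _; apply: esym; exact: iid_fun_law.
Qed.

Lemma digits_integral (g : R * R -> \bar R) : measurable_fun setT g ->
  (forall p, 0 <= g p)%E ->
  (\int[P]_w g (even_digits w, odd_digits w) =
   \int[P]_y \int[P]_x g (x, y))%E.
Proof.
move=> mg g0.
have meo : measurable_fun setT (fun x : R => (even_digits x, odd_digits x)).
  by apply: measurable_fun_pair; [exact: measurable_even_digits|exact: measurable_odd_digits].
rewrite -[RHS](fubini_tonelli2 g mg g0).
apply: (@eq_law_integral _ _ _ P _ _ (P \x P)%E _ _ (fun x => (even_digits x, odd_digits x)) id) => //.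
by move=> B mB; exact: digits_independent.
Qed.

End iid_sequence.

(** * Quantile functions *)

Section quantile.
Context (R : realType) (G : R -> R) (top : R).
Context (Gnd : {homo G : x y / x <= y}) (G01 : forall x, 0 <= G x <= 1).
Context (Grc : forall x, G y @[y --> x^'+] --> G x).
Context (Glow : forall u, 0 < u -> exists x, G x < u) (Gtop : G top = 1).

(** The default value keeps the function below [top] everywhere. *)
Definition quantile (u : R) : R :=
  if (0 < u <= 1) then inf [set x | u <= G x] else top.

Let has_lb u : 0 < u -> has_lbound [set x | u <= G x].
Proof.
move=> /Glow [x xu]; exists x => z /= uz; rewrite leNgt; apply/negP => zx.
by have := lt_le_trans xu uz; rewrite ltNge Gnd// ltW.
Qed.

(** Right-continuity of [G] makes the infimum a minimum. *)
Lemma quantile_le u x : 0 < u <= 1 -> (quantile u <= x) = (u <= G x).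
Proof.
move=> u01; rewrite /quantile u01; case/andP: u01 => u0 u1.
have ne : [set x | u <= G x] !=set0 by exists top; rewrite /= Gtop.
apply/idP/idP => h; last by apply: ge_inf => //; exact: has_lb.
apply: (cvgr_to_ge (@Grc x)); near=> y.
have xy : x < y by near: y; exact: nbhs_right_gt.
have [z /= uz zy] := inf_lt ne (le_lt_trans h xy).
by apply: (le_trans uz); apply: Gnd; exact: ltW.
Unshelve. all: by end_near. Qed.

Lemma quantile_le_top u : quantile u <= top.
Proof.
have [u01|u01] := boolP (0 < u <= 1); last by rewrite /quantile (negbTE u01).
by rewrite quantile_le// Gtop; case/andP: u01.
Qed.

Lemma measurable_quantile : measurable_fun setT quantile.
Proof.
apply: (measurability (@RGenOInfty.G R)) => [|/= _ [_ [x ->] <-]].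
  exact: RGenOInfty.measurableE.
rewrite setTI (_ : _ @^-1` _ = ~` (quantile @^-1` `]-oo, x]%classic)); last first.
  by rewrite -setCitvl preimage_setC.
apply: measurableC; rewrite (_ : quantile @^-1` _ = (`]0, 1]%classic `&` `]-oo, G x]%classic) `|`
    (~` `]0, 1]%classic `&` [set _ | top <= x])); last first.
  apply/seteqP; split => u /=; rewrite !in_itv/=.
    have [u01 h|u01 h] := boolP (0 < u <= 1); [left|right].
      by rewrite -quantile_le.
    by split; [exact/negP|move: h; rewrite /quantile (negbTE u01)].
  case=> [[u01 h]|[/negP u01 h]]; first by rewrite quantile_le.
  by rewrite /quantile (negbTE u01).
apply: measurableU; first exact: measurableI.
apply: measurableI; first exact: measurableC.
have [h|h] := leP top x.
  by rewrite (_ : [set _ | _] = setT)//; apply/seteqP; split => z /=.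
by rewrite (_ : [set _ | _] = set0)//; apply/seteqP; split => z /=.
Qed.

Lemma quantile_cdf x : unif01 R (quantile @^-1` `]-oo, x]%classic) = (G x)%:E.
Proof.
rewrite unifE; last exact: (measurable_preimage measurable_quantile).
rewrite subr0 invr1 mul1e.
have -> : quantile @^-1` `]-oo, x]%classic `&` `]0, 1]%classic =
    `]-oo, G x]%classic `&` `]0, 1]%classic.
  apply/seteqP; split => u /=; rewrite !in_itv/= => -[h u01]; split => //.
    by rewrite -quantile_le.
  by rewrite quantile_le.
by rewrite lebesgue_clamp// subr0 /clamp; have /andP[G0 G1] := G01 x; rewrite max_r// min_r.
Qed.

End quantile.

(** * A distribution function solving the functional equation *)

Section tower_cdf.
Context (R : realType) (a b r : R) (a_ge0 : 0 <= a) (ab : a < b) (r_gt0 : 0 < r).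
Context (a_le1 : a <= 1) (b_ge1 : 1 <= b) (r_le : r * (1 + ln b) <= 1).

Let b_gt0 : 0 < b. Proof. exact: lt_le_trans b_ge1. Qed.
Let lnb_ge0 : 0 <= ln b. Proof. exact: ln_ge0. Qed.
Let ba_gt0 : 0 < b - a. Proof. by rewrite subr_gt0. Qed.

Lemma phi_ndecr x y : x <= y -> y <= ln b -> phi r x <= phi r y.
Proof.
rewrite le_eqVlt => /orP[/eqP->//|xy] yb.
rewrite -subr_ge0; have [z /andP[_ zy] ->] := phi_increment r xy.
rewrite !mulr_ge0 ?expR_ge0 ?subr_ge0 ?(ltW xy)//.
have : r * z <= r * ln b by rewrite ler_pM2l// ltW// (lt_le_trans zy).
by move: r_le; rewrite mulrDr mulr1; lra.
Qed.

Let lt_lnb z : expR z < b -> z < ln b.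
Proof. by move=> h; rewrite -ltr_expR lnK. Qed.

Lemma phi_bounds z : a <= expR z < b -> a <= phi r z <= b.
Proof.
move=> /andP[az /lt_lnb zb]; apply/andP; split.
  have [z0|z0] := leP z 0.
    by apply: (le_trans az); rewrite /phi ler_peMr ?expR_ge0// lerDl oppr_ge0 mulr_ge0_le0// ltW.
  apply: (le_trans a_le1); apply: le_trans (phi_ndecr (ltW z0) (ltW zb)).
  by rewrite /phi expR0 mulr0 subr0 mulr1.
apply: (le_trans (phi_ndecr (ltW zb) (lexx _))).
by rewrite /phi lnK ?posrE// ler_piMr ?(ltW b_gt0)// gerBl mulr_ge0// ltW.
Qed.

Definition base_cdf (z : R) : R :=
  if expR z < a then 0 else if b <= expR z then 1 else (phi r z - a) / (b - a).

Lemma base_cdf01 z : 0 <= base_cdf z <= 1.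
Proof.
rewrite /base_cdf; case: (ltP (expR z) a) => az; first by rewrite lexx ler01.
case: (leP b (expR z)) => bz; first by rewrite lexx ler01.
have /andP[h1 h2] := @phi_bounds z (introT andP (conj az bz)).
rewrite divr_ge0 ?subr_ge0 ?(ltW ab)//= ler_pdivrMr//; lra.
Qed.

(** [phi] increases up to [ln b] exactly because [r * (1 + ln b) <= 1], and the
    jumps at both ends are nonnegative by [phi_bounds]. *)
Lemma base_cdf_ndecr : {homo base_cdf : x y / x <= y}.
Proof.
move=> x y xy; have exy : expR x <= expR y by rewrite ler_expR.
have /andP[y0 y1] := base_cdf01 y; have /andP[x0 x1] := base_cdf01 x.
move: y0 y1 x0 x1; rewrite /base_cdf.
case: (ltP (expR x) a) => ax //; case: (leP b (expR y)) => yb; case: (ltP (expR y) a) => ay //.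
- by have := lt_trans ay ab; rewrite ltNge yb.
- by have := le_lt_trans exy ay; rewrite ltNge ax.
- have xb : expR x < b by exact: le_lt_trans yb.
  rewrite [b <= expR x]leNgt xb/= => _ _ _ _.
  by rewrite ler_pM2r ?invr_gt0// lerD2r phi_ndecr// ltW// lt_lnb.
Qed.

Lemma base_cdf_rc z : base_cdf y @[y --> z^'+] --> base_cdf z.
Proof.
have ce : expR y @[y --> z^'+] --> expR z.
  by apply: cvg_at_right_filter; exact: continuous_expR.
have [az|az] := ltP (expR z) a.
  rewrite {2}/base_cdf az; apply: cvg_near_cst; near=> y.
  have ya : expR y < a by near: y; move/cvgr_lt: ce; apply.
  by rewrite /base_cdf ya.
have [bz|bz] := leP b (expR z).
  rewrite {2}/base_cdf ltNge az/= bz; apply: cvg_near_cst; near=> y.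
  have zy : z < y by near: y; exact: nbhs_right_gt.
  have ezy : expR z < expR y by rewrite ltr_expR.
  by rewrite /base_cdf ltNge (le_trans az (ltW ezy))/= (le_trans bz (ltW ezy)).
rewrite {2}/base_cdf ltNge az/= leNgt bz/=.
have e : {near z^'+, (fun y => (phi r y - a) / (b - a)) =1 base_cdf}.
  near=> y; have zy : z < y by near: y; exact: nbhs_right_gt.
  have yb : expR y < b by near: y; move/cvgr_lt: ce; apply.
  by rewrite /base_cdf ltNge (le_trans az)/= ?ler_expR ?(ltW zy)// leNgt yb.
apply: cvg_trans (near_eq_cvg e) _.
apply: cvgM; last exact: cvg_cst.
apply: cvgB; last exact: cvg_cst.
by apply: cvg_at_right_filter; exact: is_derive1_continuous (is_derive_phi r z).
Unshelve. all: by end_near. Qed.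

Let rho := a / b.
Let c := ratio a b r.

Let rho_ge0 : 0 <= rho. Proof. by rewrite divr_ge0// ltW. Qed.
Let rho_lt1 : rho < 1. Proof. by rewrite ltr_pdivrMr// mul1r. Qed.
Let c_ge0 : 0 <= c. Proof. by rewrite divr_ge0// powR_ge0. Qed.

(** When [a = 0] the mixture has a single term; otherwise its copies shrink. *)
Let zero_or_expanding : rho = 0 \/ (0 < a /\ 1 < c).
Proof.
move: a_ge0; rewrite le_eqVlt => /orP[/eqP a0|a0]; [left|right].
  by rewrite /rho -a0 mul0r.
by split => //; exact: ratio_gt1.
Qed.

(** The solution is the mixture [\sum_i (1 - rho) * rho ^+ i * base_cdf (c ^+ i * z)]
    of rescaled copies of [base_cdf]. *)
Fixpoint mixture (n : nat) (z : R) : R :=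
  if n is m.+1 then (1 - rho) * base_cdf z + rho * mixture m (c * z) else 0.

Definition tower_cdf (z : R) : R := limn (mixture ^~ z).

Lemma mixture01 n z : 0 <= mixture n z <= 1.
Proof.
elim: n z => [|n IH] z /=; first by rewrite lexx ler01.
have /andP[m0 m1] := IH (c * z); have /andP[h0 h1] := base_cdf01 z.
have rho1 : 0 <= 1 - rho by rewrite subr_ge0 ltW.
have := ler_wpM2l rho_ge0 m1; have := ler_wpM2l rho1 h1.
have := mulr_ge0 rho_ge0 m0; have := mulr_ge0 rho1 h0; lra.
Qed.

Lemma mixture_ndecr n : {homo mixture n : x y / x <= y}.
Proof.
elim: n => [|n IH] x y xy //=.
by rewrite lerD ?ler_wpM2l ?subr_ge0 ?(ltW rho_lt1) ?base_cdf_ndecr ?IH ?ler_wpM2l.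
Qed.

Lemma mixture_ndecr_seq z : nondecreasing_seq (mixture ^~ z).
Proof.
apply/nondecreasing_seqP => n; elim: n z => [|n IH] z.
  by have /andP[] := mixture01 1 z.
rewrite -[leLHS]/((1 - rho) * base_cdf z + rho * mixture n (c * z)).
rewrite -[leRHS]/((1 - rho) * base_cdf z + rho * mixture n.+1 (c * z)).
by rewrite lerD2l ler_wpM2l.
Qed.

Lemma cvg_mixture z : mixture n z @[n --> \oo] --> tower_cdf z.
Proof.
apply: nondecreasing_is_cvgn; first exact: mixture_ndecr_seq.
by exists 1 => _ [n _ <-]; have /andP[] := mixture01 n z.
Qed.

Lemma tower_cdf01 z : 0 <= tower_cdf z <= 1.
Proof.
apply/andP; split.
  by apply: (cvgr_to_ge (@cvg_mixture z)); apply: nearW => n; have /andP[] := mixture01 n z.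
by apply: (cvgr_to_le (@cvg_mixture z)); apply: nearW => n; have /andP[] := mixture01 n z.
Qed.

Lemma tower_cdf_ndecr : {homo tower_cdf : x y / x <= y}.
Proof.
move=> x y xy; apply: (ler_cvg_to (@cvg_mixture x) (@cvg_mixture y)).
by apply: nearW => n; exact: mixture_ndecr.
Qed.

Lemma tower_cdfE z :
  tower_cdf z = (1 - rho) * base_cdf z + rho * tower_cdf (c * z).
Proof.
have h : mixture n.+1 z @[n --> \oo] -->
    (1 - rho) * base_cdf z + rho * tower_cdf (c * z).
  apply: cvgD; first exact: cvg_cst.
  by apply: cvgM; [exact: cvg_cst|exact: cvg_mixture].
have := @cvg_mixture z; rewrite -(cvg_shiftS (mixture ^~ z)) => h'.
exact: cvg_unique h' h.
Qed.

(** The convergence is uniform in [z], which transfers right-continuity to the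
    limit. *)
Lemma mixture_gap n z : mixture n z <= tower_cdf z <= mixture n z + rho ^+ n.
Proof.
elim: n z => [|n IH] z; first by rewrite /= expr0 add0r tower_cdf01.
have /andP[h1 h2] := IH (c * z).
have := ler_wpM2l rho_ge0 h1; have := ler_wpM2l rho_ge0 h2.
by rewrite (tower_cdfE z) /= exprS mulrDr => ? ?; apply/andP; split; lra.
Qed.

Lemma mixture_rc n z : mixture n y @[y --> z^'+] --> mixture n z.
Proof.
elim: n z => [|n IH] z /=; first exact: cvg_cst.
apply: cvgD; first by apply: cvgM; [exact: cvg_cst|exact: base_cdf_rc].
case: zero_or_expanding => [->|[_ c1]].
  by under eq_fun do rewrite mul0r; rewrite mul0r; exact: cvg_cst.
apply: cvgM; first exact: cvg_cst.
apply: (@cvg_at_right_shift _ _ _ _ ( *%R c) (c * z)) => //.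
  apply: cvg_at_right_filter; apply: cvgM; [exact: cvg_cst|exact: cvg_id].
near=> y; rewrite ltr_pM2l ?(lt_trans ltr01)//; near: y; exact: nbhs_right_gt.
Unshelve. all: by end_near. Qed.

Lemma cvg_rho : rho ^+ n @[n --> \oo] --> (0 : R).
Proof. by apply: cvg_expr; rewrite ger0_norm. Qed.

Lemma tower_cdf_rc z : tower_cdf y @[y --> z^'+] --> tower_cdf z.
Proof.
apply/cvgrPdist_lt => e e0.
have e2 : 0 < e / 2 by rewrite divr_gt0.
have [n _ /(_ n (leqnn n))/= ne] : \forall n \near \oo, rho ^+ n < e / 2.
  by move/cvgr_lt: cvg_rho; apply.
near=> y.
have zy : z < y by near: y; exact: nbhs_right_gt.
have hy : `|mixture n z - mixture n y| < e / 2.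
  by near: y; move/cvgrPdist_lt: (@mixture_rc n z); apply.
have /andP[h1 h2] := mixture_gap n z; have /andP[h3 h4] := mixture_gap n y.
have := tower_cdf_ndecr (ltW zy); move: hy; rewrite !ltr_norml => /andP[h5 h6] h7.
by apply/andP; split; lra.
Unshelve. all: by end_near. Qed.

Lemma tower_cdf_above z : b <= expR z -> tower_cdf z = 1.
Proof.
move=> bz.
have h n : 1 - rho ^+ n <= mixture n z.
  elim: n z bz => [|n IH] z bz; first by rewrite expr0 subrr.
  have e1 : base_cdf z = 1 by rewrite /base_cdf ltNge (le_trans (ltW ab))//= bz.
  rewrite /= e1 mulr1 exprS.
  case: zero_or_expanding => [->|[_ c1]]; first by rewrite !mul0r subr0 addr0.
  have /IH h : b <= expR (c * z).
    apply: (le_trans bz); rewrite ler_expR ler_peMl ?(ltW c1)//.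
    by rewrite -ler_expR expR0 (le_trans b_ge1).
  by have := ler_wpM2l rho_ge0 h; lra.
apply/eqP; rewrite eq_le; have /andP[_ ->]/= := tower_cdf01 z.
have l1 : 1 - rho ^+ n @[n --> \oo] --> (1 : R).
  by rewrite -[X in _ --> X]subr0; apply: cvgB; [exact: cvg_cst|exact: cvg_rho].
by apply: (ler_cvg_to l1 (@cvg_mixture z)); exact: nearW.
Qed.

Lemma tower_cdf_below z : expR z < a -> tower_cdf z = 0.
Proof.
move=> za; have a0 : 0 < a by exact: lt_trans (expR_gt0 z) za.
case: zero_or_expanding => [/eqP|[_ c1]].
  by rewrite mulf_eq0 invr_eq0 !gt_eqF.
have h n : mixture n z = 0.
  elim: n z za => [|n IH] z zb //=.
  rewrite {1}/base_cdf zb mulr0 IH ?mulr0 ?addr0//.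
  apply: (le_lt_trans _ zb); rewrite ler_expR ler_neMl ?(ltW c1)//.
  by rewrite -ler_expR expR0 (le_trans (ltW zb)).
have := @cvg_mixture z; rewrite (funext h) => h'.
exact: (cvg_unique (@Rhausdorff R) h' (cvg_cst _)).
Qed.

(** The mixture is the geometric series that inverts [H |-> H - rho * H (c * _)]. *)
Lemma tower_cdf_FE z : b * tower_cdf z - a * tower_cdf (c * z) = (b - a) * base_cdf z.
Proof. by rewrite {1}tower_cdfE /rho; field; rewrite gt_eqF. Qed.

Lemma tower_cdf_low u : 0 < u -> exists z, tower_cdf z < u.
Proof.
move=> u0; move: a_ge0; rewrite le_eqVlt => /orP[/eqP a0|a0]; last first.
  exists (ln a - 1); rewrite tower_cdf_below//.
  by rewrite -[ltRHS](@lnK _ a) ?posrE// ltr_expR gtrDl oppr_lt0.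
have h : x - r * (x `^ 1 * ln x) @[x --> 0^'+] --> (0 : R).
  have e0 : (0 : R) = 0 - r * 0 by rewrite mulr0 subr0.
  rewrite [X in _ --> X]e0 => {e0}; apply: cvgB; last by apply: cvgM; [exact: cvg_cst|exact: cvg_powR_ln0].
  by apply: cvg_at_right_filter; exact: cvg_id.
have [x [xu x0 xb]] : exists x, [/\ x - r * (x `^ 1 * ln x) < u * b, 0 < x & x < b].
  apply: (@filter_ex _ (0^'+)); near=> x; split.
  - by near: x; move/cvgr_lt: h; apply; rewrite mulr_gt0.
  - by near: x; exact: nbhs_right_gt.
  - by near: x; exact: nbhs_right_lt.
exists (ln x); rewrite tower_cdfE /rho -a0 !mul0r subr0 addr0 mul1r /base_cdf -a0.
rewrite (ltNge _ 0) expR_ge0/= leNgt lnK ?posrE// xb/= !subr0 ltr_pdivrMr//.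
by rewrite /phi lnK ?posrE//; move: xu; rewrite powRr1 ?ltW//; lra.
Unshelve. all: by end_near. Qed.

End tower_cdf.

(** * From the functional equation back to the integral equation *)

Lemma integral_derivative (R : realType) (f F : R -> R) c d : c < d ->
  measurable_fun setT f ->
  (forall x : R, c <= x <= d -> is_derive x (1 : R) F (f x)) ->
  (forall x, c <= x <= d -> {for x, continuous f}) ->
  (\int[mu]_(x in `]c, d]) (f x)%:E = (F d - F c)%:E)%E.
Proof.
move=> cd mf dF cf.
have cF x : c <= x <= d -> {for x, continuous F} by move=> /dF/is_derive1_continuous.
rewrite integral_itv_obnd_cbnd; last exact/measurable_EFinP/measurable_funTS.
rewrite EFinB; apply: (continuous_FTC2 cd).
- by apply: continuous_in_subspaceT => s; rewrite inE/= in_itv/=; exact: cf.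
- split.
  + by move=> s /itvP cs; have csd : c <= s <= d; [rewrite !cs|have [] := dF s csd].
  + by apply: cvg_at_right_filter; apply: cF; rewrite lexx ltW.
  + by apply: cvg_at_left_filter; apply: cF; rewrite lexx ltW.
- move=> s /itvP cs; have csd : c <= s <= d by rewrite !cs.
  by rewrite derive1E; have [_ ->] := dF s csd.
Qed.

Section functional_equation_converse.
Context (R : realType) (a b r : R) (a_ge0 : 0 <= a) (ab : a < b) (r_gt0 : 0 < r).
Context (G : R -> R) (Gnd : {homo G : x y / x <= y}) (G01 : forall x, 0 <= G x <= 1).

Let b_gt0 : 0 < b. Proof. exact: le_lt_trans ab. Qed.

Lemma phi_antiderivative t y : 0 < t -> t < 1 ->
  (\int[mu]_(s in `]t, 1]) (phi r (s `^ (- r) * y) - a) =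
   (expR y - a) - t * (expR (t `^ (- r) * y) - a))%R.
Proof.
move=> t0 t1.
pose K (s : R) := s * (expR (s `^ (- r) * y) - a).
pose k (s : R) := phi r (s `^ (- r) * y) - a.
have dK (s : R) : 0 < s -> is_derive s (1 : R) K (k s).
  exact: is_derive_profile.
have cpow (s : R) : 0 < s -> {for s, continuous k}.
  move=> s0; apply: cvgB; last exact: cvg_cst.
  apply: (continuous_comp (f := fun s => s `^ (- r) * y)).
    exact: (is_derive1_continuous (@is_derive_powR_scaled _ r s y s0)).
  exact: (is_derive1_continuous (is_derive_phi r _)).
have mphi : measurable_fun setT (phi r).
  by apply: measurable_funM => //; apply: measurable_funB; [exact: measurable_cst|apply: measurable_funM; [exact: measurable_cst|exact: measurable_id]].
have mk : measurable_fun setT k.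
  apply: measurable_funB; last exact: measurable_cst.
  apply: (measurableT_comp mphi); apply: measurable_funM; last exact: measurable_cst.
  exact: measurable_powR.
have dk (x : R) : t <= x <= 1 -> is_derive x (1 : R) K (k x).
  by move=> /andP[tx _]; apply: dK; exact: lt_le_trans tx.
have ck x : t <= x <= 1 -> {for x, continuous k}.
  by move=> /andP[tx _]; apply: cpow; exact: lt_le_trans tx.
by rewrite /Rintegral (integral_derivative t1 mk dk ck) /= /K powR1 !mul1r.
Qed.

Context (GFE : forall y, a <= expR y < b ->
  b * G (b `^ (- r) * y) - a * G (a `^ (- r) * y) = phi r y - a).

(** The finite form of the derivation in [functional_eq]. *)
Lemma mixed_balance t y : 0 < t -> t < 1 ->
  (forall s, t < s <= 1 -> a <= expR (s `^ (- r) * y) < b) ->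
  mixed r G y a b - t * mixed r G (t `^ (- r) * y) a b =
  (expR y - a) - t * (expR (t `^ (- r) * y) - a).
Proof.
move=> t0 t1 h.
have signedE c : 0 <= c -> signed_mixed r G y c t = c * mixed r G (c `^ (- r) * y) t 1.
  move=> c0; rewrite /signed_mixed (ltW t1); move: c0; rewrite le_eqVlt => /orP[/eqP<-|c0].
    rewrite mulr0 mul0r /mixed /Rintegral set_itv_ge ?integral_set0//.
    by rewrite -leNgt bnd_simp.
  have := mixed_scale r Gnd G01 y 1 (ltW t0) c0.
  by rewrite mulr1 mulrC.
have := signed_mixedB r a_ge0 ab Gnd G01 y t0.
rewrite (signedE a a_ge0) (signedE b (ltW b_gt0)) => e.
move: e; move: (mixed r G y a b) (mixed r G (t `^ (- r) * y) a b) => m1 m2 e.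
rewrite -[LHS]opprB e opprB -(phi_antiderivative y t0 t1) => {m1 m2 e}.
have mG z : measurable_fun setT (section_cdf r G z) by exact: measurable_section_cdf.
have iG z : mu.-integrable `]t, 1]%classic (EFin \o section_cdf r G z).
  by apply: bounded_integrable => // x; exact: G01.
have iZ k z : mu.-integrable `]t, 1]%classic (EFin \o (fun s => k * section_cdf r G z s)).
  have mI : measurable (`]t, 1]%classic : set (measurableTypeR R)) by [].
  have := integrableZl mI k (iG z).
  by apply: eq_integrable.
rewrite /mixed -!RintegralZl// -RintegralB//.
apply: eq_Rintegral => s /[!inE]/= /[!in_itv]/= ts.
rewrite -GFE ?h// /section_cdf.
by rewrite (mulrCA (b `^ (- r))) (mulrCA (a `^ (- r))).
Qed.

Context (Gabove : forall y v, b <= expR y -> 0 < v -> a <= v <= b -> G (v `^ (- r) * y) = 1).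
Context (Gbelow : forall y v, expR y < a -> a <= v <= b -> G (v `^ (- r) * y) = 0).

Let mixed_const y m : (forall v, a < v <= b -> section_cdf r G y v = m) ->
  mixed r G y a b = m * (b - a).
Proof.
move=> h; have /andP[h1 h2] : m * (b - a) <= mixed r G y a b <= m * (b - a).
  by apply: (mixed_bounds Gnd G01 (ltW ab)) => v vab; rewrite h// lexx.
by apply/eqP; rewrite eq_le h1 h2.
Qed.

Lemma mixed_above y : b <= expR y -> mixed r G y a b = b - a.
Proof.
move=> yb; rewrite (@mixed_const y 1) ?mul1r// => v /andP[av vb].
by apply: Gabove; rewrite ?(le_lt_trans a_ge0 av)// (ltW av).
Qed.

Lemma mixed_below y : expR y < a -> mixed r G y a b = 0.
Proof.
move=> ya; rewrite (@mixed_const y 0) ?mul0r// => v /andP[av vb].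
by apply: Gbelow; rewrite ?(ltW av).
Qed.

(** At [y = ln a] the integrand vanishes for [v < b], but not necessarily at
    [v = b], where [G] may jump. *)
Lemma mixed_bottom : 0 < a -> a < 1 -> mixed r G (ln a) a b = 0.
Proof.
move=> a0 a1; have la : ln a < 0 by rewrite ln_lt0// a0.
have /andP[m0 _] : 0 * (b - a) <= mixed r G (ln a) a b <= 1 * (b - a).
  by apply: (mixed_bounds Gnd G01 (ltW ab)) => v _; exact: G01.
apply/eqP; rewrite eq_le -(mul0r (b - a)) m0 andbT; apply/ler_addgt0Pr => e e0.
pose m := Num.max a (b - e).
have am : a <= m by rewrite le_max lexx.
have mb : m < b by rewrite gt_max ab/= ltrBlDr ltrDl.
rewrite (mixed_chasles r Gnd G01 _ am (ltW mb)) mul0r add0r.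
have /andP[_ h1] : 0 * (m - a) <= mixed r G (ln a) a m <= 0 * (m - a).
  apply: (mixed_bounds Gnd G01 am) => v /andP[av vm].
  have v0 : 0 < v by exact: lt_trans av.
  have -> : section_cdf r G (ln a) v = G (b `^ (- r) * ((b / v) `^ r * ln a)).
    rewrite /section_cdf powRM ?invr_ge0 ?(ltW v0) ?(ltW b_gt0)// -powR_inv1 ?(ltW v0)//.
    rewrite -powRrM mulN1r !mulrA -powRD ?(gt_eqF b_gt0) ?implybT//.
    by rewrite addNr powRr0 mul1r.
  have -> : G (b `^ (- r) * ((b / v) `^ r * ln a)) = 0; last by rewrite lexx.
  apply: Gbelow; last by rewrite lexx ltW.
  rewrite -[ltRHS](@lnK _ a) ?posrE// ltr_expR gtr_nMl//.
  rewrite -[ltLHS](one_powR r) lt_powRl// ltr_pdivlMr// mul1r.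
  exact: le_lt_trans mb.
have /andP[_ h2] : 0 * (b - m) <= mixed r G (ln a) m b <= 1 * (b - m).
  by apply: (mixed_bounds Gnd G01 (ltW mb)) => v _; exact: G01.
have : b - e <= m by rewrite le_max lexx orbT.
by move: h1 h2; lra.
Qed.

(* the time [s] at which [s `^ (- r) * y] reaches the end [l] *)
Let root y l : 0 < y / l -> l != 0 -> y != 0 ->
  [/\ 0 < (y / l) `^ r^-1 & ((y / l) `^ r^-1) `^ (- r) * y = l].
Proof.
move=> yl l0 y0; split; first exact: powR_gt0.
rewrite -powRrM mulrN mulVf ?gt_eqF// powR_inv1 ?(ltW yl)// invf_div.
by rewrite divfK.
Qed.

Let root_lt1 y l : 0 < y / l < 1 -> (y / l) `^ r^-1 < 1.
Proof.
move=> /andP[yl0 yl1].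
by rewrite -[ltRHS](one_powR r^-1) lt_powRl ?invr_gt0// ltW.
Qed.

Let powRN_anti s t : 0 < s -> s < t -> t `^ (- r) < s `^ (- r).
Proof.
move=> s0 st; have t0 := lt_trans s0 st.
by rewrite !powRN ltf_pV2 ?posrE ?powR_gt0// lt_powRl// ltW.
Qed.

Let powRN_ge1 s : 0 < s -> s <= 1 -> 1 <= s `^ (- r).
Proof.
move=> s0; rewrite le_eqVlt => /orP[/eqP->|s1]; first by rewrite powR1.
by rewrite -[leLHS](one_powR (- r)) ltW// powRN_anti.
Qed.

(** [s `^ (- r) * y] runs from [y] at [s = 1] to an end of the range, where the
    mixed value is known; in between the functional equation integrates to the
    claim. *)
Lemma integral_of_functional_eq y : mixed r G y a b = clamp a b (expR y) - a.
Proof.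
have [yb|yb] := leP b (expR y).
  by rewrite mixed_above// /clamp max_r ?min_l// (le_trans (ltW ab)).
have [ya|ya] := ltP (expR y) a.
  by rewrite mixed_below// /clamp max_l ?min_r ?subrr// ltW.
rewrite /clamp max_r// min_r ?(ltW yb)//.
have lyb : y < ln b by rewrite -ltr_expR lnK.
have [y0|y0|y0] := ltgtP y 0; last first.
- have e : b * G 0 - a * G 0 = 1 - a.
    have := @GFE 0; rewrite !mulr0 /phi expR0 mulr0 subr0 mulr1; apply.
    by move: ya yb; rewrite y0 expR0 => -> ->.
  rewrite (@mixed_const y (G 0)) => [|v _]; last by rewrite /section_cdf y0 mulr0.
  by rewrite y0 expR0 -e; ring.
- have lb0 : 0 < ln b by exact: lt_trans lyb.
  have [||| t0 tE] := @root y (ln b); rewrite ?divr_gt0 ?gt_eqF//.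
  have := @root_lt1 y (ln b); rewrite divr_gt0//= ltr_pdivrMr// mul1r => /(_ lyb).
  move: t0 tE; set t := _ `^ r^-1 => t0 tE t1.
  have := @mixed_balance t y t0 t1; rewrite tE (@mixed_above (ln b)) ?lnK ?posrE// => h.
  suff: mixed r G y a b - t * (b - a) = expR y - a - t * (b - a) by move/addIr.
  apply: h => s /andP[ts s1]; have s0 := lt_trans t0 ts.
  rewrite (le_trans ya) ?ler_expR ?ler_peMl ?powRN_ge1 ?(ltW y0)//=.
  by rewrite -[ltRHS](@lnK _ b) ?posrE// ltr_expR -tE ltr_pM2r// powRN_anti.
have small s : 0 < s -> s <= 1 -> expR (s `^ (- r) * y) < b.
  move=> s0 s1; apply: le_lt_trans yb.
  by rewrite ler_expR ler_neMl ?powRN_ge1// ltW.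
move: a_ge0; rewrite le_eqVlt => /orP[/eqP a0|a0]; last first.
  have lya : ln a <= y by rewrite -ler_expR lnK.
  have la : ln a < 0 by exact: le_lt_trans y0.
  have a1 : a < 1 by rewrite -[ltLHS](@lnK _ a) ?posrE// -expR0 ltr_expR.
  move: lya; rewrite le_eqVlt => /orP[/eqP<-|lya].
    by rewrite mixed_bottom// lnK ?posrE// subrr.
  have yl : 0 < y / ln a by rewrite nmulr_rgt0// invr_lt0.
  have [||| t0 tE] := @root y (ln a); rewrite ?lt_eqF//.
  have := @root_lt1 y (ln a); rewrite yl/= ltr_ndivrMr// mul1r => /(_ lya).
  move: t0 tE; set t := _ `^ r^-1 => t0 tE t1.
  have := @mixed_balance t y t0 t1; rewrite tE mixed_bottom// lnK ?posrE// subrr => h.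
  suff: mixed r G y a b - t * 0 = expR y - a - t * 0 by rewrite mulr0 !subr0.
  apply: h => s /andP[ts s1]; have s0 := lt_trans t0 ts.
  rewrite small// andbT -[leLHS](@lnK _ a) ?posrE// ler_expR -tE.
  by rewrite ler_nM2r// ltW// powRN_anti.
(* [a = 0]: there is no lower end to reach and [s] runs down to [0] *)
apply/eqP; rewrite -subr_eq0 -normr_le0 -a0 subr0; apply/ler_addgt0Pr => e e0.
pose t := Num.min 2^-1 (e / (b + 1)).
have b1 : 0 < b + 1 by rewrite addr_gt0.
have t0 : 0 < t by rewrite lt_min invr_gt0 ltr0n divr_gt0.
have t1 : t < 1 by rewrite gt_min invf_lt1// ltr1n.
have te : t * (b + 1) <= e by rewrite -ler_pdivlMr// ge_min lexx orbT.
have range s : t < s <= 1 -> a <= expR (s `^ (- r) * y) < b.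
  by move=> /andP[ts s1]; rewrite -a0 expR_ge0 small// (lt_trans t0).
have := @mixed_balance t y t0 t1 range; rewrite -a0 !subr0 => h.
have /andP[m0 mb] : 0 * (b - a) <= mixed r G (t `^ (- r) * y) a b <= 1 * (b - a).
  by apply: (mixed_bounds Gnd G01 (ltW ab)) => v _; exact: G01.
move: m0 mb; rewrite -a0 mul0r mul1r subr0 => m0 mb.
have e1 : expR (t `^ (- r) * y) <= 1.
  by rewrite -expR0 ler_expR mulr_ge0_le0// ?powR_ge0 ?ltW.
have h1 := ler_wpM2l (ltW t0) mb; have h2 := ler_wpM2l (ltW t0) e1.
have h3 := mulr_ge0 (ltW t0) m0; have h4 := mulr_ge0 (ltW t0) (expR_ge0 (t `^ (- r) * y)).
rewrite add0r (_ : mixed r G y 0 b - expR y =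
  t * mixed r G (t `^ (- r) * y) 0 b - t * expR (t `^ (- r) * y)); last first.
  by move: h; move: (mixed r G y 0 b) (t * mixed r G _ 0 b) => m1 m2 h; lra.
apply: le_trans te; rewrite mulrDr; move: h1 h2 h3 h4.
move: (t * mixed r G _ 0 b) (t * expR _) => m1 m2 h1 h2 h3 h4.
by rewrite ler_norml; apply/andP; split; lra.
Qed.

End functional_equation_converse.

(** * The inverse tower law *)

Section inverse_law.
Context (R : realType) (a b r : R) (a_ge0 : 0 <= a) (ab : a < b) (r_gt0 : 0 < r).
Context (a_le1 : a <= 1) (b_ge1 : 1 <= b) (r_le : r * (1 + ln b) <= 1).

Let b_gt0 : 0 < b. Proof. exact: lt_le_trans b_ge1. Qed.
Let br_gt0 : 0 < b `^ r. Proof. exact: powR_gt0. Qed.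
Let r_neq0 : r != 0. Proof. by rewrite gt_eqF. Qed.

(** The distribution function of [ln x / r] under the inverse tower law. *)
Definition log_cdf (l : R) : R := tower_cdf a b r (b `^ r * l).

Lemma log_cdf_ndecr : {homo log_cdf : x y / x <= y}.
Proof. by move=> x y xy; apply: tower_cdf_ndecr => //; rewrite ler_pM2l. Qed.

Lemma log_cdf01 x : 0 <= log_cdf x <= 1.
Proof. exact: tower_cdf01. Qed.

Lemma log_cdf_rc x : log_cdf y @[y --> x^'+] --> log_cdf x.
Proof.
apply: (@cvg_at_right_shift _ (tower_cdf a b r) _ _ ( *%R (b `^ r)) (b `^ r * x)).
- exact: tower_cdf_rc.
- by apply: cvg_at_right_filter; apply: cvgM; [exact: cvg_cst|exact: cvg_id].
- by near=> y; rewrite ltr_pM2l//; near: y; exact: nbhs_right_gt.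
Unshelve. all: by end_near. Qed.

Lemma log_cdf_low u : 0 < u -> exists x, log_cdf x < u.
Proof.
move=> /(tower_cdf_low a_ge0 ab r_gt0 a_le1 b_ge1 r_le)[z zu].
by exists (z / b `^ r); rewrite /log_cdf mulrC divfK// gt_eqF.
Qed.

(** The right end of the support. *)
Definition log_top : R := b `^ (- r) * ln b.

Lemma log_cdf_top : log_cdf log_top = 1.
Proof.
rewrite /log_cdf /log_top powRN mulrA divff ?gt_eqF// mul1r.
by rewrite tower_cdf_above// lnK.
Qed.

Lemma log_cdf_FE y : a <= expR y < b ->
  b * log_cdf (b `^ (- r) * y) - a * log_cdf (a `^ (- r) * y) = phi r y - a.
Proof.
move=> /andP[ay yb]; have br0 : b `^ r != 0 by rewrite gt_eqF.
have -> : log_cdf (b `^ (- r) * y) = tower_cdf a b r y.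
  by rewrite /log_cdf powRN mulrA divff// mul1r.
have -> : log_cdf (a `^ (- r) * y) = tower_cdf a b r (ratio a b r * y).
  by rewrite /log_cdf /ratio (powRN b) invrK mulrA [b `^ r * _]mulrC.
rewrite tower_cdf_FE// /base_cdf ltNge ay/= leNgt yb/= mulrC divfK//.
by rewrite gt_eqF// subr_gt0.
Qed.

Let expand v : 0 < v -> a <= v <= b -> 1 <= b `^ r * v `^ (- r).
Proof.
move=> v0 /andP[av vb]; rewrite powRN ler_pdivlMr ?powR_gt0// mul1r.
by rewrite le_powRl// ltW.
Qed.

Lemma log_cdf_above y v : b <= expR y -> 0 < v -> a <= v <= b ->
  log_cdf (v `^ (- r) * y) = 1.
Proof.
move=> yb v0 avb; rewrite /log_cdf mulrA tower_cdf_above//; apply: (le_trans yb).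
by rewrite ler_expR ler_peMl ?expand// -ler_expR expR0 (le_trans b_ge1).
Qed.

Lemma log_cdf_below y v : expR y < a -> a <= v <= b -> log_cdf (v `^ (- r) * y) = 0.
Proof.
move=> ya avb; have a0 := lt_trans (expR_gt0 y) ya.
have v0 : 0 < v by case/andP: avb => /(lt_le_trans a0).
rewrite /log_cdf mulrA tower_cdf_below//; apply: (le_lt_trans _ ya).
by rewrite ler_expR ler_neMl ?expand// -ler_expR expR0 (le_trans (ltW ya)).
Qed.

Lemma log_cdf_integral y : mixed r log_cdf y a b = clamp a b (expR y) - a.
Proof.
exact: (integral_of_functional_eq a_ge0 ab r_gt0 log_cdf_ndecr log_cdf01 log_cdf_FE
  log_cdf_above log_cdf_below).
Qed.

Let log_quantile := quantile log_cdf log_top.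

(** A variable with the inverse tower law, as a function of a uniform one. *)
Definition tower_base (u : R) : R := expR (r * log_quantile u).

Lemma measurable_tower_base : measurable_fun setT tower_base.
Proof.
apply: measurableT_comp; first exact: measurable_expR.
apply: measurable_funM; first exact: measurable_cst.
exact: (measurable_quantile log_cdf_ndecr log_cdf_rc log_cdf_low log_cdf_top).
Qed.

(** The largest base is the one whose tower with seed [b `^ r] stays at [b `^ r]. *)
Lemma ln_tower_base u : b `^ r * ln (tower_base u) <= r * ln b.
Proof.
rewrite expRK mulrCA ler_pM2l// -ler_pdivlMl//.
rewrite mulrC -powRN [ln b * _]mulrC.
exact: (quantile_le_top log_cdf_ndecr log_cdf_rc log_cdf_low log_cdf_top).
Qed.

Definition inverse_law : probability R R := iid_law measurable_tower_base.

Lemma cdfR_log_inverse_law y : cdfR (log_law r inverse_law) y = log_cdf y.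
Proof.
apply: EFin_inj; rewrite cdfR_fin.
rewrite -(quantile_cdf log_cdf_ndecr log_cdf01 log_cdf_rc log_cdf_low log_cdf_top y).
have -> : log_law r inverse_law `]-oo, y]%classic =
  unif01 R (tower_base @^-1` (log_r r @^-1` `]-oo, y]%classic)) by [].
congr (unif01 R _); apply/seteqP; split => u /=; rewrite !in_itv/= /log_r expRK.
  by rewrite mulrAC divff// mul1r.
by rewrite [r * _ / r]mulrAC divff// mul1r.
Qed.

Lemma inverse_law_pos : inverse_law `]-oo, 0]%classic = 0%E.
Proof.
have -> : inverse_law `]-oo, 0]%classic = unif01 R (tower_base @^-1` `]-oo, 0]%classic) by [].
rewrite (_ : _ @^-1` _ = set0) ?measure0// -subset0 => u /=.
by rewrite in_itv/= leNgt expR_gt0.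
Qed.

Lemma power_law_pos : power_law r ab `]-oo, 0]%classic = 0%E.
Proof.
have -> : power_law r ab `]-oo, 0]%classic = unif ab ((fun v => v `^ r) @^-1` `]-oo, 0]%classic) by [].
rewrite unifE; last exact: (measurable_preimage (@measurable_powR R r)).
rewrite (_ : _ `&` _ = set0) ?measure0 ?mule0// -subset0 => v [/=].
rewrite !in_itv/= => h /andP[av _]; move: h.
by rewrite leNgt powR_gt0// (le_lt_trans a_ge0).
Qed.

(** In logarithmic form this is the integral equation, which follows from the
    functional equation of [tower_cdf]. *)
Lemma inverse_law_fixpoint C : measurable C ->
  power_law r ab C = (inverse_law \x power_law r ab)%E (powp @^-1` C).
Proof.
pose m2 : probability R R :=
  distribution (inverse_law \x power_law r ab)%E (rv (@measurable_powp R)).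
move=> mC; apply: (@prob_eq_cdf _ (power_law r ab) m2) mC => x.
have m2_pos : m2 `]-oo, 0]%classic = 0%E.
  have m0 : measurable (`]-oo, (0 : R)]%classic : set R) by [].
  have -> : m2 `]-oo, 0]%classic =
    (inverse_law \x power_law r ab)%E (powp @^-1` `]-oo, 0]%classic) by [].
  apply/eqP; rewrite -measure_le0.
  have <- : (inverse_law \x power_law r ab)%E (`]-oo, 0]%classic `*` setT) = 0%E.
    apply: etrans (product_measure1E _ _ m0 measurableT) _.
    by apply: etrans (congr2 _ inverse_law_pos erefl) _; rewrite mul0e.
  apply: le_measure; rewrite ?inE.
  - exact: (measurable_preimage (@measurable_powp R)).
  - exact: measurableX.
  - move=> [p q] /=; rewrite !in_itv/= /powp/= => h; split=> //.
    by rewrite leNgt; apply/negP => p0; move: h; rewrite leNgt powR_gt0.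
have [x0|x0] := leP x 0.
  have le0 (m : probability R R) : m `]-oo, 0]%classic = 0%E -> m `]-oo, x]%classic = 0%E.
    move=> m0; apply/eqP; rewrite -measure_le0 -m0 le_measure ?inE//.
    by move=> z /=; rewrite !in_itv/= => /le_trans; apply.
  by rewrite !le0// power_law_pos.
rewrite (positive_law_cdf power_law_pos r_gt0 x0) (positive_law_cdf m2_pos r_gt0 x0).
have -> : log_r r @^-1` `]-oo, ln x / r]%classic = [set t : R | ln t / r <= ln x / r].
  by apply/seteqP; split => t /=; rewrite in_itv.
rewrite power_law_log_le//; apply: esym.
apply: etrans (fixpoint_log_law r ab inverse_law (ln x / r)) _.
rewrite scaled_le_prob// EFinM; congr (_ * _)%E.
rewrite -log_cdf_integral /mixed /Rintegral fineK.
  by apply: eq_integral => v _; rewrite cdfR_log_inverse_law.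
apply: integrable_fin_num => //.
apply: bounded_integrable => [|v]; last exact: log_cdf01.
exact: (measurable_section_cdf r log_cdf_ndecr).
Qed.

End inverse_law.

(** * Contraction estimates *)

Section lipschitz.
Context (R : realType) (M : R) (M_ge1 : 1 <= M).

Let M_gt0 : 0 < M. Proof. exact: lt_le_trans M_ge1. Qed.
Let lnM_ge0 : 0 <= ln M. Proof. exact: ln_ge0. Qed.

(** The maximum of [p * `|ln p|] for [0 < p <= M]. *)
Definition lip_const : R := Num.max (expR (- 1)) (M * ln M).

Lemma lip_const_gt0 : 0 < lip_const.
Proof. by rewrite lt_max expR_gt0. Qed.

(** The function [w |-> expR w * `|w|] peaks at [w = - 1] on the negative axis and
    increases on the positive one. *)
Lemma expR_mul_le (w : R) : w <= ln M -> expR w * `|w| <= lip_const.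
Proof.
move=> wM; rewrite le_max; have [w0|w0] := leP w 0; apply/orP; [left|right].
  have := expR_ge1Dx (- w - 1); rewrite ler0_norm//.
  have -> : 1 + (- w - 1) = - w by ring.
  move=> /(ler_wpM2l (expR_ge0 w)); rewrite -expRD.
  by have -> : w + (- w - 1) = - 1 by ring.
rewrite gtr0_norm// ler_pM ?expR_ge0 ?(ltW w0)//.
by rewrite -[leRHS](@lnK _ M) ?posrE// ler_expR.
Qed.

(** The hypothesis on [l] is only effective for [l > 0], where [s = M] is the worst
    case. *)
Lemma mul_ln_le (s l : R) : 0 <= s <= M -> M * l <= ln M -> s * l <= ln M.
Proof.
move=> /andP[s0 sM] h; have [l0|l0] := leP l 0.
  by apply: le_trans lnM_ge0; rewrite mulr_ge0_le0.
by apply: le_trans h; rewrite ler_wpM2r// ltW.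
Qed.

Lemma powR_bounded (x s : R) : 0 < x -> M * ln x <= ln M -> 0 <= s <= M ->
  0 <= x `^ s <= M.
Proof.
move=> x0 hx s0M; rewrite powR_ge0/= /powR gt_eqF//.
by rewrite -[leRHS](@lnK _ M) ?posrE// ler_expR mul_ln_le.
Qed.

(** The derivative in the seed is [p * ln p * ln y], with [p] the value of the two
    floors; the unbounded factor [ln x] of a single floor is absorbed in
    [p * ln p]. *)
Lemma two_floors_lipschitz (x y s t : R) : 0 < x -> 0 < y ->
  M * ln x <= ln M -> M * ln y <= ln M -> 0 <= s <= M -> 0 <= t <= M ->
  `|x `^ (y `^ s) - x `^ (y `^ t)| <= lip_const * `|ln y| * `|s - t|.
Proof.
move=> x0 y0 hx hy.
wlog st : s t / s < t.
  move=> H s0 t0; have [st|ts|->] := ltgtP s t; first exact: H.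
    by rewrite distrC [`|s - t|]distrC; exact: H.
  by rewrite !subrr normr0 mulr0.
move=> /andP[s0 sM] /andP[t0 tM].
pose h z : R := expR (ln x * expR (ln y * z)).
have hE z : h z = x `^ (y `^ z).
  by rewrite /h /powR gt_eqF// gt_eqF// [ln y * _]mulrC [ln x * _]mulrC.
have d1 z : is_derive z (1 : R) (fun z => ln y * z) (ln y).
  by apply: is_derive_eq; rewrite /GRing.scale/=; ring.
have d2 z : is_derive z (1 : R) (fun z => ln x * expR (ln y * z)) (ln x * (expR (ln y * z) * ln y)).
  have := @is_derive1_comp R expR _ z _ _ (is_derive_expR _) (d1 z) => d2.
  by apply: is_derive_eq; rewrite /GRing.scale/=; ring.
have d3 z : is_derive z (1 : R) h (h z * (ln x * (expR (ln y * z) * ln y))).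
  exact: (@is_derive1_comp R expR _ z _ _ (is_derive_expR _) (d2 z)).
have ch : {within `[s, t], continuous h}.
  apply: continuous_subspaceT => z.
  exact: is_derive1_continuous (d3 z).
have [z] := @MVT R h _ _ _ st (fun z _ => d3 z) ch.
rewrite in_itv/= => /andP[sz zt] e.
rewrite -!hE distrC e [`|s - t|]distrC normrM ler_wpM2r// !normrM.
have -> : `|h z| * (`|ln x| * (`|expR (ln y * z)| * `|ln y|)) =
   (`|h z| * `|ln x * expR (ln y * z)|) * `|ln y| by rewrite normrM; ring.
rewrite ler_wpM2r// ger0_norm ?expR_ge0//.
apply: expR_mul_le; rewrite mulrC; apply: mul_ln_le => //.
rewrite expR_ge0/= -[leRHS](@lnK _ M) ?posrE// ler_expR mulrC; apply: mul_ln_le => //.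
by apply/andP; split; lra.
Qed.

End lipschitz.

Section log_moment.
Context (R : realType) (a b r : R) (a_ge0 : 0 <= a) (ab : a < b) (r_gt0 : 0 < r).
Context (a_le1 : a <= 1) (b_ge1 : 1 <= b) (r_le : r * (1 + ln b) <= 1).

Let b_gt0 : 0 < b. Proof. exact: lt_le_trans b_ge1. Qed.
Let lnb_ge0 : 0 <= ln b. Proof. exact: ln_ge0. Qed.

Let C := lip_const (b `^ r).
Let s := r * ln b.

Let s_ge0 : 0 <= s. Proof. by rewrite mulr_ge0// ltW. Qed.
Let r_le_1s : r <= 1 - s. Proof. by move: r_le; rewrite mulrDr mulr1 -/s; lra. Qed.
Let C_E : C = Num.max (expR (- 1)) (s * expR s).
Proof.
rewrite /C /lip_const ln_powR -/s; congr Num.max.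
by rewrite mulrC /powR (gt_eqF b_gt0).
Qed.

(** The first entry covers [lip_const = expR (- 1)], the second one
    [lip_const = s * expR s]. *)
Definition rate : R := Num.max (2 * expR (- 1)) (s * (2 - s)).

Let exp1 : 2 * expR (- 1) < 1 :> R.
Proof.
rewrite expRN ltr_pdivrMr ?expR_gt0// mul1r.
by have := @expR_gt1Dx R 1; rewrite oner_eq0 => /(_ isT); lra.
Qed.

Lemma rate_lt1 : rate < 1.
Proof.
have r0 := r_gt0; have s0 := s_ge0; have rs := r_le_1s.
rewrite gt_max exp1/=; have : 0 < (1 - s) * (1 - s) by rewrite mulr_gt0//; lra.
lra.
Qed.

Lemma rate_ge0 : 0 <= rate.
Proof. by rewrite le_max mulr_ge0 ?expR_ge0. Qed.

Let exp_le (v : R) : v < 1 -> expR v * (1 - v) <= 1.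
Proof.
move=> v1; have := expR_ge1Dx (- v) => /(ler_wpM2l (expR_ge0 v)).
by rewrite -expRD subrr expR0.
Qed.

(** For the part [V <= 1], compared on average in [integral_abs_ln_le]. With
    [r <= 1 - s] it reduces to [expR s * (1 - s) <= 1]. *)
Lemma lip_const_rate_small : C * (r * (1 + r)) <= rate.
Proof.
have r0 := r_gt0; have s0 := s_ge0; have rs := r_le_1s; have r1 : r <= 1 by lra.
have rr : r * (1 + r) <= (1 - s) * (2 - s).
  by apply: ler_pM; lra.
have rr2 : r * (1 + r) <= 2 by nra.
have rr0 : 0 <= r * (1 + r) by rewrite mulr_ge0//; lra.
rewrite C_E maxr_pMl// ge_max; apply/andP; split.
  rewrite le_max mulrC ler_wpM2r ?expR_ge0//.
rewrite le_max; apply/orP; right.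
have h := exp_le (v := s); have {}h : expR s * (1 - s) <= 1 by apply: h; lra.
have h1 : s * expR s * (r * (1 + r)) <= s * expR s * ((1 - s) * (2 - s)).
  by rewrite ler_wpM2l// mulr_ge0// expR_ge0.
have h2 : s * (2 - s) * (expR s * (1 - s)) <= s * (2 - s) * 1.
  by rewrite ler_wpM2l// mulr_ge0//; lra.
lra.
Qed.

(** With [v = r * ln u], the function [v * expR (- v)] increases on [[0, s]] as
    [s <= 1], and at [v = s] the bound is [s ^+ 2 <= s * (2 - s)]. *)
Lemma lip_const_rate_large u : 1 <= u <= b -> C * (r * ln u) <= rate * u `^ r.
Proof.
move=> /andP[u1 ub]; have u0 : 0 < u by exact: lt_le_trans u1.
have r0 := r_gt0; have s0 := s_ge0; have rs := r_le_1s.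
pose v := r * ln u; have v0 : 0 <= v by rewrite mulr_ge0 ?ln_ge0// ltW.
have vs : v <= s by rewrite ler_pM2l// ler_ln ?posrE.
rewrite -/v (_ : u `^ r = expR v); last by rewrite /powR gt_eqF.
have h := expR_ge1Dx v; have ev := expR_ge0 v.
rewrite C_E maxr_pMl// ge_max; apply/andP; split.
  apply: (@le_trans _ _ (2 * expR (- 1) * expR v)); last first.
    by rewrite ler_wpM2r// le_max lexx.
  rewrite [2 * _]mulrC -mulrA ler_wpM2l ?expR_ge0//; lra.
apply: (@le_trans _ _ (s * (2 - s) * expR v)); last first.
  by rewrite ler_wpM2r// le_max lexx orbT.
have h1 : expR (s - v) * (1 - (s - v)) <= 1 by apply: exp_le; lra.
have sv : v <= s * (1 - (s - v)) by nra.
have h2 : v * expR (s - v) <= s.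
  apply: (@le_trans _ _ (s * (1 - (s - v)) * expR (s - v))).
    by rewrite ler_wpM2r ?expR_ge0.
  by rewrite -mulrA [_ * expR _]mulrC -[leRHS]mulr1 ler_wpM2l.
have -> : expR s = expR v * expR (s - v) by rewrite -expRD; congr expR; ring.
have h3 : s * expR v * (v * expR (s - v)) <= s * expR v * s.
  by rewrite ler_wpM2l// mulr_ge0.
have h4 : s * expR v * s <= s * expR v * (2 - s).
  by rewrite ler_wpM2l ?mulr_ge0//; lra.
lra.
Qed.

End log_moment.

(** * Moments of the target law and of the inverse tower law *)

Section moments.
Context (R : realType) (a b r : R) (a_ge0 : 0 <= a) (ab : a < b) (r_gt0 : 0 < r).
Context (a_le1 : a <= 1) (b_ge1 : 1 <= b) (r_le : r * (1 + ln b) <= 1).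

Let b_gt0 : 0 < b. Proof. exact: lt_le_trans b_ge1. Qed.

Let mln (c d : R) : measurable_fun `]c, d]%classic (fun u : R => `|ln u|%:E).
Proof.
apply/measurable_EFinP; apply: measurable_funTS.
by apply: measurableT_comp => //; exact: measurable_ln.
Qed.

Let mpow (c d : R) : measurable_fun `]c, d]%classic (fun u : R => (u `^ r)%:E).
Proof. by apply/measurable_EFinP; apply: measurable_funTS; exact: measurable_powR. Qed.

Lemma integral_abs_ln (c : R) : 0 < c -> c < 1 ->
  (\int[mu]_(u in `]c, 1%R]) `|ln u|%:E = (1 - (c - c * ln c))%R%:E)%E.
Proof.
move=> c0 c1.
have -> : (\int[mu]_(u in `]c, 1%R]) `|ln u|%:E = \int[mu]_(u in `]c, 1%R]) (- ln u)%:E)%E.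
  apply: eq_integral => u /[!inE]/= /[!in_itv]/= /andP[_ u1].
  by rewrite ler0_norm// ln_le0.
have mL : measurable_fun setT (fun u : R => - ln u).
  by apply: measurableT_comp => //; exact: measurable_ln.
have dL (u : R) : c <= u <= 1 -> is_derive u (1 : R) (fun u => u - u * ln u) (- ln u).
  move=> /andP[cu _]; have u0 := lt_le_trans c0 cu.
  have d1 := is_derive1_ln u0.
  apply: is_derive_eq; rewrite /GRing.scale/=; field.
  by rewrite gt_eqF.
have cL (u : R) : c <= u <= 1 -> {for u, continuous (fun u => - ln u)}.
  move=> /andP[cu _]; apply: cvgN.
  exact: (continuous_ln (lt_le_trans c0 cu)).
by rewrite (integral_derivative c1 mL dL cL) ln1 mulr0 subr0.
Qed.

Lemma integral_power c : 0 < c -> c < 1 ->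
  (\int[mu]_(u in `]c, 1%R]) (u `^ r)%:E = ((1 - c * c `^ r) / (1 + r))%:E)%E.
Proof.
move=> c0 c1; have r1 : 1 + r != 0 by rewrite gt_eqF// addr_gt0.
have dP (u : R) : c <= u <= 1 -> is_derive u (1 : R) (fun u => u `^ (1 + r) / (1 + r)) (u `^ r).
  move=> /andP[cu _]; have u0 := lt_le_trans c0 cu.
  have d1 := is_derive1_powR (1 + r) u0.
  apply: is_derive_eq; rewrite /GRing.scale/=.
  have -> : 1 + r - 1 = r by ring.
  by field.
have cP (u : R) : c <= u <= 1 -> {for u, continuous (fun u => u `^ r)}.
  move=> /andP[cu _]; exact: (continuous_powRl (lt_le_trans c0 cu)).
rewrite (integral_derivative c1 (measurable_powR r) dP cP).
rewrite powR1 -mulrBl powRD ?powRr1 ?(ltW c0)//.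
by rewrite (gt_eqF c0) implybT.
Qed.

(** The logarithm is not dominated pointwise near [0], but it is on average: on
    [`]c, 1]] the difference of the two sides is
    [c * (1 - c `^ r - ln c) >= 0]. The endpoint [c] then decreases to [a], as the
    case [a = 0] gives an improper integral. *)
Lemma integral_abs_ln_le :
  (\int[mu]_(u in `]a, 1%R]) `|ln u|%:E <=
   (1 + r)%:E * \int[mu]_(u in `]a, 1%R]) (u `^ r)%:E)%E.
Proof.
move: a_le1; rewrite le_eqVlt => /orP[/eqP->|a1].
  by rewrite set_itvoc0 !integral_set0 mule0.
pose c n : R := a + (1 - a) / n.+2%:R.
have a1' : 0 < 1 - a by rewrite subr_gt0.
have ac n : a < c n by rewrite ltrDl divr_gt0.
have c1 n : c n < 1.
  by rewrite /c -ltrBrDl ltr_pdivrMr// ltr_pMr// ltr1n.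
have c0 n : 0 < c n by exact: le_lt_trans (ac n).
have cup : \bigcup_n `]c n, 1%R]%classic = `]a, 1%R]%classic.
  apply/seteqP; split => [u [n _]|u] /=; rewrite !in_itv/= => /andP[u1 u2].
    by rewrite u2 (lt_trans (ac n)).
  have ua : 0 < u - a by rewrite subr_gt0.
  exists (Num.bound ((1 - a) / (u - a))) => //=; rewrite in_itv/= u2 andbT.
  rewrite /c -ltrBrDl ltr_pdivrMr// mulrC -ltr_pdivrMr//.
  apply: (lt_trans (archi_boundP _)); first by rewrite divr_ge0// ltW.
  by rewrite ltr_nat ltnS leqnSn.
have cvg_ln : (\int[mu]_(u in `]c n, 1%R]) `|ln u|%:E)%E @[n --> \oo] -->
    (\int[mu]_(u in `]a, 1%R]) `|ln u|%:E)%E.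
  rewrite -cup; apply: ge0_nondecreasing_set_cvg_integral => [|//|n|//]; last exact: mln.
  move=> m n mn; apply/subsetPset => u /=; rewrite !in_itv/= => /andP[u1 ->].
  rewrite andbT (le_lt_trans _ u1)// lerD2l ler_pM2l// lef_pV2 ?posrE ?ltr0n//.
  by rewrite ler_nat.
apply: (cvge_to_le cvg_ln); apply: nearW => n.
have sub : (\int[mu]_(u in `]c n, 1%R]) (u `^ r)%:E <= \int[mu]_(u in `]a, 1%R]) (u `^ r)%:E)%E.
  apply: ge0_subset_integral => //; first exact: mpow.
    by move=> u _; rewrite lee_fin powR_ge0.
  by move=> u /=; rewrite !in_itv/= => /andP[u1 ->]; rewrite (lt_trans (ac n)).
apply: le_trans (lee_wpmul2l _ sub); last by rewrite lee_fin addr_ge0// ltW.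
rewrite integral_abs_ln// integral_power// -EFinM lee_fin.
rewrite [leRHS]mulrC divfK ?gt_eqF ?addr_gt0// lerD2l lerN2.
rewrite -[X in _ <= X - _]mulr1 -mulrBr ler_pM2l//.
apply: (@le_trans _ _ 1); last by rewrite lerDl oppr_ge0 ln_le0// ltW.
by rewrite -[leRHS](one_powR r) le_powRl// ltW.
Qed.

Lemma power_law_integral (g : R -> \bar R) : measurable_fun setT g -> (forall t, 0 <= g t)%E ->
  (\int[power_law r ab]_t g t = (b - a)^-1%:E * \int[mu]_(u in `]a, b]) g (u `^ r)%R)%E.
Proof.
move=> mg g0.
have := @ge0_integral_distribution _ _ _ _ _ (unif ab) (rv (@measurable_powR R r)) g mg g0.
move=> ->; rewrite integral_unif//; first exact: (measurableT_comp mg (measurable_powR r)).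
by move=> u; exact: g0.
Qed.

Definition power_mean : \bar R := (\int[power_law r ab]_t `|t|%:E)%E.

Let mabs : measurable_fun setT (fun t : R => `|t|%:E).
Proof. by apply/measurable_EFinP; exact: normr_measurable. Qed.

Let mlnT : measurable_fun setT (fun u : R => `|ln u|%:E).
Proof.
apply/measurable_EFinP.
by apply: measurableT_comp => //; exact: measurable_ln.
Qed.

Lemma power_meanE :
  power_mean = ((b - a)^-1%:E * \int[mu]_(u in `]a, b]) (u `^ r)%:E)%E.
Proof.
rewrite /power_mean power_law_integral//.
by congr (_ * _)%E; apply: eq_integral => u _; rewrite ger0_norm// powR_ge0.
Qed.

Let ba_gt0 : 0 < (b - a)^-1. Proof. by rewrite invr_gt0 subr_gt0. Qed.

Lemma power_mean_gt0 : (0 < power_mean)%E.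
Proof.
rewrite power_meanE mule_gt0 ?lte_fin//.
pose m := (a + b) / 2; have am : a < m by rewrite midf_lt.
have mb : m < b by rewrite midf_lt.
have m0 : 0 < m by exact: le_lt_trans am.
have sub : `]m, b]%classic `<=` `]a, b]%classic.
  by move=> u /=; rewrite !in_itv/= => /andP[mu ->]; rewrite (lt_trans am).
apply: (@lt_le_trans _ _ (\int[mu]_(u in `]m, b]) (m `^ r)%:E)%E); last first.
  apply: (@le_trans _ _ (\int[mu]_(u in `]m, b]) (u `^ r)%:E)%E); last first.
    apply: ge0_subset_integral => //; last by move=> u _; rewrite lee_fin powR_ge0.
    exact: mpow.
  apply: ge0_le_integral => //.
  - by move=> u _; rewrite lee_fin powR_ge0.
  - exact: mpow.
  - move=> u /=; rewrite in_itv/= => /andP[mu _]; rewrite lee_fin.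
    by rewrite le_powRl// ltW.
rewrite integral_cst//= lebesgue_measure_itv/= lte_fin mb -EFinB -EFinM lte_fin.
by rewrite mulr_gt0 ?powR_gt0// subr_gt0.
Qed.

Lemma power_mean_fin : (power_mean < +oo)%E.
Proof.
rewrite power_meanE.
apply: (@le_lt_trans _ _ ((b - a)^-1%:E * \int[mu]_(u in `]a, b]) (b `^ r)%:E)%E).
  rewrite lee_wpmul2l ?lee_fin ?(ltW ba_gt0)//; apply: ge0_le_integral => //.
  - by move=> u _; rewrite lee_fin powR_ge0.
  - exact: mpow.
  - move=> u /=; rewrite in_itv/= => /andP[au ub]; rewrite lee_fin.
    by rewrite le_powRl// ltW// (le_lt_trans a_ge0).
by rewrite integral_cst//= lebesgue_measure_itv/= lte_fin ab -EFinB -!EFinM ltry.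
Qed.

(** [V <= 1] and [V >= 1] are treated separately. *)
Lemma power_law_log_moment :
  ((lip_const (b `^ r))%:E * \int[power_law r ab]_t `|ln t|%:E <=
   (rate b r)%:E * power_mean)%E.
Proof.
rewrite power_meanE power_law_integral//.
rewrite !(muleCA _ (b - a)^-1%:E) lee_pmul2l ?fin_numE//.
have C0 := lip_const_gt0 (b `^ r).
have split f : measurable_fun setT f -> (forall u, 0 <= f u)%E ->
    (\int[mu]_(u in `]a, b]) f u = \int[mu]_(u in `]a, 1%R]) f u + \int[mu]_(u in `]1%R, b]) f u)%E.
  move=> mf f0; rewrite -ge0_integral_setU//.
  - by rewrite -itv_bndbnd_setU.
  - exact: measurable_funTS.
  - rewrite disj_set2E; apply/eqP; apply/seteqP; split => // z /=.
    by rewrite !in_itv/= => -[/andP[_ zd] /andP[dz _]]; move: (lt_le_trans dz zd); rewrite ltxx.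
have -> : (\int[mu]_(u in `]a, b]) `|ln (u `^ r)|%:E = \int[mu]_(u in `]a, b]) `|(r * ln u)%R|%:E)%E.
  by apply: eq_integral => u _; rewrite ln_powR.
have mrl : measurable_fun setT (fun u : R => `|r * ln u|%:E).
  apply/measurable_EFinP; apply: measurableT_comp => //.
  by apply: measurable_funM => //; exact: measurable_ln.
have mp : measurable_fun setT (fun u : R => (u `^ r)%:E).
  by apply/measurable_EFinP; exact: measurable_powR.
rewrite (split _ mrl)// (split _ mp)//; last by move=> u; rewrite lee_fin powR_ge0.
have nn c d (f : R -> R) : (forall u, 0 <= f u) -> (0 <= \int[mu]_(u in `]c, d]) (f u)%:E)%E.
  by move=> f0; apply: integral_ge0 => u _; rewrite lee_fin.
have p0 (u : R) : 0 <= u `^ r by exact: powR_ge0.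
have I1 := nn a 1 _ p0; have I2 := nn 1 b _ p0.
have I3 := nn a 1 _ (fun u => normr_ge0 (r * ln u)).
have I4 := nn 1 b _ (fun u => normr_ge0 (r * ln u)).
rewrite (ge0_muleDr _ I3 I4) (ge0_muleDr _ I1 I2).
apply: leeD.
  have -> : (\int[mu]_(u in `]a, 1%R]) `|(r * ln u)%R|%:E = r%:E * \int[mu]_(u in `]a, 1%R]) `|ln u|%:E)%E.
    rewrite -ge0_integralZl//; [|exact: mln|by rewrite lee_fin ltW].
    by apply: eq_integral => u _; rewrite normrM (gtr0_norm r_gt0).
  apply: (@le_trans _ _ ((lip_const (b `^ r))%:E * (r%:E * ((1 + r)%:E * \int[mu]_(u in `]a, 1%R]) (u `^ r)%:E)))%E).
    by rewrite !lee_wpmul2l ?lee_fin ?(ltW C0) ?(ltW r_gt0)// integral_abs_ln_le.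
  rewrite !muleA -!EFinM -mulrA lee_wpmul2r// lee_fin.
  exact: lip_const_rate_small.
rewrite -!ge0_integralZl//; try by rewrite lee_fin ?rate_ge0 ?(ltW C0).
- apply: ge0_le_integral => //.
  - by move=> u _; rewrite -EFinM lee_fin mulr_ge0// ltW.
  - by apply: measurable_funeM; exact: measurable_funTS.
  - by apply: measurable_funeM; exact: measurable_funTS.
  - move=> u /=; rewrite in_itv/= => /andP[u1 ub]; rewrite -!EFinM lee_fin.
    rewrite ger0_norm ?mulr_ge0 ?(ltW r_gt0) ?ln_ge0 ?(ltW u1)//.
    by apply: lip_const_rate_large => //; rewrite (ltW u1).
- exact: measurable_funTS.
- by move=> u _; rewrite lee_fin powR_ge0.
- exact: measurable_funTS.
Qed.

(** [`|ln (A `^ T)| = T * `|ln A|] with [A] and [T] independent, and [A `^ T] is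
    distributed as [T]. *)
Lemma log_moment_factor :
  (\int[power_law r ab]_t `|ln t|%:E =
   (\int[inverse_law a_ge0 ab r_gt0 a_le1 b_ge1 r_le]_x `|ln x|%:E) * power_mean)%E.
Proof.
set nu := inverse_law _ _ _ _ _ _.
have mpq : measurable_fun setT (fun p : R * R => `|ln (powp p)|%:E).
  exact: (measurableT_comp mlnT (@measurable_powp R)).
have := @eq_law_integral _ _ _ (power_law r ab) _ _ (nu \x power_law r ab)%E _ _ id (@powp R)
  (fun t => `|ln t|%:E) (@measurable_id _ _ _) (@measurable_powp R) mlnT.
move=> ->; last 2 first.
- by move=> t; rewrite lee_fin.
- by move=> B mB; exact: (inverse_law_fixpoint a_ge0 ab r_gt0 a_le1 b_ge1 r_le mB).
rewrite [LHS](fubini_tonelli1 (fun p : R * R => `|ln (powp p)|%:E) mpq) => [|p]; last by rewrite lee_fin.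
rewrite /fubini_F/= muleC -ge0_integralZl//; last by apply: integral_ge0 => t _; rewrite lee_fin.
apply: eq_integral => x _; rewrite muleC -ge0_integralZl//; try exact: mabs.
by apply: eq_integral => t _; rewrite /powp/= ln_powR normrM mulrC EFinM.
Qed.

Lemma inverse_law_log_moment :
  ((lip_const (b `^ r))%:E *
    \int[inverse_law a_ge0 ab r_gt0 a_le1 b_ge1 r_le]_x `|ln x|%:E <= (rate b r)%:E)%E.
Proof.
have := power_law_log_moment; rewrite log_moment_factor muleA.
rewrite lee_pmul2r ?power_mean_gt0//.
by rewrite ge0_fin_numE ?power_mean_fin// ltW// power_mean_gt0.
Qed.

End moments.

(** * Almost sure convergence of the towers *)

Lemma ae_prod1 (R : realType) d1 d2 (T1 : measurableType d1) (T2 : measurableType d2)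
  (P1 : probability T1 R) (P2 : probability T2 R) (Q : T1 -> Prop) :
  {ae P1, forall w, Q w} -> {ae (P1 \x P2)%E, forall w, Q w.1}.
Proof.
move=> [N [mN N0 QN]]; exists (N `*` setT); split.
- exact: measurableX.
- by rewrite product_measure1E//; apply/eqP; rewrite mule_eq0; apply/orP; left; apply/eqP.
- by move=> [w1 w2] /= h; split => //; exact: QN.
Qed.

Section convergence.
Context (R : realType) (f : R -> R) (mf : measurable_fun setT f) (M q : R).
Context (f_gt0 : forall u, 0 < f u) (M_ge1 : 1 <= M).
Context (f_le : forall u, M * ln (f u) <= ln M).

Let P := unif01 R.
Let C := lip_const M.

(** The tower of height [n] over the digits of [w], with seed [x] on its top. *)
Fixpoint seeded_tower (n : nat) (w x : R) : R :=
  if n is m.+1 then f (even_digits w) `^ seeded_tower m (odd_digits w) x else x.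

Lemma tower_seeded n w : tower (iid_fun f ^~ w) n = seeded_tower n w 1.
Proof.
elim: n w => [//|n IH] w /=; rewrite -IH; congr (_ `^ tower _ n).
by apply/funext => i; rewrite iid_funS.
Qed.

Lemma seeded_tower_bounded n w x : 0 <= x <= M -> 0 <= seeded_tower n w x <= M.
Proof.
by move=> xM; elim: n w => [//|n IH] w /=; apply: powR_bounded.
Qed.

Lemma seeded_towerD m n w x :
  seeded_tower (m + n) w x = seeded_tower m w (seeded_tower n (iter m (@odd_digits R) w) x).
Proof. by elim: m w => [//|m IH] w; rewrite addSn iterSr /= IH. Qed.

(** A Lipschitz constant in the seed for the first [n.*2] floors. *)
Fixpoint contraction (n : nat) (w : R) : R :=
  if n is m.+1 then
    C * `|ln (f (even_digits (odd_digits w)))| * contraction m (odd_digits (odd_digits w))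
  else 1.

Let C_ge0 : 0 <= C. Proof. exact/ltW/lip_const_gt0. Qed.

Lemma contraction_ge0 n w : 0 <= contraction n w.
Proof. by elim: n w => [|n IH] w //=; rewrite !mulr_ge0. Qed.

Lemma seeded_tower_lipschitz n w x y : 0 <= x <= M -> 0 <= y <= M ->
  `|seeded_tower n.*2 w x - seeded_tower n.*2 w y| <= contraction n w * `|x - y|.
Proof.
move=> xM yM; elim: n w => [|n IH] w; first by rewrite /= mul1r.
rewrite doubleS /=.
have bx := seeded_tower_bounded n.*2 (odd_digits (odd_digits w)) xM.
have by' := seeded_tower_bounded n.*2 (odd_digits (odd_digits w)) yM.
apply: (le_trans (two_floors_lipschitz M_ge1 (f_gt0 _) (f_gt0 _) (f_le _) (f_le _) bx by')).
by rewrite -[leRHS]mulrA ler_wpM2l// mulr_ge0.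
Qed.

(** Seeds no longer matter once [contraction n w] is small. *)
Lemma seeded_tower_close n k w x y : (n.*2 <= k)%N -> 0 <= x <= M -> 0 <= y <= M ->
  `|seeded_tower n.*2 w x - seeded_tower k w y| <= contraction n w * M.
Proof.
move=> nk xM yM; rewrite -(subnKC nk) seeded_towerD.
have := seeded_tower_bounded (k - n.*2) (iter n.*2 (@odd_digits R) w) yM.
set z := seeded_tower _ _ y => zM.
apply: (le_trans (seeded_tower_lipschitz n w xM zM)).
rewrite ler_wpM2l ?contraction_ge0//.
by case/andP: xM => ? ?; case/andP: zM => ? ?; rewrite ler_norml; apply/andP; split; lra.
Qed.

Lemma measurable_seeded_tower n :
  measurable_fun setT (fun p : R * R => seeded_tower n p.1 p.2).
Proof.
elim: n => [|n IH] /=; first exact: measurable_snd.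
apply: measurable_powR2.
  apply: (measurableT_comp mf); apply: (measurableT_comp (@measurable_even_digits R)).
  exact: measurable_fst.
have mshift : measurable_fun setT (fun p : R * R => (odd_digits p.1, p.2)).
  apply: measurable_fun_pair; last exact: measurable_snd.
  by apply: (measurableT_comp (@measurable_odd_digits R)); exact: measurable_fst.
exact: (measurableT_comp IH mshift).
Qed.

Lemma measurable_seeded_tower1 n x : measurable_fun setT (fun w => seeded_tower n w x).
Proof.
have mpair : measurable_fun setT (fun w : R => (w, x)).
  by apply: measurable_fun_pair; [exact: measurable_id|exact: measurable_cst].
exact: (measurableT_comp (measurable_seeded_tower n) mpair).
Qed.

Let mlnf : measurable_fun setT (fun u : R => `|ln (f u)|).
Proof.
apply: measurableT_comp => //; apply: measurableT_comp => //; exact: measurable_ln.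
Qed.

Lemma measurable_contraction n : measurable_fun setT (contraction n).
Proof.
have mo := @measurable_odd_digits R; have me := @measurable_even_digits R.
elim: n => [|n IH] /=; first exact: measurable_cst.
apply: measurable_funM; last by apply: (measurableT_comp IH); exact: measurableT_comp.
apply: measurable_funM; first exact: measurable_cst.
by apply: (measurableT_comp mlnf); exact: measurableT_comp.
Qed.

Context (log_moment : (C%:E * \int[iid_law mf]_x `|ln x|%:E <= q%:E)%E).
Context (q_lt1 : q < 1).

Let iid_log_moment : (\int[iid_law mf]_x `|ln x|%:E = \int[P]_u `|ln (f u)|%:E)%E.
Proof.
apply: (@ge0_integral_distribution _ _ _ _ _ P (rv mf) (fun x => `|ln x|%:E)) => //.
apply/measurable_EFinP; apply: measurableT_comp => //; exact: measurable_ln.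
Qed.

Lemma q_ge0 : 0 <= q.
Proof.
rewrite -lee_fin; apply: le_trans log_moment; rewrite mule_ge0 ?lee_fin//.
by apply: integral_ge0 => x _; rewrite lee_fin.
Qed.

Let odd_integral (g : R -> \bar R) : measurable_fun setT g -> (forall u, 0 <= g u)%E ->
  (\int[P]_w g (odd_digits w) = \int[P]_w g w)%E.
Proof.
move=> mg g0; apply: (@eq_law_integral _ _ _ P _ _ P _ _ (@odd_digits R) id) => //.
- exact: measurable_odd_digits.
- by move=> B mB; rewrite odd_digits_law.
Qed.

(** The factors of [contraction] are independent. *)
Lemma contraction_mean n : (\int[P]_w (contraction n w)%:E <= (q ^+ n)%:E)%E.
Proof.
elim: n => [|n IH].
  by rewrite /= integral_cst// mul1e expr0 [leLHS](probability_setT P).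
pose h (p : R * R) : \bar R := (C * `|ln (f p.1)| * contraction n p.2)%:E.
have mh : measurable_fun setT h.
  apply/measurable_EFinP; apply: measurable_funM.
    apply: measurable_funM; first exact: measurable_cst.
    by apply: (measurableT_comp mlnf); exact: measurable_fst.
  by apply: (measurableT_comp (measurable_contraction n)); exact: measurable_snd.
have h0 p : (0 <= h p)%E by rewrite lee_fin !mulr_ge0// contraction_ge0.
have meo : measurable_fun setT (fun x : R => (even_digits x, odd_digits x)).
  by apply: measurable_fun_pair; [exact: measurable_even_digits|exact: measurable_odd_digits].
have -> : (\int[P]_w (contraction n.+1 w)%:E =
    \int[P]_w h (even_digits (odd_digits w), odd_digits (odd_digits w)))%E by [].
rewrite (@odd_integral (fun w => h (even_digits w, odd_digits w)))//; last first.
  exact: (measurableT_comp mh meo).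
rewrite digits_integral//.
have I0 : (0 <= \int[P]_x `|ln (f x)|%:E)%E by apply: integral_ge0 => x _; rewrite lee_fin.
have inner y : (\int[P]_x h (x, y) =
    (C%:E * \int[P]_x `|ln (f x)|%:E) * (contraction n y)%:E)%E.
  rewrite muleC muleA -ge0_integralZl//.
  - by apply: eq_integral => x _; rewrite /h/= -!EFinM; congr EFin; ring.
  - by apply/measurable_EFinP.
  - by rewrite mule_ge0// lee_fin// contraction_ge0.
under eq_integral do rewrite inner.
rewrite ge0_integralZl//; last 3 first.
- by apply/measurable_EFinP; exact: measurable_contraction.
- by move=> x _; rewrite lee_fin contraction_ge0.
- by rewrite mule_ge0// lee_fin.
rewrite exprS EFinM lee_pmul//.
- by rewrite mule_ge0// lee_fin.
- by apply: integral_ge0 => x _; rewrite lee_fin contraction_ge0.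
- by rewrite -iid_log_moment.
Qed.

(** Markov's inequality, as the means of [contraction n] tend to [0]. *)
Lemma contraction_small k : {ae P, forall w, exists n, contraction n w < k.+1%:R^-1}.
Proof.
pose e : R := k.+1%:R^-1; have e0 : 0 < e by rewrite invr_gt0.
pose N := \bigcap_n [set w | e <= contraction n w].
have mE n : measurable [set w | e <= contraction n w].
  rewrite (_ : [set w | _] = contraction n @^-1` `[e, +oo[%classic).
    exact: (measurable_preimage (measurable_contraction n)).
  by apply/seteqP; split => w /=; rewrite in_itv/= andbT.
have mN : measurable N by apply: bigcap_measurableType.
exists N; split => //; last first.
  move=> w /= h n _ /=; rewrite leNgt; apply/negP => cn; apply: h.
  by exists n.
have bound n : (e%:E * P N <= (q ^+ n)%:E)%E.
  apply: le_trans (contraction_mean n).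
  rewrite -integral_cst//.
  apply: (@le_trans _ _ (\int[P]_(w in N) (contraction n w)%:E)%E).
    apply: ge0_le_integral => //.
    - by move=> x _; rewrite lee_fin ltW.
    - by apply/measurable_EFinP; apply: measurable_funTS; exact: measurable_contraction.
    - by move=> x /(_ n I) /=; rewrite lee_fin.
  apply: ge0_subset_integral => //.
  - by apply/measurable_EFinP; exact: measurable_contraction.
  - by move=> x _; rewrite lee_fin contraction_ge0.
have PN : P N = (fine (P N))%:E by rewrite fineK// fin_num_measure.
have : e * fine (P N) <= 0.
  have lim : q ^+ n @[n --> \oo] --> (0 : R) by apply: cvg_expr; rewrite ger0_norm// q_ge0.
  apply: (cvgr_to_ge lim); apply: nearW => n.
  by rewrite -lee_fin EFinM -PN bound.
rewrite pmulr_rle0// => h; apply/eqP; rewrite -measure_le0 -[leLHS]/(P N) PN lee_fin//.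
Qed.

Let M_ge0 : 0 <= M. Proof. exact: le_trans M_ge1. Qed.
Let zeroM : 0 <= (0 : R) <= M. Proof. by rewrite lexx. Qed.
Let oneM : 0 <= (1 : R) <= M. Proof. by rewrite ler01. Qed.

(** The upper limit is measurable and finite everywhere, also where the towers
    diverge. *)
Definition tower_limit (w : R) : R := limn_sup (fun n => seeded_tower n w 1).

Lemma measurable_tower_limit : measurable_fun setT tower_limit.
Proof.
apply: (@measurable_fun_limn_sup _ _ _ _ (fun n w => seeded_tower n w 1)).
- by move=> w _; exists M => _ [n _ <-]; have /andP[] := seeded_tower_bounded n w oneM.
- by move=> w _; exists 0 => _ [n _ <-]; have /andP[] := seeded_tower_bounded n w oneM.
- by move=> n; exact: measurable_seeded_tower1.
Qed.

(** Towers of height at least [n.*2] are within [contraction n w * M] of each other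
    whatever their seeds, so they form a Cauchy sequence with a common limit. *)
Lemma seeded_tower_cvg : {ae P, forall w, forall v, 0 <= v <= M ->
  seeded_tower n w v @[n --> \oo] --> tower_limit w}.
Proof.
apply: filterS (ae_foralln contraction_small) => w small.
have close e : 0 < e -> exists x, forall v, 0 <= v <= M ->
    \forall n \near \oo, `|x - seeded_tower n w v| < e.
  move=> e0; have eM : 0 < e / M by rewrite divr_gt0// (lt_le_trans ltr01).
  have [n hn] := small (Num.bound (e / M)^-1).
  exists (seeded_tower n.*2 w 0) => v vM; exists n.*2 => // k /= nk.
  apply: (le_lt_trans (seeded_tower_close w nk zeroM vM)).
  rewrite -ltr_pdivlMr ?(lt_le_trans ltr01)//; apply: (lt_trans hn).
  rewrite -[ltRHS]invrK ltf_pV2 ?posrE ?invr_gt0 ?ltr0n//.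
  apply: (lt_trans (archi_boundP _)); first by rewrite invr_ge0 ltW.
  by rewrite ltr_nat.
have cvg1 : cvgn (fun n => seeded_tower n w 1 : R).
  apply: cauchy_cvg; apply: cauchy_exP => e e0.
  by have [x hx] := close e e0; exists x; exact: hx.
have to1 : seeded_tower n w 1 @[n --> \oo] --> tower_limit w.
  by rewrite /tower_limit cvg_limn_supE.
move=> v vM; apply/cvgrPdist_lt => e e0.
have e3 : 0 < e / 3 by rewrite divr_gt0.
have [x hx] := close _ e3.
near=> n.
have h1 : `|tower_limit w - seeded_tower n w 1| < e / 3.
  by near: n; move/cvgrPdist_lt: to1; apply.
have h2 : `|x - seeded_tower n w 1| < e / 3 by near: n; exact: hx.
have h3 : `|x - seeded_tower n w v| < e / 3 by near: n; exact: hx.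
move: h1 h2 h3; rewrite !ltr_norml => /andP[? ?] /andP[? ?] /andP[? ?].
by apply/andP; split; lra.
Unshelve. all: by end_near. Qed.

Context (pl : probability R R).
Context (fixpoint : forall B, measurable B -> pl B = (iid_law mf \x pl)%E (powp @^-1` B)).
Context (pl_bounded : {ae pl, forall v, 0 <= v <= M}).

(** A random seed with law [pl], independent of the digits, is mapped to the same
    law by every floor. *)
Lemma seeded_tower_integral n (g : R -> \bar R) : measurable_fun setT g ->
  (forall t, 0 <= g t)%E ->
  (\int[pl]_v \int[P]_w g (seeded_tower n w v) = \int[pl]_t g t)%E.
Proof.
elim: n g => [|n IH] g mg g0.
  apply: eq_integral => v _; rewrite /= integral_cst//.
  by rewrite [X in (_ * X)%E](probability_setT P) mule1.
pose k (p : R * R) := g (f p.1 `^ p.2).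
have mk : measurable_fun setT k.
  apply: (measurableT_comp mg); apply: measurable_powR2.
    by apply: (measurableT_comp mf); exact: measurable_fst.
  exact: measurable_snd.
have k0 p : (0 <= k p)%E by exact: g0.
pose g' (t : R) : \bar R := fubini_G P k t.
have mg' : measurable_fun setT g' by exact: measurable_fun_fubini_tonelli_G.
have g'0 t : (0 <= g' t)%E by apply: integral_ge0 => x _; exact: k0.
have step v : (\int[P]_w g (seeded_tower n.+1 w v) = \int[P]_w g' (seeded_tower n w v))%E.
  pose h (p : R * R) := k (p.1, seeded_tower n p.2 v).
  have mh : measurable_fun setT h.
    apply: (measurableT_comp mk); apply: measurable_fun_pair; first exact: measurable_fst.
    by apply: (measurableT_comp (measurable_seeded_tower1 n v)); exact: measurable_snd.
  exact: (digits_integral mh (fun p => k0 _)).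
under eq_integral do rewrite step.
rewrite IH//.
have := @eq_law_integral _ _ _ pl _ _ (iid_law mf \x pl)%E _ _ id (@powp R) g
  (@measurable_id _ _ _) (@measurable_powp R) mg g0 fixpoint.
move=> ->; rewrite [RHS](fubini_tonelli2 (fun p : R * R => g (powp p)) (measurableT_comp mg (@measurable_powp R)) (fun p => g0 _)).
apply: eq_integral => t _; rewrite /g' /fubini_G.
apply: esym; apply: (@ge0_integral_distribution _ _ _ _ _ P (rv mf) (fun x => g (powp (x, t)))) => //.
apply: (measurableT_comp mg); apply: measurable_powR2; first exact: measurable_id.
exact: measurable_cst.
Qed.

(** The towers with random seed all have law [pl] and converge to [tower_limit]. *)
Lemma tower_limit_law B : measurable B -> P (tower_limit @^-1` B) = pl B.
Proof.
move=> mB.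
have mL := measurable_tower_limit.
have := @ae_limit_law _ _ _ (P \x pl)%E _ _ pl
  (fun n p => seeded_tower n p.1 p.2) (fun p => tower_limit p.1) (fun _ => id) id.
have <- : (P \x pl)%E ((fun p => tower_limit p.1) @^-1` B) = P (tower_limit @^-1` B).
  have -> : (fun p : R * R => tower_limit p.1) @^-1` B = (tower_limit @^-1` B) `*` setT.
    by apply/seteqP; split => -[x y] //= [].
  have mLB : measurable (tower_limit @^-1` B) by exact: (measurable_preimage mL).
  apply: etrans (product_measure1E P pl mLB measurableT) _.
  by rewrite [X in (_ * X)%E](probability_setT pl) mule1.
apply => //.
- by move=> n; exact: measurable_seeded_tower.
- by apply: (measurableT_comp mL); exact: measurable_fst.
- have a1 := ae_prod1 pl seeded_tower_cvg; have a2 := ae_prod2 P pl_bounded.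
  by apply: filterS2 a1 a2 => p h1 h2; exact: h1.
- by apply: aeW => v; exact: cvg_cst.
- move=> n D mD; have mI : measurable_fun setT (fun t : R => (\1_D t)%:E : \bar R).
    by apply/measurable_EFinP.
  have mS : measurable ((fun p : R * R => seeded_tower n p.1 p.2) @^-1` D).
    exact: (measurable_preimage (measurable_seeded_tower n)).
  have ind0 (t : R) : (0 <= (\1_D t)%:E :> \bar R)%E by rewrite lee_fin.
  have := seeded_tower_integral n mI ind0.
  rewrite [RHS]integral_indic// setIT => <-.
  rewrite -[_ @^-1` D]setIT -integral_indic//.
  apply: (fubini_tonelli2 (fun p : R * R => (\1_D (seeded_tower n p.1 p.2))%:E)).
    by apply: (measurableT_comp mI); exact: measurable_seeded_tower.
  by move=> p; exact: ind0.
Qed.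

End convergence.

(** * The characterization *)

Section inverse_tower_existence.
Context (R : realType) (a b r : R) (a_ge0 : 0 <= a) (ab : a < b) (r_gt0 : 0 < r).
Context (a_le1 : a <= 1) (b_ge1 : 1 <= b) (r_le : r * (1 + ln b) <= 1).

Let b_gt0 : 0 < b. Proof. exact: lt_le_trans b_ge1. Qed.

Lemma power_law_bounded : {ae power_law r ab, forall v, 0 <= v <= b `^ r}.
Proof.
have mN : measurable (~` `[0, b `^ r]%classic : set R) by exact: measurableC.
exists (~` `[0, b `^ r]%classic); split => //.
  have -> : power_law r ab (~` `[0, b `^ r]%classic) =
    unif ab ((fun v => v `^ r) @^-1` (~` `[0, b `^ r]%classic)) by [].
  rewrite unifE; last exact: (measurable_preimage (@measurable_powR R r)).
  rewrite (_ : _ `&` _ = set0) ?measure0 ?mule0// -subset0 => v [/=].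
  rewrite !in_itv/= powR_ge0/= => h /andP[av vb]; apply: h.
  by rewrite le_powRl// ltW// (le_lt_trans a_ge0).
Qed.

Context d (Omega : measurableType d) (P : probability Omega R) (U : {RV P >-> R}).
Context (U_unif : uniformly_distributed U ab).

Lemma inverse_law_inverse_tower :
  inverse_tower_distribution (rv_powR U r)
    (inverse_law a_ge0 ab r_gt0 a_le1 b_ge1 r_le).
Proof.
pose f := @tower_base R a b r.
have mf : measurable_fun setT f by exact: measurable_tower_base.
have f0 u : 0 < f u by exact: expR_gt0.
have M1 : 1 <= b `^ r by rewrite -[leLHS](one_powR r) le_powRl.
have f_le u : b `^ r * ln (f u) <= ln (b `^ r) by rewrite ln_powR; exact: ln_tower_base.
have moment := inverse_law_log_moment a_ge0 ab r_gt0 a_le1 b_ge1 r_le.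
have rate1 := rate_lt1 r_gt0 b_ge1 r_le.
have fixpoint B := @inverse_law_fixpoint R a b r a_ge0 ab r_gt0 a_le1 b_ge1 r_le B.
have cvgL := seeded_tower_cvg f0 M1 f_le moment rate1.
have lawL := tower_limit_law f0 M1 f_le moment rate1 fixpoint power_law_bounded.
have mL := measurable_tower_limit mf f0 M1 f_le.
exists _, _, (unif01 R), (iid_rv (measurable_tower_base a_ge0 ab r_gt0 a_le1 b_ge1 r_le)), (rv mL); split.
- exact: iid_rvP.
- by move=> i w; exact: f0.
- apply: filterS cvgL => w cw.
  have one : 0 <= (1 : R) <= b `^ r by rewrite ler01.
  have := cw 1 one; rewrite -[X in X @ _ --> _](_ : (fun n => tower (iid_fun f ^~ w) n) = _)//.
  by apply/funext => n; rewrite tower_seeded.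
- by move=> B mB; rewrite (power_lawE r U_unif mB); exact: lawL.
Qed.

End inverse_tower_existence.

Unset Implicit Arguments.

Theorem theorem3p1 (R : realType) (a b r : R) (a_ge0 : 0 <= a) (ab : a < b)
    (r_neq0 : r != 0) (d : measure_display) (Omega : measurableType d)
    (P : probability Omega R) (U : {RV P >-> R})
    (U_unif : uniformly_distributed U ab) :
  (has_tower_distribution (rv_powR U r) <->
     1 \in `[a, b] /\ r \in `[0, (1 + ln b)^-1]) /\
  (1 \in `[a, b] /\ r \in `[0, (1 + ln b)^-1] ->
     exists F : R -> R,
       unique (inverse_tower_cdf_eqn a b r) F /\
       forall nu : probability R R,
         inverse_tower_distribution (rv_powR U r) nu ->
         forall x : R, nu `]-oo, x]%classic = (F x)%:E).
Proof.
have conditions : 1 \in `[a, b] /\ r \in `[0, (1 + ln b)^-1] ->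
    [/\ 0 < r, a <= 1, 1 <= b & r * (1 + ln b) <= 1].
  rewrite !in_itv/= => -[/andP[a1 b1] /andP[r0 rb]].
  have lb : 0 < 1 + ln b by rewrite ltr_wpDr// ln_ge0.
  split => //; first by rewrite lt0r r_neq0.
  by rewrite -ler_pdivlMr// mul1r.
split; first split.
- by move=> [nu nu_inv]; exact: (inverse_tower_conditions a_ge0 r_neq0 U_unif nu_inv).
- move=> /conditions[r0 a1 b1 rb]; exists (inverse_law a_ge0 ab r0 a1 b1 rb).
  exact: inverse_law_inverse_tower.
- move=> /conditions[r0 a1 b1 rb].
  have nu_inv := inverse_law_inverse_tower a_ge0 r0 a1 b1 rb U_unif.
  exists (cdfR (inverse_law a_ge0 ab r0 a1 b1 rb)).
  have F_eqn := inverse_tower_cdf a_ge0 r0 a1 b1 U_unif nu_inv.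
  split; first by split => // F' F'_eqn; exact: (cdf_eqn_unique a_ge0 ab r0).
  move=> nu nu_inv' x; rewrite -cdfR_fin; congr EFin.
  have F'_eqn := inverse_tower_cdf a_ge0 r0 a1 b1 U_unif nu_inv'.
  by rewrite (cdf_eqn_unique a_ge0 ab r0 F'_eqn F_eqn).
Qed.
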